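(* Let $s\ge0$, $\frac25<b<\frac12$ and $0\le a\le 10b-4$. There exists a constant $C>0$ such that the following holds. Let $u_0\in H^s(\mathbb R)$, and let $T\in(0,\frac12]$ and $u\in X^{s,b}\cap C(\mathbb R_t;H^s(\mathbb R_x))$ be such that $u$ is the solution of $$u(t)=\eta(t)W(t)u_0+\eta(t)\int_0^tW(t-t')F_T(u(t'))\,dt',\qquad F_T(u(t'))=\eta\!\left(\tfrac{t'}{2T}\right)\left(-\tfrac12\partial_x(u(t'))^2\right).$$ Then the function $t\mapsto\int_0^tW(t-t')\left(-\frac12\partial_x(u(t'))^2\right)dt'$ belongs to $C([0,T];H^{s+a}(\mathbb R))$ and $$\left\|\int_0^{t}W(t-t')\left(-\tfrac12\partial_x(u(t'))^2\right)dt'\right\|_{C([0,T];H^{s+a}(\mathbb R))}\le C\|u\|_{X^{s,b}}^2.$$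
   Context: $\widehat{\cdot}$ denotes the Fourier transform (in $x$ with frequency $\xi$ for functions of $x$; in $(x,t)$ with frequencies $(\xi,\tau)$ for functions or distributions on $\mathbb R^2$), and $\langle\cdot\rangle:=1+|\cdot|$. $H^s(\mathbb R)$ is the usual $L^2$-based Sobolev space. $\{W(t)\}_{t\in\mathbb R}$ is the unitary group on $H^s(\mathbb R)$ defined by $[W(t)u_0]^\wedge(\xi)=e^{-it\xi^5}\widehat u_0(\xi)$. For $s,b\in\mathbb R$, the Bourgain space $X^{s,b}=X^{s,b}(\mathbb R^2)$ is the space of tempered distributions $u$ on $\mathbb R^2_{xt}$ with $\|u\|_{X^{s,b}}:=\|\langle\xi\rangle^s\langle\tau+\xi^5\rangle^b\widehat u(\xi,\tau)\|_{L^2_{\xi\tau}}<\infty$. The function $\eta$ of the time variable is a fixed bump function: $\eta\in C_0^\infty(\mathbb R)$, $\operatorname{supp}\eta\subset[-1,1]$, $\eta\equiv1$ on $[-\frac12,\frac12]$. Here $u(t)$ stands for $u(\cdot,t)$, and the norm of $C([0,T];H^{s+a}(\mathbb R))$ is the supremum over $t\in[0,T]$ of the $H^{s+a}(\mathbb R)$ norm. For $s\ge 0$, $\frac25<b<\frac12$ and $u_0\in H^s(\mathbb R)$, such $T$ and a unique such $u$ are provided by the paper's local well-posedness theorem. *)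

(* Defs.v *)
From HB Require Import structures.
From mathcomp Require Import all_boot all_order all_algebra.
From mathcomp Require Import all_classical all_reals all_analysis.
From mathcomp.real_closed Require Export complex.

Set Implicit Arguments.
Unset Strict Implicit.
Unset Printing Implicit Defensive.

Import Order.TTheory GRing.Theory Num.Theory.
Import numFieldNormedType.Exports.

Local Open Scope classical_set_scope.
Local Open Scope ring_scope.
Local Open Scope complex_scope.

Section ComplexIntegral.
Context {d : measure_display} {V : measurableType d} {R : realType}.
Variable mu : {measure set V -> \bar R}.
Implicit Types g : V -> R[i].

Definition cmeasurable g :=
  measurable_fun setT (fun x => complex.Re (g x)) /\
  measurable_fun setT (fun x => complex.Im (g x)).

Definition cintegrable g :=
  mu.-integrable setT (fun x => (complex.Re (g x))%:E) /\
  mu.-integrable setT (fun x => (complex.Im (g x))%:E).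

Definition cintegral (D : set V) g : R[i] :=
  Rintegral mu D (fun x => complex.Re (g x)) +i*
  Rintegral mu D (fun x => complex.Im (g x)).

End ComplexIntegral.

Section Schwartz.
Context {R : realType} {V : normedModType R}.

Definition iter_derive (vs : seq V) (f : V -> R) : V -> R :=
  foldr (fun v g => fun x => 'D_v g x) f vs.

Definition smooth (f : V -> R) := forall vs : seq V,
  continuous (iter_derive vs f) /\
  forall x v, derivable (iter_derive vs f) x v.

Definition schwartzR (f : V -> R) :=
  smooth f /\
  forall (k : nat) (vs : seq V), exists M : R, forall x : V,
    `|x| ^+ k * `|iter_derive vs f x| <= M.

Definition schwartz (phi : V -> R[i]) :=
  schwartzR (fun x => complex.Re (phi x)) /\
  schwartzR (fun x => complex.Im (phi x)).

(* A tempered distribution is represented by a functional defined on all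
   functions [V -> R[i]], of which only the values on Schwartz functions are
   meaningful. *)
Definition tempered (U : (V -> R[i]) -> R[i]) :=
  (forall (c : R[i]) phi psi, schwartz phi -> schwartz psi ->
     U (fun x => c * phi x + psi x) = c * U phi + U psi) /\
  exists (k : nat) (ws : seq (seq V)) (K : R), forall phi (M : R),
    schwartz phi ->
    (forall vs x, vs \in ws ->
       (1 + `|x|) ^+ k *
         `|iter_derive vs (fun y => complex.Re (phi y)) x| <= M /\
       (1 + `|x|) ^+ k *
         `|iter_derive vs (fun y => complex.Im (phi y)) x| <= M) ->
    ComplexField.Normc.normc (U phi) <= K * M.

Definition eq_dist (U1 U2 : (V -> R[i]) -> R[i]) :=
  forall phi, schwartz phi -> U1 phi = U2 phi.

Definition mul_dist (m : V -> R[i]) (U : (V -> R[i]) -> R[i]) :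
    (V -> R[i]) -> R[i] :=
  fun phi => U (fun x => m x * phi x).

End Schwartz.

(* [S] is the class of test functions; it is [schwartz] on R or on R * R. *)
Section FunctionDistributions.
Context {d : measure_display} {V : measurableType d} {R : realType}.
Variables (mu : {measure set V -> \bar R}) (S : (V -> R[i]) -> Prop).

Definition dist_of (g : V -> R[i]) : (V -> R[i]) -> R[i] :=
  fun phi => cintegral mu setT (fun x => g x * phi x).

Definition test_integrable (g : V -> R[i]) :=
  cmeasurable g /\
  forall phi, S phi -> cintegrable mu (fun x => g x * phi x).

Definition is_density (U : (V -> R[i]) -> R[i]) (g : V -> R[i]) :=
  test_integrable g /\ forall phi, S phi -> U phi = dist_of g phi.

(* The L^2 norm of [w * U]. A density of [U] is unique up to a null set, so
   the infimum is over a single value, or over the empty set (hence +oo) when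
   [U] is not a function. *)
Definition wL2norm (w : V -> R) (U : (V -> R[i]) -> R[i]) : \bar R :=
  ereal_inf [set Lnorm mu 2%:E
                   (fun x => (w x * ComplexField.Normc.normc (g x))%:E)
            | g in is_density U].

End FunctionDistributions.

Definition dist1 (R : realType) := (R -> R[i]) -> R[i].
Definition dist2 (R : realType) := (R * R -> R[i]) -> R[i].

Section Spaces.
Context {R : realType}.
Local Notation C := R[i].
Local Notation dist1 := (dist1 R).
Local Notation dist2 := (dist2 R).
Local Notation mu1 := (@lebesgue_measure R).
Local Notation mu2 := (mu1 \x mu1)%E.

Definition schwartz1 : (R -> C) -> Prop := @schwartz R R^o.
Definition schwartz2 : (R * R -> C) -> Prop := @schwartz R (R^o * R^o)%type.
Definition tempered1 : dist1 -> Prop := @tempered R R^o.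
Definition tempered2 : dist2 -> Prop := @tempered R (R^o * R^o)%type.

Definition dist1_of : (R -> C) -> dist1 := dist_of mu1.
Definition dist2_of : (R * R -> C) -> dist2 := dist_of mu2.

Definition bracket (x : R) : R := 1 + `|x|.

Definition cis (theta : R) : C := cos theta +i* sin theta.

Definition fourier1 (phi : R -> C) (xi : R) : C :=
  cintegral mu1 setT (fun x => cis (- (x * xi)) * phi x).

Definition inv_fourier1 (phi : R -> C) (x : R) : C :=
  ((2 * pi)^-1)%:C * cintegral mu1 setT (fun xi => cis (x * xi) * phi xi).

Definition fourier2 (phi : R * R -> C) (z : R * R) : C :=
  cintegral mu2 setT (fun y => cis (- (y.1 * z.1 + y.2 * z.2)) * phi y).

(* Fourier transform, its inverse and multiplication by a symbol are extended
   to distributions by duality, in the convention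
   U phi = \int U(x) phi(x) dx. *)
Definition fourier_dist1 (U : dist1) : dist1 := fun phi => U (fourier1 phi).
Definition inv_fourier_dist1 (U : dist1) : dist1 :=
  fun phi => U (inv_fourier1 phi).
Definition fourier_dist2 (U : dist2) : dist2 := fun phi => U (fourier2 phi).

Definition Dx (U : dist1) : dist1 := fun phi =>
  - U (fun x => 'D_1 (fun y : R => complex.Re (phi y)) x +i*
                'D_1 (fun y : R => complex.Im (phi y)) x).

Definition Hnorm (s : R) (U : dist1) : \bar R :=
  wL2norm mu1 schwartz1 (fun xi => bracket xi `^ s) (fourier_dist1 U).

Definition Hs (s : R) (U : dist1) := tempered1 U /\ (Hnorm s U < +oo)%E.

Definition Xnorm (s b : R) (U : dist2) : \bar R :=
  wL2norm mu2 schwartz2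
    (fun z => bracket z.1 `^ s * bracket (z.2 + z.1 ^+ 5) `^ b)
    (fourier_dist2 U).

Definition Xsb (s b : R) (U : dist2) := tempered2 U /\ (Xnorm s b U < +oo)%E.

Definition continuous_Hs (A : set R) (s : R) (v : R -> dist1) :=
  (forall t, A t -> Hs s (v t)) /\
  forall t0, A t0 ->
    (fun t => Hnorm s (v t \- v t0)) @ within A (nbhs t0) --> 0%E.

Definition CHnorm (A : set R) (s : R) (v : R -> dist1) : \bar R :=
  ereal_sup [set Hnorm s (v t) | t in A].

Definition slice (u : R * R -> C) (t : R) : R -> C := fun x => u (x, t).

(* An element of X^{s,b} that is also in C(R_t; H^s), for s, b >= 0; it is
   given by a jointly measurable function u(x, t) whose slice u(., t) is, for
   every t, a representative of the value at t of the H^s-valued curve. *)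
Definition XsbCHs (s b : R) (u : R * R -> C) :=
  [/\ test_integrable mu2 schwartz2 u,
      Xsb s b (dist2_of u),
      forall t, test_integrable mu1 schwartz1 (slice u t) &
      continuous_Hs setT s (fun t => dist1_of (slice u t))].

Definition W (t : R) (U : dist1) : dist1 :=
  inv_fourier_dist1
    (@mul_dist R R^o (fun xi => cis (- (t * xi ^+ 5))) (fourier_dist1 U)).

Definition cintegral_from0 (f : R -> C) (t : R) : C :=
  if 0 <= t then cintegral mu1 `[0, t] f else - cintegral mu1 `[t, 0] f.

(* The integral of a distribution-valued function is taken weakly. *)
Definition duhamel (F : R -> dist1) (t : R) : dist1 :=
  fun phi => cintegral_from0 (fun t' => W (t - t') (F t') phi) t.

Definition nonlin (u : R * R -> C) (t : R) : dist1 :=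
  fun phi => - (2^-1) * Dx (dist1_of (fun x => slice u t x ^+ 2)) phi.

Definition nonlin_cutoff (eta : R -> R) (T : R) (u : R * R -> C) (t : R) :
    dist1 :=
  fun phi => (eta (t / (2 * T)))%:C * nonlin u t phi.

Definition bump_function (eta : R -> R) :=
  [/\ @smooth R R^o eta,
      closure [set t | eta t != 0] `<=` `[-1, 1] &
      forall t, - 2^-1 <= t <= 2^-1 -> eta t = 1].

Definition solves_cutoff_equation (eta : R -> R) (T : R) (u0 : dist1)
    (u : R * R -> C) :=
  forall t, @eq_dist R R^o (dist1_of (slice u t))
    (fun phi => (eta t)%:C * W t u0 phi +
                (eta t)%:C * duhamel (nonlin_cutoff eta T u) t phi).

End Spaces.

(* Main.v *)
(* For t in [0, 1], the Fourier transform of the Duhamel term is the function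
     G_t(xi) = - (i xi / 2) \int\int e^{-i x xi} B_t(t', xi) u(x, t')^2 dx dt',
   with B_t(t', xi) = e^{-i (t - t') xi^5} 1_{[0, t]}(t').  The Fourier
   transform of B_t in t' is at most 4 / <tau + xi^5>, so G_t is controlled by
   the convolution of g = u^ with itself against <tau + xi^5>^-1.  By
   Cauchy-Schwarz, the H^{s+a} norm of G_t is at most a constant times
   ||u||_{X^{s,b}}^2 as soon as
     sup_xi  xi^2 <xi>^{2a} \int\int\int <tau1 + xi1^5>^{-2b} <tau2 + xi2^5>^{-2b}
               <tau1 + tau2 + xi^5>^{-2}  < oo      (xi = xi1 + xi2).
   Integrating out tau1 and tau2 leaves a power of the resonance function
     xi^5 - xi1^5 - xi2^5 = (5/2) xi xi1 xi2 (xi^2 + xi1^2 + xi2^2),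
   whose integral in xi1 is finite and of the right size because b > 2/5 and
   a <= 10 b - 4; on |xi| <= 1 the smaller exponent 3/5 is used instead of
   4 b - 1.  Continuity in t follows from dominated convergence applied to
   B_t - B_{t0}.

   That u^2 is integrable and is the limit in L^1 of functions whose Fourier
   transform is the convolution of regularizations of g is obtained by damping
   g with Gaussians, which convolves u with Gaussians. *)

From HB Require Import structures.
Require Import Defs.
From mathcomp Require Import all_boot all_order all_algebra.
From mathcomp Require Import all_classical all_reals all_analysis.
From mathcomp Require Import measurable_realfun.
From mathcomp Require Import ring lra.
Import Order.TTheory GRing.Theory Num.Theory.
Import numFieldNormedType.Exports.
Set Implicit Arguments.
Unset Strict Implicit.
Unset Printing Implicit Defensive.
Local Open Scope classical_set_scope.
Local Open Scope ring_scope.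
Local Open Scope complex_scope.

(** The convolution square of the density [g] is never formed as a function: it stays a weight on
    pairs of frequencies, pushed forward by addition. The passage to a fixed xi is replaced by
    duality. The transform [D] of [Bt * u^2] is continuous and bounded because [u^2] is integrable,
    so it can be tested against [hweight * gaus * conj D]. Young's inequality with a parameter then
    leaves less than half of the quantity to be bounded on the right. The Gaussian makes that
    quantity finite beforehand, so it can be absorbed, and Fatou removes the Gaussian; no finiteness
    of the H^{s+a} norm is assumed. The exponents come from scaling. With t = 4b - 1 the resonance
    integral is of size |xi|^{6-20b}, so for |xi| > 1 the total power is |xi|^{2a+8-20b}, bounded
    when a <= 10b - 4. Near 0 the power 8 - 20b is negative, which forces t = 3/5, where 2 + (1 -
    5t) = 0. The link between [u] and [g] is an identity of distributions. Gaussian plane waves are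
    the test functions that turn it into an identity of functions. *)

Local Notation normc := ComplexField.Normc.normc.
Local Notation Re := complex.Re.
Local Notation Im := complex.Im.

(** * Integration of real and complex functions *)

Section ComplexNorm.
Context {R : realType}.
Implicit Types z w : R[i].

Lemma normcE z : normc z = Num.sqrt (Re z ^+ 2 + Im z ^+ 2).
Proof. by case: z. Qed.

Lemma normc_ge0 z : 0 <= normc z.
Proof. by rewrite normcE sqrtr_ge0. Qed.

Lemma sqr_normc z : normc z ^+ 2 = Re z ^+ 2 + Im z ^+ 2.
Proof. by rewrite normcE sqr_sqrtr// addr_ge0// sqr_ge0. Qed.

Lemma normc_Re z : `|Re z| <= normc z.
Proof.
rewrite -(@ler_pXn2r _ 2%N) ?nnegrE// ?normc_ge0//.
by rewrite sqr_normc real_normK ?num_real// lerDl sqr_ge0.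
Qed.

Lemma normc_Im z : `|Im z| <= normc z.
Proof.
rewrite -(@ler_pXn2r _ 2%N) ?nnegrE// ?normc_ge0//.
by rewrite sqr_normc real_normK ?num_real// lerDr sqr_ge0.
Qed.

Lemma normc_le z : normc z <= `|Re z| + `|Im z|.
Proof.
rewrite -(@ler_pXn2r _ 2%N) ?nnegrE// ?normc_ge0 ?addr_ge0//.
rewrite sqr_normc sqrrD !real_normK ?num_real//.
by rewrite lerD2r lerDl mulrn_wge0// mulr_ge0.
Qed.

Lemma normc_real (x : R) : normc x%:C = `|x|.
Proof. by rewrite normcE /= expr0n/= addr0 sqrtr_sqr. Qed.

Lemma normc_cis (x : R) : normc (cis x) = 1.
Proof. by rewrite normcE/= cos2Dsin2 sqrtr1. Qed.

Lemma cisD (x y : R) : cis (x + y) = cis x * cis y.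
Proof.
rewrite /cis cosD sinD; simpc.
by congr (_ +i* _); rewrite addrC.
Qed.

Lemma cis0 : cis 0 = 1 :> R[i].
Proof. by rewrite /cis cos0 sin0. Qed.

Lemma cisN (x : R) : cis (- x) = conjc (cis x).
Proof. by rewrite /cis cosN sinN. Qed.

Lemma normc_conj z : normc (conjc z) = normc z.
Proof. by case: z => a b /=; rewrite sqrrN. Qed.

Lemma mulc_conj z : z * conjc z = (normc z ^+ 2)%:C.
Proof. by rewrite sqr_normc; case: z => a b; simpc; congr (_ +i* _) => /=; ring. Qed.

Lemma ReD z w : Re (z + w) = Re z + Re w. Proof. by case: z w => ? ? []. Qed.
Lemma ImD z w : Im (z + w) = Im z + Im w. Proof. by case: z w => ? ? []. Qed.
Lemma ReN z : Re (- z) = - Re z. Proof. by case: z. Qed.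
Lemma ImN z : Im (- z) = - Im z. Proof. by case: z. Qed.
Lemma ReM z w : Re (z * w) = Re z * Re w - Im z * Im w.
Proof. by case: z w => ? ? []. Qed.
Lemma ImM z w : Im (z * w) = Re z * Im w + Im z * Re w.
Proof. by case: z w => ? ? []. Qed.
Lemma complex_eq z w : Re z = Re w -> Im z = Im w -> z = w.
Proof. by case: z w => ? ? [? ?]/= -> ->. Qed.

Lemma normcN z : normc (- z) = normc z.
Proof. by rewrite !normcE ReN ImN !sqrrN. Qed.

Lemma normcD z w : normc (z + w) <= normc z + normc w.
Proof. by have := ler_normD z w; rewrite !normc_def -rmorphD lecR !normcE. Qed.

End ComplexNorm.

Section RealIntegrals.
Context d {V : measurableType d} {R : realType} (mu : {measure set V -> \bar R}).
Implicit Types f h : V -> R.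

Lemma le_integrableR f h : measurable_fun setT f ->
  mu.-integrable setT (EFin \o h) -> (forall x, `|f x| <= h x) ->
  mu.-integrable setT (EFin \o f).
Proof.
move=> mf ih fh; apply: le_integrable ih => //; first exact/measurable_EFinP.
by move=> x _ /=; rewrite lee_fin (le_trans (fh x))// ler_norm.
Qed.

Lemma integrable_measurable f : mu.-integrable setT (EFin \o f) ->
  measurable_fun setT f.
Proof. by move=> /measurable_int/measurable_EFinP. Qed.

Lemma integrableDR f h : mu.-integrable setT (EFin \o f) ->
  mu.-integrable setT (EFin \o h) ->
  mu.-integrable setT (EFin \o (fun x => f x + h x)).
Proof. by move=> fi hi; rewrite /comp/=; under eq_fun do rewrite EFinD; exact: integrableD. Qed.

Lemma integrableZR (c : R) f : mu.-integrable setT (EFin \o f) ->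
  mu.-integrable setT (EFin \o (fun x => c * f x)).
Proof. by move=> fi; rewrite /comp/=; under eq_fun do rewrite EFinM; exact: integrableZl. Qed.

Lemma Rintegral_fin f : mu.-integrable setT (EFin \o f) ->
  (\int[mu]_x (f x)%:E = (Rintegral mu setT f)%:E)%E.
Proof. by move=> fi; rewrite /Rintegral fineK//; exact: integrable_fin_num. Qed.

Lemma integrable_lty f : measurable_fun setT f -> (forall x, 0 <= f x) ->
  (\int[mu]_x (f x)%:E < +oo)%E -> mu.-integrable setT (EFin \o f).
Proof.
move=> mf f0 fi; apply/integrableP; split; first exact/measurable_EFinP.
by under eq_integral do rewrite /= ger0_norm//.
Qed.

(** Arbitrary functions are allowed because the integral of a nonnegative function is a supremum
    over the simple functions below it. This spares measurability proofs when iterated integrals are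
    compared. *)
Lemma ge0_le_integral_nm (f g : V -> \bar R) : (forall x, 0 <= f x)%E ->
  (forall x, f x <= g x)%E -> (\int[mu]_x f x <= \int[mu]_x g x)%E.
Proof.
move=> f0 fg; have g0 x : (0 <= g x)%E by exact: le_trans (fg x).
rewrite !ge0_integralTE//; apply: ge_ereal_sup => _ [h hf <-].
by apply: ereal_sup_ubound; exists h => // x; exact: le_trans (fg x).
Qed.

Definition liminfR (f_ : nat -> V -> R) (x : V) : \bar R := limn_einf (fun n => (f_ n x)%:E).

Lemma measurable_liminfR (f_ : nat -> V -> R) :
  (forall n, measurable_fun setT (f_ n)) -> measurable_fun setT (liminfR f_).
Proof.
move=> mf_; rewrite (_ : liminfR f_ =
    (fun x => - limn_esup (fun n => (- f_ n x)%:E))%E); last first.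
  apply/funext => x; rewrite -[LHS]oppeK -limn_esupN.
  by congr (- limn_esup _)%E; apply/funext => n; rewrite /= EFinN.
apply: measurableT_comp => //; apply: measurable_fun_limn_esup => n.
by apply/measurable_EFinP; exact: measurableT_comp.
Qed.

Lemma liminfR_cvg (f_ : nat -> V -> R) (x : V) (l : R) :
  f_ ^~ x @ \oo --> l -> liminfR f_ x = l%:E.
Proof.
move=> cx; have c1 : (fun n => (f_ n x)%:E) @ \oo --> l%:E by apply: cvg_EFin => //; exact: nearW.
by rewrite /liminfR is_cvg_limn_einfE; [rewrite (cvg_lim _ c1)|apply/cvg_ex; exists l%:E].
Qed.

Lemma liminfR_ge0 (f_ : nat -> V -> R) (x : V) : (forall n, 0 <= f_ n x) -> (0 <= liminfR f_ x)%E.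
Proof.
move=> f0; rewrite /liminfR limn_einf_lim; apply: lime_ge; first exact: is_cvg_einfs.
by apply: nearW => n; apply: le_ereal_inf_tmp => _ [k _ <-]; rewrite lee_fin.
Qed.

(** Fatou is split in two: this bound on the integral of the lower limit, and the identification of
    the lower limit with the true limit in [integral_ae_liminfR]. The sectionwise versions use this
    half on a product space and the other half on each section. *)
Lemma integral_liminfR (f_ : nat -> V -> R) (B : \bar R) :
  (forall n, measurable_fun setT (f_ n)) -> (forall n x, 0 <= f_ n x) ->
  (\forall n \near \oo, \int[mu]_x (f_ n x)%:E <= B)%E ->
  (\int[mu]_x liminfR f_ x <= B)%E.
Proof.
move=> mf_ f0_ leB; apply: le_trans.
  apply: (@fatou _ _ _ mu _ measurableT (fun n x => (f_ n x)%:E)).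
  - by move=> n; exact/measurable_EFinP.
  - by move=> n x _; rewrite lee_fin.
rewrite limn_einf_lim; apply: lime_le; first exact: is_cvg_einfs.
case: leB => N _ hN; near=> n.
apply: ereal_inf_le; exists (\int[mu]_x (f_ n x)%:E)%E.
  by exists n => //=.
by apply: hN => /=; near: n; exists N.
Unshelve. all: by end_near. Qed.

Lemma integral_ae_liminfR (f_ : nat -> V -> R) f :
  (forall n, measurable_fun setT (f_ n)) -> measurable_fun setT f ->
  {ae mu, forall x, f_ ^~ x @ \oo --> f x} ->
  (\int[mu]_x (f x)%:E = \int[mu]_x liminfR f_ x)%E.
Proof.
move=> mf_ mf cf; apply: ae_eq_integral => //; first exact/measurable_EFinP.
- exact: measurable_liminfR.
- by apply: filterS cf => x /= cx _; rewrite (liminfR_cvg cx).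
Qed.

Lemma fatou_bound (f_ : nat -> V -> R) f (B : \bar R) :
  (forall n, measurable_fun setT (f_ n)) -> measurable_fun setT f ->
  (forall n x, 0 <= f_ n x) ->
  {ae mu, forall x, f_ ^~ x @ \oo --> f x} ->
  (\forall n \near \oo, \int[mu]_x (f_ n x)%:E <= B)%E ->
  (\int[mu]_x (f x)%:E <= B)%E.
Proof.
by move=> mf_ mf f0_ cf leB; rewrite (integral_ae_liminfR mf_)//; exact: integral_liminfR.
Qed.

End RealIntegrals.

Section FubiniR.
Context d1 d2 {T1 : measurableType d1} {T2 : measurableType d2} {R : realType}.
Variables (m1 : {sigma_finite_measure set T1 -> \bar R})
          (m2 : {sigma_finite_measure set T2 -> \bar R}).
Implicit Types f : T1 * T2 -> R.

Lemma measurable_fineR (h : T1 -> \bar R) :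
  measurable_fun setT h -> measurable_fun setT (fun x => fine (h x)).
Proof. by move=> mh; apply: measurableT_comp => //; exact: measurable_fine. Qed.

(** Integrability of the sections plays no part: the integrals of the positive and negative parts
    are measurable by Tonelli, and [fine] sends infinite values to 0. *)
Lemma measurable_Rintegral2 f : measurable_fun setT f ->
  measurable_fun setT (fun x => Rintegral m2 setT (fun y => f (x, y))).
Proof.
move=> mf; apply: measurable_fineR.
have -> : (fun x => \int[m2]_y (f (x, y))%:E)%E = (fun x =>
    \int[m2]_y ((EFin \o f)^\+ (x, y)) - \int[m2]_y ((EFin \o f)^\- (x, y)))%E.
  apply/funext=> x; rewrite [LHS]integralE.
  by congr (_ - _)%E; apply: eq_integral => y _; rewrite ?funeposE ?funenegE.
have mEf : measurable_fun setT (EFin \o f) by exact/measurable_EFinP.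
apply: emeasurable_funB.
- apply: (@measurable_fun_fubini_tonelli_F _ _ _ _ _ m2 ((EFin \o f)^\+)%E) => //.
  exact: measurable_funepos.
- apply: (@measurable_fun_fubini_tonelli_F _ _ _ _ _ m2 ((EFin \o f)^\-)%E) => //.
  exact: measurable_funeneg.
Qed.

Lemma Rintegral_Fubini f : (m1 \x m2)%E.-integrable setT (EFin \o f) ->
  Rintegral (m1 \x m2)%E setT f =
  Rintegral m1 setT (fun x => Rintegral m2 setT (fun y => f (x, y))).
Proof.
move=> fi; rewrite {1}/Rintegral -(integral12_prod_meas1 fi) /Rintegral; congr fine.
apply: ae_eq_integral => //=.
- exact: measurable_fubini_F fi.
- apply/measurable_EFinP.
  exact: measurable_fineR (measurable_fubini_F fi).
- move: (ae_integrable1 fi) => /=; apply: filterS => x h _.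
  by rewrite /fubini_F/= fineK// integrable_fin_num.
Qed.

Lemma integrable_Rintegral f : (m1 \x m2)%E.-integrable setT (EFin \o f) ->
  m1.-integrable setT (fun x => (Rintegral m2 setT (fun y => f (x, y)))%:E).
Proof.
move=> fi.
have h := ae_integrable1 fi.
have e : ae_eq m1 setT (fubini_F m2 (EFin \o f))
    (fun x => (Rintegral m2 setT (fun y => f (x, y)))%:E).
  apply: filterS h => x h _.
  by rewrite /Rintegral /fubini_F/= fineK// integrable_fin_num.
have iF := integrable_fubini_F fi.
have mG : measurable_fun setT
    (fun x => (Rintegral m2 setT (fun y => f (x, y)))%:E).
  by apply/measurable_EFinP/measurable_Rintegral2; exact: integrable_measurable fi.
apply/integrableP; split=> //.
have /integrableP[mF] := iF; rewrite (@ae_eq_integral _ _ _ m1 setT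
  (fun x => `|(Rintegral m2 setT (fun y => f (x, y)))%:E|)%E)//.
- by apply: measurableT_comp.
- by apply: measurableT_comp.
- by apply: filterS e => x ex /ex ->.
Qed.

End FubiniR.

Section ComplexIntegrals.
Context d {V : measurableType d} {R : realType} (mu : {measure set V -> \bar R}).
Implicit Types f g : V -> R[i].
Local Notation cint := (cintegral mu setT).

Lemma cmeasurable_cst (c : R[i]) : cmeasurable (fun _ : V => c).
Proof. by split; exact: measurable_cst. Qed.

Lemma cmeasurable_real (f : V -> R) :
  measurable_fun setT f -> cmeasurable (fun x => (f x)%:C).
Proof. by move=> mf; split => //=; exact: measurable_cst. Qed.

Lemma cmeasurableD f g :
  cmeasurable f -> cmeasurable g -> cmeasurable (fun x => f x + g x).
Proof.
move=> [fr fi] [gr gi]; split.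
- by under eq_fun do rewrite ReD; exact: measurable_funD.
- by under eq_fun do rewrite ImD; exact: measurable_funD.
Qed.

Lemma cmeasurableN f : cmeasurable f -> cmeasurable (fun x => - f x).
Proof.
move=> [fr fi]; split.
- by under eq_fun do rewrite ReN; exact: measurableT_comp.
- by under eq_fun do rewrite ImN; exact: measurableT_comp.
Qed.

Lemma cmeasurableM f g :
  cmeasurable f -> cmeasurable g -> cmeasurable (fun x => f x * g x).
Proof.
move=> [fr fi] [gr gi]; split.
- by under eq_fun do rewrite ReM; apply: measurable_funB; exact: measurable_funM.
- by under eq_fun do rewrite ImM; apply: measurable_funD; exact: measurable_funM.
Qed.

Lemma cmeasurable_conj f : cmeasurable f -> cmeasurable (fun x => conjc (f x)).
Proof.
move=> [fr fi]; split.
- by rewrite (_ : (fun x => _) = (fun x => Re (f x)))//; apply/funext => x; case: (f x).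
- rewrite (_ : (fun x => _) = (fun x => - Im (f x))); first exact: measurableT_comp.
  by apply/funext => x; case: (f x).
Qed.

Lemma cmeasurable_cis (f : V -> R) :
  measurable_fun setT f -> cmeasurable (fun x => cis (f x)).
Proof.
move=> mf; split.
- apply: (measurableT_comp (f := @cos R)) => //; apply: continuous_measurable_fun.
  exact: continuous_cos.
- apply: (measurableT_comp (f := @sin R)) => //; apply: continuous_measurable_fun.
  exact: continuous_sin.
Qed.

Lemma measurable_normc f :
  cmeasurable f -> measurable_fun setT (fun x => normc (f x)).
Proof.
move=> [fr fi]; under eq_fun do rewrite normcE.
apply: measurableT_comp.
  by apply: continuous_measurable_fun; exact: sqrt_continuous.
by apply: measurable_funD; exact: measurable_funX.
Qed.

Lemma le_cintegrable f (h : V -> R) : cmeasurable f ->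
  mu.-integrable setT (EFin \o h) -> (forall x, normc (f x) <= h x) ->
  cintegrable mu f.
Proof.
move=> [fr fi] ih fh; split.
- by apply: (le_integrableR fr ih) => x; exact: le_trans (normc_Re _) (fh x).
- by apply: (le_integrableR fi ih) => x; exact: le_trans (normc_Im _) (fh x).
Qed.

Lemma cintegrable_measurable f : cintegrable mu f -> cmeasurable f.
Proof. by move=> [fr fi]; split; [exact: integrable_measurable fr|exact: integrable_measurable fi]. Qed.

Lemma cintegrable_norm f : cintegrable mu f ->
  mu.-integrable setT (EFin \o (fun x => normc (f x))).
Proof.
move=> cf; have [fr fi] := cf.
apply: (@le_integrableR _ _ _ _ _ (fun x => `|Re (f x)| + `|Im (f x)|)).
- exact/measurable_normc/cintegrable_measurable.
- by apply: integrableDR; exact: integrable_norm.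
- by move=> x; rewrite ger0_norm ?normc_ge0// normc_le.
Qed.

Lemma cintegrableD f g : cintegrable mu f -> cintegrable mu g ->
  cintegrable mu (fun x => f x + g x).
Proof.
move=> [fr fi] [gr gi]; split.
- by under eq_fun do rewrite ReD; exact: integrableDR.
- by under eq_fun do rewrite ImD; exact: integrableDR.
Qed.

Lemma cintegrableM f (c : V -> R[i]) (B : R) : cintegrable mu f ->
  cmeasurable c -> (forall x, normc (c x) <= B) ->
  cintegrable mu (fun x => c x * f x).
Proof.
move=> cf mc cB.
apply: (@le_cintegrable _ (fun x => B * normc (f x))).
- exact/cmeasurableM/cintegrable_measurable.
- exact/integrableZR/cintegrable_norm.
- by move=> x; rewrite ComplexField.Normc.normcM ler_wpM2r// normc_ge0.
Qed.

Lemma cintegrableZ f (c : R[i]) : cintegrable mu f ->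
  cintegrable mu (fun x => c * f x).
Proof.
by move=> cf; apply: (@cintegrableM _ (fun=> c) (normc c)) => //; exact: cmeasurable_cst.
Qed.

Lemma cintegralD f g : cintegrable mu f -> cintegrable mu g ->
  cint (fun x => f x + g x) = cint f + cint g.
Proof.
move=> [fr fi] [gr gi]; apply: complex_eq => /=.
- by under eq_Rintegral do rewrite ReD; rewrite RintegralD.
- by under eq_Rintegral do rewrite ImD; rewrite RintegralD.
Qed.

Lemma cintegralZ f (c : R[i]) : cintegrable mu f ->
  cint (fun x => c * f x) = c * cint f.
Proof.
move=> [fr fi]; apply: complex_eq => /=.
- rewrite ReM/=; under eq_Rintegral do rewrite ReM.
  rewrite RintegralB ?RintegralZl//; exact: integrableZR.
- rewrite ImM/=; under eq_Rintegral do rewrite ImM.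
  rewrite RintegralD ?RintegralZl//; exact: integrableZR.
Qed.

Lemma cintegralB f g : cintegrable mu f -> cintegrable mu g ->
  cint (fun x => f x - g x) = cint f - cint g.
Proof.
move=> fi gi; rewrite -[in RHS]mulN1r -cintegralZ// -cintegralD//; last exact: cintegrableZ.
by congr cintegral; apply/funext => x; rewrite mulN1r.
Qed.

Lemma cintegrableB f g : cintegrable mu f -> cintegrable mu g ->
  cintegrable mu (fun x => f x - g x).
Proof.
move=> fi gi; have := cintegrableD fi (cintegrableZ (-1) gi).
by under eq_fun do rewrite mulN1r.
Qed.

Lemma cintegrable_real (f : V -> R) : mu.-integrable setT (EFin \o f) ->
  cintegrable mu (fun x => (f x)%:C).
Proof. by move=> fi; split => //=; exact: integrable0. Qed.

Lemma cintegral_real (f : V -> R) :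
  cint (fun x => (f x)%:C) = (Rintegral mu setT f)%:C.
Proof.
by apply: complex_eq => //=; rewrite /Rintegral integral0.
Qed.

(** Multiplying by the conjugate of the integral [z] rotates it onto the real axis, so |z|^2 is the
    integral of a real part bounded by |z| |f|. Arguing on the two components separately would lose
    a factor. *)
Lemma normc_cintegral f : cintegrable mu f ->
  normc (cint f) <= Rintegral mu setT (fun x => normc (f x)).
Proof.
move=> fi; set z := cint f.
have [z0|z0] := eqVneq (normc z) 0.
  by rewrite z0; apply: Rintegral_ge0 => x _; exact: normc_ge0.
have zp : 0 < normc z by rewrite lt_neqAle eq_sym z0 normc_ge0.
rewrite -(ler_pM2l zp) -expr2.
have -> : normc z ^+ 2 = Re (cint (fun x => conjc z * f x)).
  by rewrite cintegralZ// -/z mulrC mulc_conj.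
rewrite -RintegralZl//; last exact: cintegrable_norm.
rewrite [leLHS]/=; change (Rintegral mu setT (fun x => Re (conjc z * f x)) <= Rintegral mu setT (fun x => normc z * normc (f x))).
apply: le_Rintegral => //.
- by have [] := cintegrableZ (conjc z) fi.
- exact/integrableZR/cintegrable_norm.
- move=> x _; rewrite -(normc_conj z) -ComplexField.Normc.normcM.
  exact: le_trans (ler_norm _) (normc_Re _).
Qed.

Lemma normc_cintegral_le f (h : V -> R) : cmeasurable f ->
  mu.-integrable setT (EFin \o h) -> (forall x, normc (f x) <= h x) ->
  normc (cint f) <= Rintegral mu setT h.
Proof.
move=> mf ih fh; have fi := le_cintegrable mf ih fh.
apply: le_trans (normc_cintegral fi) _.
by apply: le_Rintegral => //; exact: cintegrable_norm.
Qed.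

Lemma Rintegral_cvg (f_ : nat -> V -> R) (f h : V -> R) :
  (forall n, measurable_fun setT (f_ n)) -> measurable_fun setT f ->
  mu.-integrable setT (EFin \o h) -> (forall n x, `|f_ n x| <= h x) ->
  (forall x, f_ ^~ x @ \oo --> f x) ->
  (fun n => Rintegral mu setT (f_ n)) @ \oo --> Rintegral mu setT f.
Proof.
move=> mf_ mf ih fh fc.
have [i1 _ i3] : [/\ mu.-integrable setT (EFin \o f),
  [sequence \int[mu]_x (`|(f_ n x)%:E - (f x)%:E|)]_n @ \oo --> 0 &
  [sequence \int[mu]_x (f_ n x)%:E]_n @ \oo --> \int[mu]_x (f x)%:E]%E.
  apply: (@dominated_convergence _ _ _ mu _ measurableT
    (fun n x => (f_ n x)%:E) (EFin \o f) (EFin \o h)) => //.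
  - by move=> n; exact/measurable_EFinP.
  - exact/measurable_EFinP.
  - by apply: aeW => x _ /=; apply: cvg_EFin; [exact: nearW|exact: fc].
  - by apply: aeW => x n _ /=; rewrite lee_fin.
apply: fine_cvg; rewrite fineK; first exact: i3.
exact: integrable_fin_num.
Qed.

End ComplexIntegrals.

Section ComplexFubini.
Context d1 d2 {T1 : measurableType d1} {T2 : measurableType d2} {R : realType}.
Variables (m1 : {sigma_finite_measure set T1 -> \bar R})
          (m2 : {sigma_finite_measure set T2 -> \bar R}).
Implicit Types f : T1 * T2 -> R[i].

Lemma cmeasurable_cintegral2 f : cmeasurable f ->
  cmeasurable (fun x => cintegral m2 setT (fun y => f (x, y))).
Proof. by move=> [fr fi]; split; [exact: (measurable_Rintegral2 _ fr)|exact: (measurable_Rintegral2 _ fi)]. Qed.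

Lemma cintegral_Fubini f : cintegrable (m1 \x m2)%E f ->
  cintegral (m1 \x m2)%E setT f =
  cintegral m1 setT (fun x => cintegral m2 setT (fun y => f (x, y))).
Proof.
by move=> [fr fi]; apply: complex_eq => /=; rewrite Rintegral_Fubini.
Qed.

End ComplexFubini.

Section FubiniSwap.
Context d1 d2 {T1 : measurableType d1} {T2 : measurableType d2} {R : realType}.
Variables (m1 : {sigma_finite_measure set T1 -> \bar R})
          (m2 : {sigma_finite_measure set T2 -> \bar R}).

Lemma Rintegral_Fubini2 (f : T1 * T2 -> R) :
  (m1 \x m2)%E.-integrable setT (EFin \o f) ->
  Rintegral (m1 \x m2)%E setT f =
  Rintegral m2 setT (fun y => Rintegral m1 setT (fun x => f (x, y))).
Proof.
move=> fi; rewrite {1}/Rintegral -(integral21_prod_meas1 fi) /Rintegral; congr fine.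
have mf := integrable_measurable fi.
apply: ae_eq_integral => //=.
- exact: measurable_fubini_G fi.
- apply/measurable_EFinP.
  by apply: measurableT_comp (measurable_fubini_G fi) => //; exact: measurable_fine.
- move: (ae_integrable2 fi) => /=; apply: filterS => x h _.
  by rewrite /fubini_G/= fineK// integrable_fin_num.
Qed.

Lemma cintegral_Fubini2 (f : T1 * T2 -> R[i]) : cintegrable (m1 \x m2)%E f ->
  cintegral (m1 \x m2)%E setT f =
  cintegral m2 setT (fun y => cintegral m1 setT (fun x => f (x, y))).
Proof.
by move=> [fr fi]; apply: complex_eq => /=; rewrite Rintegral_Fubini2.
Qed.

Lemma cintegral_swap (f : T1 * T2 -> R[i]) : cintegrable (m1 \x m2)%E f ->
  cintegral m1 setT (fun x => cintegral m2 setT (fun y => f (x, y))) =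
  cintegral m2 setT (fun y => cintegral m1 setT (fun x => f (x, y))).
Proof. by move=> fi; rewrite -cintegral_Fubini// cintegral_Fubini2. Qed.

Lemma integrable_swap (f : T1 * T2 -> R) : (m1 \x m2)%E.-integrable setT (EFin \o f) ->
  (m2 \x m1)%E.-integrable setT (EFin \o (fun z : T2 * T1 => f (z.2, z.1))).
Proof.
move=> fi; have mf := integrable_measurable fi.
have ms : measurable_fun setT (fun z : T2 * T1 => f (z.2, z.1)).
  apply: (measurableT_comp mf); exact: measurable_swap.
have man : measurable_fun setT (fun z => `|(EFin \o f) z|%E).
  by apply: measurableT_comp => //; exact/measurable_EFinP.
have mas : measurable_fun setT (fun z : T2 * T1 => `|(f (z.2, z.1))%:E|%E).
  by apply: measurableT_comp => //; exact/measurable_EFinP.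
have /integrableP[_] := fi.
rewrite (fubini_tonelli2 _ man)//= => h; apply/integrableP; split; first exact/measurable_EFinP.
by rewrite (fubini_tonelli1 _ mas).
Qed.

Lemma cintegrable_cintegral2 (f : T1 * T2 -> R[i]) : cintegrable (m1 \x m2)%E f ->
  cintegrable m2 (fun y => cintegral m1 setT (fun x => f (x, y))).
Proof.
by move=> [fr fi]; split; [exact: (integrable_Rintegral (integrable_swap fr))
  |exact: (integrable_Rintegral (integrable_swap fi))].
Qed.

Lemma integrable_prodM (f : T1 -> R) (g : T2 -> R) :
  m1.-integrable setT (EFin \o f) -> m2.-integrable setT (EFin \o g) ->
  (m1 \x m2)%E.-integrable setT (EFin \o (fun z => f z.1 * g z.2)).
Proof.
move=> fi gi; have mf := integrable_measurable fi; have mg := integrable_measurable gi.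
have mfg : measurable_fun setT (EFin \o (fun z : T1 * T2 => f z.1 * g z.2)).
  by apply/measurable_EFinP/measurable_funM; exact: measurableT_comp.
apply/(integrable12ltyP _ _ mfg) => /=.
under eq_integral => x _.
  under eq_integral => y _ do rewrite normrM EFinM.
  rewrite ge0_integralZl//; last exact/measurable_EFinP/measurableT_comp.
  over.
have gf : (\int[m2]_y `|(g y)%:E| \is a fin_num)%E.
  by have := integrable_fin_num measurableT (integrable_abse gi).
have ff : (\int[m1]_x `|(f x)%:E| \is a fin_num)%E.
  by have := integrable_fin_num measurableT (integrable_abse fi).
rewrite /= -(fineK gf) ge0_integralZr//.
- by move: ff => /= ff; rewrite -(fineK ff) -EFinM ltry.
- exact/measurable_EFinP/measurableT_comp.
- by rewrite lee_fin fine_ge0// integral_ge0.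
Qed.

Lemma cintegrable_prodM (f : T1 -> R[i]) (g : T2 -> R[i]) :
  cintegrable m1 f -> cintegrable m2 g ->
  cintegrable (m1 \x m2)%E (fun z => f z.1 * g z.2).
Proof.
move=> fi gi.
have [fr fm] := cintegrable_measurable fi.
have [gr gm] := cintegrable_measurable gi.
apply: (@le_cintegrable _ _ _ _ _ (fun z => normc (f z.1) * normc (g z.2))).
- apply: cmeasurableM; split.
  + by apply: (measurableT_comp fr); exact: measurable_fst.
  + by apply: (measurableT_comp fm); exact: measurable_fst.
  + by apply: (measurableT_comp gr); exact: measurable_snd.
  + by apply: (measurableT_comp gm); exact: measurable_snd.
- exact: (integrable_prodM (cintegrable_norm fi) (cintegrable_norm gi)).
- by move=> z; rewrite ComplexField.Normc.normcM.
Qed.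

Lemma cintegral_prodM (f : T1 -> R[i]) (g : T2 -> R[i]) :
  cintegrable m1 f -> cintegrable m2 g ->
  cintegral (m1 \x m2)%E setT (fun z => f z.1 * g z.2) =
  cintegral m1 setT f * cintegral m2 setT g.
Proof.
move=> fi gi; rewrite cintegral_Fubini//=; last exact: cintegrable_prodM.
under [X in cintegral _ _ X]eq_fun do rewrite cintegralZ// mulrC.
by rewrite cintegralZ// mulrC.
Qed.

End FubiniSwap.

(** * Gaussians *)

Section Line.
Context {R : realType}.
Local Notation mu := (@lebesgue_measure R).

Lemma measurable_addr (c : R) : measurable_fun setT (fun x : R => x + c).
Proof. exact: measurable_funD. Qed.

(** By uniqueness of Lebesgue measure: its pushforward under the translation gives half-open
    intervals the right length. *)
Lemma lebesgue_measureD (c : R) (A : set R) : measurable A ->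
  mu ((fun x => x + c) @^-1` A) = mu A.
Proof.
move=> mA.
pose nu : {measure set (measurableTypeR R) -> \bar R} :=
  pushforward mu (fun x : measurableTypeR R => (x + c : measurableTypeR R)).
suff: mu A = nu (measurable_addr c) A by [].
apply: lebesgue_measure_unique => // _ [[a b] _ <-] /=.
rewrite /nu/= /pushforward/=.
rewrite (_ : _ @^-1` _ = `]a - c, b - c]%classic); last first.
  by apply/seteqP; split => x /=; rewrite !in_itv/= ltrBlDr lerBrDr.
rewrite !lebesgue_measure_itv/= !lte_fin ltrD2r.
by case: ifP => // _; rewrite -!EFinD; congr _%:E; ring.
Qed.

Lemma ge0_integral_shift (c : R) (f : R -> \bar R) : measurable_fun setT f ->
  (forall x, 0 <= f x)%E ->
  (\int[mu]_x f (x + c)%R = \int[mu]_x f x)%E.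
Proof.
move=> mf f0.
have := @ge0_integral_pushforward _ _ _ _ R (fun x : measurableTypeR R => (x + c : measurableTypeR R))
  (measurable_addr c) mu setT f measurableT mf (fun x _ => f0 x).
rewrite preimage_setT => <-.
apply: eq_measure_integral => [|? A mA _]; first exact: measurable_addr.
change (mu ((fun x : R => x + c) @^-1` (A : set R)) = mu (A : set R)).
exact: lebesgue_measureD.
Qed.

Lemma Rintegral_FTC2 (f F : R -> R) (a b : R) : a <= b -> continuous f ->
  (forall x : R, is_derive x 1 F (f x)) ->
  Rintegral mu `[a, b] f = F b - F a.
Proof.
move=> ab cf dF; have cF : continuous F.
  by move=> x; apply/differentiable_continuous/derivable1_diffP; have [] := dF x.
move: ab; rewrite le_eqVlt => /predU1P[->|ab].
  by rewrite set_itv1 Rintegral_set1 subrr.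
rewrite /Rintegral (@continuous_FTC2 _ f F)//.
- exact: continuous_subspaceT.
- split.
  + by move=> x _; have [] := dF x.
  + exact: cvg_at_right_filter (cF a).
  + exact: cvg_at_left_filter (cF b).
- by move=> x _; rewrite derive1E; have [_ ->] := dF x.
Qed.

(** Truncate to [-n, n]: the boundary terms of the fundamental theorem are at most 2M / (1 + n), and
    the truncated integrals converge by domination. This is the form in which integration by parts
    on the line is used, [F] being the product whose derivative is [f]. *)
Lemma Rintegral_line (f F : R -> R) (M : R) : continuous f ->
  mu.-integrable setT (EFin \o f) ->
  (forall x : R, is_derive x 1 F (f x)) ->
  (forall x, `|F x| * (1 + `|x|) <= M) ->
  Rintegral mu setT f = 0.
Proof.
move=> cf fi dF FM.
have mf : measurable_fun setT f by exact: integrable_measurable fi.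
have c1 : (fun n : nat => Rintegral mu setT (f \_ `[- n%:R, n%:R])) @ \oo -->
    Rintegral mu setT f.
  apply: (@Rintegral_cvg _ _ _ mu _ _ (fun x => `|f x|)) => //.
  - move=> n; apply/(measurable_restrictT f) => //.
    exact: measurable_funTS.
  - exact: integrable_norm.
  - move=> n x; rewrite patchE; case: ifP => _ //; first by rewrite normr0.
  - move=> x; apply: cvg_near_cst; near=> n.
    rewrite patchE mem_set//=.
    rewrite in_itv/= -ler_norml.
    by near: n; exact: nbhs_infty_ger.
have c2 : (fun n : nat => Rintegral mu setT (f \_ `[- n%:R, n%:R])) @ \oo --> 0.
  apply/cvgr0Pnorm_le => e e0.
  near=> n.
  rewrite -Rintegral_mkcond (Rintegral_FTC2 _ cf dF); last first.
    by rewrite (@le_trans _ _ 0)// oppr_le0.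
  apply: le_trans (ler_normB _ _) _.
  have n1 : 0 < 1 + n%:R :> R by rewrite ltr_wpDr.
  rewrite -(ler_pM2r n1) mulrDl.
  apply: (@le_trans _ _ (M + M)).
    apply: lerD; first by have := FM n%:R; rewrite [`|n%:R|]ger0_norm.
    by have := FM (- n%:R); rewrite normrN [`|n%:R|]ger0_norm.
  rewrite -ler_pdivrMl// (@le_trans _ _ n%:R)//; last by rewrite lerDr.
  by near: n; exact: nbhs_infty_ger.
exact: (cvg_unique (@Rhausdorff R) c1 c2).
Unshelve. all: by end_near. Qed.

End Line.

Section Gaussian.
Context {R : realType}.
Local Notation mu := (@lebesgue_measure R).
Implicit Types s x : R.

(** [s] is the inverse of the standard deviation. Without normalization the function is at most 1
    and tends to 1 as [s] tends to 0, which suits a damping factor; its Fourier transform is 2 pi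
    times a normal density of standard deviation [s]. *)
Definition gaus s x : R := expR (- (s ^+ 2 * x ^+ 2 / 2)).

Lemma gaus_ge0 s x : 0 <= gaus s x. Proof. exact: expR_ge0. Qed.

Lemma gaus_le1 s x : gaus s x <= 1.
Proof.
by rewrite -[leRHS]expR0 ler_expR oppr_le0 divr_ge0// mulr_ge0// sqr_ge0.
Qed.

Lemma is_derive_gaus s x :
  is_derive x 1 (gaus s) (- (s ^+ 2 * x) * gaus s x).
Proof.
apply: is_derive_eq; rewrite /GRing.scale/= /gaus; field.
by [].
Qed.

Lemma continuous_gaus s : continuous (gaus s).
Proof.
move=> x; apply/differentiable_continuous/derivable1_diffP.
by have [] := is_derive_gaus s x.
Qed.

Lemma measurable_gaus s : measurable_fun setT (gaus s).
Proof. by apply: continuous_measurable_fun; exact: continuous_gaus. Qed.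

Lemma gausE s x : s != 0 ->
  gaus s x = (normal_peak s^-1)^-1 * normal_pdf 0 s^-1 x.
Proof.
move=> s0; have s'0 : s^-1 != 0 by rewrite invr_eq0.
rewrite normal_pdfE// mulKf ?gt_eqF ?normal_peak_gt0//.
rewrite /normal_fun /gaus; congr expR; rewrite subr0 -mulr_natr.
by field.
Qed.

Lemma normal_pdf_gaus s m x : s != 0 ->
  normal_pdf m s x = normal_peak s * gaus s^-1 (x - m).
Proof.
move=> s0; rewrite normal_pdfE// /normal_fun /gaus; congr (_ * expR _).
by rewrite -mulr_natr; field.
Qed.

Lemma integrable_gaus s : s != 0 -> mu.-integrable setT (EFin \o gaus s).
Proof.
move=> s0; rewrite (_ : gaus s = fun x => (normal_peak s^-1)^-1 * normal_pdf 0 s^-1 x).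
  exact/integrableZR/integrable_normal_pdf.
by apply/funext => x; rewrite gausE.
Qed.

Lemma integral_gaus s : s != 0 -> Rintegral mu setT (gaus s) = (normal_peak s^-1)^-1.
Proof.
move=> s0; rewrite (_ : gaus s = fun x => (normal_peak s^-1)^-1 * normal_pdf 0 s^-1 x); last first.
  by apply/funext => x; rewrite gausE.
rewrite RintegralZl//; last exact: integrable_normal_pdf.
by rewrite /Rintegral integral_normal_pdf mulr1.
Qed.

(** The triple 3, 4, 5 gives (3/5)^2 + (4/5)^2 = 1. One factor can absorb a polynomial while the
    other remains an integrable Gaussian, with rational parameters throughout. *)
Lemma gaus_split s x : gaus s x = gaus (3 / 5 * s) x * gaus (4 / 5 * s) x.
Proof. by rewrite /gaus -expRD; congr expR; field. Qed.

Lemma gaus_bound1 s x : s != 0 ->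
  (1 + `|x|) * gaus s x <= 1 + (s ^+ 2)^-1 / 2.
Proof.
move=> s0; have s2 : 0 < s ^+ 2 by rewrite exprn_even_gt0.
have y0 : 0 <= s ^+ 2 * x ^+ 2 / 2 by rewrite divr_ge0// mulr_ge0// sqr_ge0.
rewrite /gaus expRN ler_pdivrMr ?expR_gt0//.
apply: (@le_trans _ _ ((1 + (s ^+ 2)^-1 / 2) * (1 + s ^+ 2 * x ^+ 2 / 2))); last first.
  by rewrite ler_wpM2l// ?expR_ge1Dx// addr_ge0// divr_ge0// invr_ge0 ltW.
have key : `|x| <= (s ^+ 2)^-1 / 2 + s ^+ 2 * x ^+ 2 / 2.
  have : 0 <= (`|s| * `|x| - `|s|^-1) ^+ 2 by exact: sqr_ge0.
  rewrite sqrrB exprMn !real_normK ?num_real// exprVn real_normK ?num_real//.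
  have -> : `|s| * `|x| * `|s|^-1 = `|x| by rewrite mulrAC divff ?mul1r// normr_eq0.
  by rewrite -mulr_natr; lra.
have i0 : 0 <= (s ^+ 2)^-1 by rewrite invr_ge0 ltW.
by nra.
Qed.

Lemma gaus_bound s (k : nat) : s != 0 ->
  exists2 C, 0 <= C & forall x, (1 + `|x|) ^+ k * gaus s x <= C.
Proof.
elim: k s => [|k IH] s s0.
  by exists 1 => // x; rewrite mul1r gaus_le1.
have s1 : 4 / 5 * s != 0 by rewrite mulf_neq0// lt0r_neq0//; lra.
have s2 : 3 / 5 * s != 0 by rewrite mulf_neq0// lt0r_neq0//; lra.
have [C C0 hC] := IH _ s1.
exists (C * (1 + ((3 / 5 * s) ^+ 2)^-1 / 2)).
  by rewrite mulr_ge0// addr_ge0// divr_ge0// invr_ge0 sqr_ge0.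
move=> x; rewrite gaus_split exprSr.
rewrite [leLHS](_ : _ = ((1 + `|x|) ^+ k * gaus (4 / 5 * s) x) *
   ((1 + `|x|) * gaus (3 / 5 * s) x)); last by ring.
apply: ler_pM => //.
- by rewrite mulr_ge0 ?gaus_ge0// exprn_ge0// addr_ge0.
- by rewrite mulr_ge0 ?gaus_ge0// addr_ge0.
- exact: gaus_bound1.
Qed.

Lemma integrable_Xgaus s : s != 0 ->
  mu.-integrable setT (EFin \o (fun x => x * gaus s x)).
Proof.
move=> s0; have s1 : 4 / 5 * s != 0 by rewrite mulf_neq0// lt0r_neq0//; lra.
have s2 : 3 / 5 * s != 0 by rewrite mulf_neq0// lt0r_neq0//; lra.
apply: (@le_integrableR _ _ _ mu _
  (fun x => (1 + ((3 / 5 * s) ^+ 2)^-1 / 2) * gaus (4 / 5 * s) x)).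
- by apply: measurable_funM => //; exact: measurable_gaus.
- exact/integrableZR/integrable_gaus.
- move=> x; rewrite gaus_split mulrA normrM [X in _ * X]ger0_norm ?gaus_ge0//.
  rewrite ler_wpM2r ?gaus_ge0//; apply: le_trans (gaus_bound1 x s2).
  by rewrite normrM [X in _ * X]ger0_norm ?gaus_ge0// ler_wpM2r ?gaus_ge0// lerDr.
Qed.

Lemma continuous_is_derive (f g : R -> R) :
  (forall x : R, is_derive x 1 f (g x)) -> continuous f.
Proof.
by move=> fg x; apply/differentiable_continuous/derivable1_diffP; have [] := fg x.
Qed.

(** The integral [J] satisfies J'(k) = - k J(k) / s^2: differentiation under the integral sign
    brings down a factor x, and integration by parts ([part]) trades x times the Gaussian for k.
    Hence J(k) exp(k^2 / (2 s^2)) is constant. The phase [p] covers the cosine (p = 0) and the sine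
    (p = - pi / 2) with one computation. *)
Lemma integral_cos_gaus s (k p : R) : s != 0 ->
  Rintegral mu setT (fun x => cos (k * x + p) * gaus s x) =
  cos p * (normal_peak s^-1)^-1 * gaus s^-1 k.
Proof.
move=> s0.
have s2 : s ^+ 2 != 0 by rewrite expf_neq0.
pose J (k : R) := Rintegral mu setT (fun x => cos (k * x + p) * gaus s x).
have icos (l : R) : mu.-integrable setT (EFin \o (fun x => cos (l * x + p) * gaus s x)).
  apply: le_integrableR (integrable_gaus s0) _.
    apply: continuous_measurable_fun => x; apply: cvgM; last exact: continuous_gaus.
    apply: (@continuous_comp _ _ _ (fun x : R => l * x + p) cos); last exact: continuous_cos.
    by apply: cvgD; [apply: cvgM; [exact: cvg_cst|exact: cvg_id]|exact: cvg_cst].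
  move=> x; rewrite normrM [X in _ * X]ger0_norm ?gaus_ge0// ler_piMl ?gaus_ge0//.
  by rewrite ler_norml cos_geN1 cos_le1.
have isin (l : R) : mu.-integrable setT (EFin \o (fun x => sin (l * x + p) * (x * gaus s x))).
  apply: le_integrableR (integrable_norm (integrable_Xgaus s0)) _.
    apply: continuous_measurable_fun => x; apply: cvgM; last first.
      by apply: cvgM; [exact: cvg_id|exact: continuous_gaus].
    apply: (@continuous_comp _ _ _ (fun x : R => l * x + p) sin); last exact: continuous_sin.
    by apply: cvgD; [apply: cvgM; [exact: cvg_cst|exact: cvg_id]|exact: cvg_cst].
  move=> x; rewrite normrM ler_piMl//.
  by rewrite ler_norml sin_geN1 sin_le1.
have part (l : R) : l * J l = s ^+ 2 * Rintegral mu setT (fun x => sin (l * x + p) * (x * gaus s x)).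
  apply/eqP; rewrite -subr_eq0; apply/eqP.
  rewrite /J -!RintegralZl// -RintegralB//; [|exact: integrableZR..].
  have dF (x : R) : is_derive x 1 (fun x => sin (l * x + p) * gaus s x)
     (l * (cos (l * x + p) * gaus s x) - s ^+ 2 * (sin (l * x + p) * (x * gaus s x))).
    have := is_derive_gaus s x.
    move=> ?; apply: is_derive_eq; rewrite /GRing.scale/=; ring.
  have [C C0 hC] := gaus_bound 1 s0.
  apply: (@Rintegral_line _ _ (fun x => sin (l * x + p) * gaus s x) C) => //.
  - have dc (x : R) : is_derive x 1 (fun x => l * (cos (l * x + p) * gaus s x) -
       s ^+ 2 * (sin (l * x + p) * (x * gaus s x))) (
      l * (- l * sin (l * x + p) * gaus s x - cos (l * x + p) * (s ^+ 2 * x * gaus s x))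
       - s ^+ 2 * (l * cos (l * x + p) * (x * gaus s x) + sin (l * x + p) *
        (gaus s x - x * (s ^+ 2 * x * gaus s x)))).
      have := is_derive_gaus s x.
      move=> ?; apply: is_derive_eq; rewrite /GRing.scale/=; ring.
    exact: continuous_is_derive dc.
  - have := integrableDR (integrableZR l (icos l)) (integrableZR (- s ^+ 2) (isin l)).
    by under [X in _.-integrable _ (_ \o X)]eq_fun do rewrite mulNr.
  - move=> x; apply: le_trans (hC x); rewrite expr1 mulrC ler_wpM2l ?addr_ge0//.
    rewrite normrM [X in _ * X]ger0_norm ?gaus_ge0// ler_piMl ?gaus_ge0//.
    by rewrite ler_norml sin_geN1 sin_le1.
have dJ (l : R) : is_derive l 1 J (- (s ^- 2 * l * J l)).
  pose f (l x : R) := cos (l * x + p) * gaus s x.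
  have df (l' x : R) : is_derive l' 1 (f ^~ x) (- (sin (l' * x + p) * (x * gaus s x))).
    by apply: is_derive_eq; rewrite /GRing.scale/=; ring.
  have l1 : `]l - 1, l + 1[%classic l by rewrite /= in_itv/=; lra.
  have G0 (x : R) : 0 <= `|x * gaus s x| by [].
  have iG := integrable_norm (integrable_Xgaus s0).
  have p1 (l' x : R) : partial1of2 f l' x = - (sin (l' * x + p) * (x * gaus s x)).
    by rewrite partial1of2E; have [_ ->] := df l' x.
  have h1 x : `]l - 1, l + 1[%classic x -> mu.-integrable setT (EFin \o f x).
    by move=> _; exact: icos.
  have h2 (x y : R) : `]l - 1, l + 1[%classic x -> [set: R] y -> derivable (f^~ y) x 1.
    by move=> _ _; have [] := df x y.
  have h3 (x y : R) : `]l - 1, l + 1[%classic x -> [set: R] y ->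
      `|partial1of2 f x y| <= `|y * gaus s y|.
    move=> _ _; rewrite p1 normrN normrM ler_piMl//.
    by rewrite ler_norml sin_geN1 sin_le1.
  have D1 := derivable_under_integral measurableT l1 h1 h2 G0 iG h3.
  have D2 := differentiation_under_integral measurableT l1 h1 h2 G0 iG h3.
  apply: DeriveDef; first exact: D1.
  rewrite -derive1E [LHS]D2; under eq_Rintegral do rewrite p1.
  have -> : (fun x => - (sin (l * x + p) * (x * gaus s x))) =
    (fun x => -1 * (sin (l * x + p) * (x * gaus s x))).
    by apply/funext => x; rewrite mulN1r.
  rewrite RintegralZl// mulN1r; congr (- _).
  by rewrite -mulrA part mulKf.
pose g (l : R) := J l * expR (s ^- 2 * l ^+ 2 / 2).
have g0 (l : R) : is_derive l 1 g 0.
  apply: is_derive_eq; rewrite /GRing.scale/=; field.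
  by rewrite s0.
have := is_derive_0_is_cst k 0 g0.
rewrite /g expr0n/= mulr0 mul0r expR0 mulr1.
have -> : J 0 = cos p * (normal_peak s^-1)^-1.
  rewrite /J; under eq_Rintegral do rewrite mul0r add0r.
  by rewrite RintegralZl// ?integral_gaus//; exact: integrable_gaus.
move=> <-; rewrite -/(J k) /gaus exprVn -[RHS]mulrA -expRD.
by rewrite subrr expR0 mulr1.
Qed.

Lemma integrable_cis_gaus s (k : R) : s != 0 ->
  cintegrable mu (fun x => cis (k * x) * (gaus s x)%:C).
Proof.
move=> s0; apply: (@cintegrableM _ _ _ _ _ _ 1).
- exact/cintegrable_real/integrable_gaus.
- by apply: cmeasurable_cis; exact: measurable_funM.
- by move=> x; rewrite normc_cis.
Qed.

Lemma integral_cis_gaus s (k : R) : s != 0 ->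
  cintegral mu setT (fun x => cis (k * x) * (gaus s x)%:C) =
  ((normal_peak s^-1)^-1 * gaus s^-1 k)%:C.
Proof.
move=> s0; apply: complex_eq => /=.
- under eq_Rintegral do rewrite mulr0 subr0.
  rewrite (_ : Rintegral _ _ _ = Rintegral mu setT (fun x => cos (k * x + 0) * gaus s x)).
    by rewrite integral_cos_gaus// cos0 mul1r.
  by apply: eq_Rintegral => x _; rewrite addr0.
- under eq_Rintegral do rewrite mulr0 add0r.
  rewrite (_ : Rintegral _ _ _ = Rintegral mu setT (fun x => cos (k * x + - (pi / 2)) * gaus s x)).
    by rewrite integral_cos_gaus// cosN cos_pihalf !mul0r.
  by apply: eq_Rintegral => x _; rewrite cosB cos_pihalf sin_pihalf mulr0 mulr1 add0r.
Qed.

Lemma normal_peakVM s : 0 < s -> (normal_peak s^-1)^-1 = 2 * pi * normal_peak s.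
Proof.
move=> s0; have s20 : 0 < s ^+ 2 by rewrite exprn_gt0.
rewrite /normal_peak invrK exprVn; move: (s ^+ 2) (pi : R) (pi_gt0 R) s20 => t q p0 t0.
apply: (mulIf (x := Num.sqrt (t * q *+ 2))).
  by rewrite gt_eqF// sqrtr_gt0 mulrn_wgt0// mulr_gt0.
rewrite mulfVK; last by rewrite gt_eqF// sqrtr_gt0 mulrn_wgt0// mulr_gt0.
rewrite -sqrtrM; last by rewrite mulrn_wge0// mulr_ge0// ?invr_ge0 ltW.
rewrite [X in Num.sqrt X](_ : _ = (2 * q) ^+ 2).
  by rewrite sqrtr_sqr ger0_norm// mulr_ge0// ltW.
by field; rewrite gt_eqF.
Qed.

(** The exchange behind every regularization: damping by [gaus s] on one side of the Fourier
    transform is averaging against a normal density of width [s] on the other. *)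
Lemma integral_cis_gaus_pdf s (x y : R) : 0 < s ->
  cintegral mu setT (fun xi => cis ((x - y) * xi) * (gaus s xi)%:C) =
  (2 * pi * normal_pdf x s y)%:C.
Proof.
move=> s0; rewrite integral_cis_gaus ?gt_eqF// normal_peakVM//.
rewrite normal_pdf_gaus ?gt_eqF// mulrA; congr ((_ * _)%:C).
by rewrite /gaus -[x - y]opprB sqrrN.
Qed.

End Gaussian.

(** * Gaussian means converge at Lebesgue points *)

Section GaussianApproximation.
Context {R : realType}.
Local Notation mu := (@lebesgue_measure R).

(** On the shell 2^J <= u one has 4^{J+1} <= 4 u^2 <= 8 exp(u^2 / 2), which gives the term of index
    J + 1. The Gaussian is thus dominated by indicators of balls whose weights 4^-j beat their
    lengths 2^j, so that information on ball averages suffices. *)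
Lemma expR_dyadic (J : nat) (u : R) : 0 <= u -> u < 2 ^+ J ->
  expR (- (u ^+ 2 / 2)) <= \sum_(j < J.+1) 8 * 4^-1 ^+ j * (u < 2 ^+ j)%R%:R.
Proof.
move=> u0; elim: J => [|J IH] uJ.
  rewrite big_ord_recl big_ord0/= expr0 uJ !mulr1 addr0.
  rewrite (@le_trans _ _ 1)// -?expR0 ?ler_expR ?oppr_le0 ?divr_ge0 ?sqr_ge0//.
  by rewrite expR0; lra.
rewrite big_ord_recr/= uJ mulr1.
have [uJ'|uJ'] := ltP u (2 ^+ J).
  by apply: le_trans (IH uJ') _; rewrite lerDl mulr_ge0// exprn_ge0// invr_ge0.
apply: (@le_trans _ _ (8 * 4^-1 ^+ J.+1)); last first.
  rewrite lerDr; apply: sumr_ge0 => i _.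
  by rewrite !mulr_ge0// exprn_ge0// invr_ge0.
have p0 : 0 < 4 ^+ J.+1 :> R by rewrite exprn_gt0.
rewrite expRN exprVn ler_pdivlMr// mulrC ler_pdivrMr ?expR_gt0//.
have h : 4 ^+ J.+1 <= 4 * u ^+ 2.
  rewrite exprS ler_wpM2l// (_ : 4 = 2 ^+ 2 :> R); last by rewrite -natrX.
  by rewrite exprAC lerXn2r ?nnegrE// exprn_ge0.
apply: le_trans h _.
have := expR_ge1Dx (u ^+ 2 / 2); lra.
Qed.

Lemma normal_peak1 : normal_peak (1 : R) <= 1.
Proof.
rewrite /normal_peak invf_le1; last first.
  by rewrite sqrtr_gt0 expr1n mul1r mulrn_wgt0// pi_gt0.
rewrite -[leLHS]sqrtr1 ler_wsqrtr// expr1n mul1r.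
by have := @pi_ge2 R; rewrite mulr2n; lra.
Qed.

Lemma normal_peak_scale (s : R) : 0 < s -> s * normal_peak s = normal_peak 1.
Proof.
move=> s0; rewrite /normal_peak expr1n mul1r -mulrnAr sqrtrM ?sqr_ge0//.
by rewrite sqrtr_sqr gtr0_norm// invfM mulrA divff ?mul1r// gt_eqF.
Qed.

(** At distance at least [r] part of the exponent is spent on a small factor and the rest kept as
    the density of width 1. The tail is then measured by one fixed integral, which is finite even
    when [f] is only integrable against Gaussians. *)
Lemma normal_pdf_tail (x y r s : R) : 0 < s -> s <= 1 -> 0 <= r ->
  r <= `|y - x| ->
  normal_pdf x s y <= s^-1 * expR (- (r ^+ 2 / 2 * (s ^- 2 - 1))) * normal_pdf x 1 y.
Proof.
move=> s0 s1 r0 ry; rewrite !normal_pdf_gaus ?gt_eqF// ?oner_neq0//.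
rewrite -(normal_peak_scale s0) mulrACA mulKf ?gt_eqF//.
rewrite ler_wpM2l ?normal_peak_ge0//.
rewrite /gaus -expRD ler_expR invr1 expr1n mul1r exprVn.
have h1 : 1 <= s ^- 2.
  by rewrite -invr1 lef_pV2 ?posrE// ?exprn_gt0// expr_le1// ltW.
have h2 : r ^+ 2 <= (y - x) ^+ 2.
  by rewrite -(real_normK (num_real (y - x))) lerXn2r// nnegrE.
by nra.
Qed.

Lemma normal_pdf_near (J : nat) (x y r s : R) : 0 < s -> `|y - x| < r -> r < 2 ^+ J * s ->
  normal_pdf x s y <= \sum_(j < J.+1)
    normal_peak s * 8 * 4^-1 ^+ j * (`|y - x| < Num.min (2 ^+ j * s) r)%R%:R.
Proof.
move=> s0 yr rJ; rewrite normal_pdf_gaus ?gt_eqF//.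
have -> : gaus s^-1 (y - x) = expR (- ((`|y - x| / s) ^+ 2 / 2)).
  rewrite /gaus; congr expR; congr (- (_ / 2)).
  by rewrite [RHS]exprMn real_normK ?num_real// mulrC.
rewrite (_ : \sum_(j < _) _ = normal_peak s * \sum_(j < J.+1) 8 * 4^-1 ^+ j * (`|y - x| / s < 2 ^+ j)%R%:R).
  rewrite ler_wpM2l ?normal_peak_ge0// expR_dyadic// ?divr_ge0// ?ltW//.
  by rewrite ltr_pdivrMr// (lt_trans yr).
rewrite mulr_sumr; apply: eq_bigr => i _.
by rewrite lt_min yr andbT ltr_pdivrMr// !mulrA.
Qed.

Lemma lebesgue_pt_ball (f : R -> R) x : lebesgue_pt f x -> forall e, 0 < e ->
  exists2 r, 0 < r & forall rho, 0 < rho -> rho <= r ->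
    (\int[mu]_(y in ball x rho) `|f y - f x|%:E <= (2 * rho * e)%:E)%E.
Proof.
move=> fx e e0.
have : \forall r \near 0^'+, (davg f x r < e%:E)%E.
  exact: (fx _ (nbhs_open_ereal_lt (f := fun=> e) e0)).
move=> [/= r r0 hr]; exists (r / 2); first by rewrite divr_gt0.
move=> rho rho0 rhor.
have := hr rho; rewrite /= sub0r normrN gtr0_norm//.
have rr : rho < r by apply: le_lt_trans rhor _; rewrite ltr_pdivrMr// ltr_pMr// ltr1n.
move=> /(_ rr rho0) /ltW.
rewrite /davg /iavg lebesgue_measure_ball; last exact: ltW.
rewrite inver ifF; last first.
  by rewrite mulrn_eq0/= gt_eqF.
move=> h.
have p0 : 0 < rho *+ 2 by rewrite mulrn_wgt0.
have {}h := lee_wpmul2l (ltW p0 : (0 <= (rho *+ 2)%:E)%E) h.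
move: h; rewrite muleA -EFinM divff ?gt_eqF// mul1e -EFinM -(mulr_natl rho).
exact.
Qed.

Lemma geo_tail_cvg (r e : R) : 0 < r -> 0 < e -> \forall n \near \oo,
  (n.+1%:R : R) * expR (- (r ^+ 2 / 2 * (n.+1%:R ^+ 2 - 1))) <= e.
Proof.
move=> r0 e0; near=> n.
have n1 : 1 <= n%:R :> R by rewrite ler1n; near: n; exact: nbhs_infty_gt.
have nb : 4 / (e * r ^+ 2) <= n%:R by near: n; exact: nbhs_infty_ger.
have er0 : 0 < e * r ^+ 2 by rewrite mulr_gt0// exprn_gt0.
rewrite ler_pdivrMr// in nb.
rewrite expRN ler_pdivrMr ?expR_gt0//.
apply: (@le_trans _ _ (e * (1 + r ^+ 2 / 2 * (n.+1%:R ^+ 2 - 1)))); last first.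
  by rewrite ler_pM2l// expR_ge1Dx.
rewrite -natr1; move: nb n1; move: (n%:R : R) => t nb n1.
have : 4 * (t + 2) <= (t * (e * r ^+ 2)) * (t + 2) by rewrite ler_wpM2r//; lra.
by have := e0; nra.
Unshelve. all: by end_near. Qed.

Lemma integral_indicR (h : R -> R) (A : set R) :
  (\int[mu]_y (h y * \1_A y)%:E = \int[mu]_(y in A) (h y)%:E)%E.
Proof.
rewrite [RHS]integral_mkcond; apply: eq_integral => y _.
rewrite patchE indicE; case: ifPn => yA; first by rewrite mulr1.
by rewrite mulr0.
Qed.

(** Within distance [r] of the point the density is bounded by dyadic indicators, and each ball
    average of |f - f x| is at most [e]; beyond [r] the comparison with width 1 leaves [e] times the
    fixed integral [A]. The constant 32 is the sum of the shell contributions 16 * 2^-j. *)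
Lemma gauss_lebesgue_pt (f : R -> R) x : measurable_fun setT f ->
  lebesgue_pt f x ->
  (forall n : nat, mu.-integrable setT
     (EFin \o (fun y => f y * normal_pdf x n.+1%:R^-1 y))) ->
  (fun n : nat => Rintegral mu setT (fun y => f y * normal_pdf x n.+1%:R^-1 y))
    @ \oo --> f x.
Proof.
move=> mf lf ifn.
have if1 : mu.-integrable setT (EFin \o (fun y => f y * normal_pdf x 1 y)).
  by have := ifn 0%N; rewrite invr1.
pose h (y : R) : R := `|f y - f x|.
have h0 y : 0 <= h y by exact: normr_ge0.
have mpdf s : measurable_fun setT (normal_pdf x s) by exact: measurable_normal_pdf.
have mh : measurable_fun setT h.
  by apply: measurableT_comp => //; exact: measurable_funB.
have mhp s : measurable_fun setT (fun y => h y * normal_pdf x s y).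
  exact: (measurable_funM mh (mpdf s)).
have ih s : mu.-integrable setT (EFin \o (fun y => f y * normal_pdf x s y)) ->
    mu.-integrable setT (EFin \o (fun y => h y * normal_pdf x s y)).
  move=> ifs.
  apply: (@le_integrableR _ _ _ mu _
    (fun y => `|f y * normal_pdf x s y| + `|f x| * normal_pdf x s y)).
  - exact: mhp.
  - apply: integrableDR; first exact: integrable_norm.
    exact/integrableZR/integrable_normal_pdf.
  - move=> y; rewrite !normrM normr_id [`|normal_pdf _ _ _|]ger0_norm ?normal_pdf_ge0//.
    by rewrite -mulrDl ler_wpM2r ?normal_pdf_ge0// ler_normB.
pose A := Rintegral mu setT (fun y => h y * normal_pdf x 1 y).
have A0 : 0 <= A.
  by apply: Rintegral_ge0 => y _; rewrite mulr_ge0// normal_pdf_ge0.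
have key e : 0 < e -> \forall n \near \oo,
    Rintegral mu setT (fun y => h y * normal_pdf x n.+1%:R^-1 y) <= 32 * e + e * A.
  move=> e0.
  have [r r0 hr] := lebesgue_pt_ball lf e0.
  have tailc := geo_tail_cvg r0 e0.
  near=> n.
  set s : R := n.+1%:R^-1.
  have s0 : 0 < s by rewrite invr_gt0.
  have s1 : s <= 1 by rewrite invf_le1// ler1n.
  (* The number of shells grows as [s] shrinks, but their total contribution is bounded
     independently of [J]. *)
  have [J rJ] : exists J, r < 2 ^+ J * s.
    exists (Num.truncn (r / s)).+1.
    rewrite -ltr_pdivrMr//; apply: lt_trans (truncnS_gt _) _.
    by rewrite -natrX ltr_nat ltn_expl.
  pose c j := normal_peak s * 8 * 4^-1 ^+ j : R.
  have c0 j : 0 <= c j.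
    by rewrite /c !mulr_ge0// ?normal_peak_ge0// exprn_ge0// invr_ge0.
  pose B j := ball x (Num.min (2 ^+ j * s) r) : set R.
  have mB j : measurable (B j) by exact: measurable_ball.
  have mhB j : measurable_fun setT (fun y => h y * \1_(B j) y).
    by apply: (measurable_funM mh); exact: measurable_indic.
  have mchB j : measurable_fun setT (fun y => c j * (h y * \1_(B j) y)).
    exact: (measurable_funM (measurable_cst _) (mhB j)).
  pose q := s^-1 * expR (- (r ^+ 2 / 2 * (s ^- 2 - 1))).
  have q0 : 0 <= q by rewrite mulr_ge0 ?expR_ge0// invr_ge0 ltW.
  have pw y : h y * normal_pdf x s y <=
      \sum_(j < J.+1) c j * (h y * \1_(B j) y) + q * (h y * normal_pdf x 1 y).
    have sum0 : 0 <= \sum_(j < J.+1) c j * (h y * \1_(B j) y).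
      by apply: sumr_ge0 => j _; rewrite mulr_ge0// mulr_ge0// indicE.
    have [yr|yr] := ltP `|y - x| r.
      apply: (@le_trans _ _ (\sum_(j < J.+1) c j * (h y * \1_(B j) y))); last first.
        by rewrite lerDl mulr_ge0// mulr_ge0// normal_pdf_ge0.
      apply: le_trans (ler_wpM2l (h0 y) (normal_pdf_near s0 yr rJ)) _.
      rewrite mulr_sumr; apply: ler_sum => j _.
      rewrite mulrCA indicE (_ : (y \in B j) = (`|y - x| < Num.min (2 ^+ j * s) r))//.
      by apply/idP/idP; rewrite inE /B /ball/= distrC.
    apply: (@le_trans _ _ (q * (h y * normal_pdf x 1 y))); last by rewrite lerDr.
    by rewrite mulrCA ler_wpM2l// normal_pdf_tail// ltW.
  have lem : (\int[mu]_y (h y * normal_pdf x s y)%:E <= (32 * e + e * A)%:E)%E.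
    apply: (@le_trans _ _ (\int[mu]_y ((\sum_(j < J.+1) (c j * (h y * \1_(B j) y))%:E) +
         (q * (h y * normal_pdf x 1 y))%:E))%E).
      apply: ge0_le_integral => //.
      - by move=> y _; rewrite lee_fin mulr_ge0// normal_pdf_ge0.
      - by apply/measurable_EFinP; exact: mhp.
      - apply: emeasurable_funD.
          apply: emeasurable_sum => j; apply/measurable_EFinP.
          exact: mchB.
        by apply/measurable_EFinP; exact: (measurable_funM (measurable_cst _) (mhp _)).
      - by move=> y _; rewrite sumEFin -EFinD lee_fin.
    rewrite ge0_integralD//; last 4 first.
      - by move=> y _; apply: sume_ge0 => j _; rewrite lee_fin mulr_ge0// mulr_ge0// indicE.
      - apply: emeasurable_sum => j; apply/measurable_EFinP.
        exact: mchB.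
      - by move=> y _; rewrite lee_fin mulr_ge0// mulr_ge0// normal_pdf_ge0.
      - by apply/measurable_EFinP; exact: (measurable_funM (measurable_cst _) (mhp _)).
    rewrite EFinD; apply: leeD.
      rewrite ge0_integral_sum//; last 2 first.
      - move=> j; apply/measurable_EFinP.
        exact: mchB.
      - by move=> j y _; rewrite lee_fin mulr_ge0// mulr_ge0// indicE.
      apply: (@le_trans _ _ (\sum_(j < J.+1) (16 * e * 2^-1 ^+ j)%:E)%E).
        apply: lee_sum => j _.
        under eq_integral do rewrite EFinM.
        rewrite ge0_integralZl_EFin//; last 2 first.
        - by move=> y _; rewrite lee_fin mulr_ge0// indicE.
        - by apply/measurable_EFinP; exact: mhB.
        rewrite integral_indicR.
        have m0 : 0 < Num.min (2 ^+ j * s) r.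
          by rewrite lt_min r0 andbT mulr_gt0// exprn_gt0.
        have mr : Num.min (2 ^+ j * s) r <= r by rewrite ge_min lexx orbT.
        apply: le_trans (lee_wpmul2l _ (hr _ m0 mr)) _; first by rewrite lee_fin.
        rewrite -EFinM lee_fin.
        apply: (@le_trans _ _ (c j * (2 * (2 ^+ j * s) * e))).
          by rewrite ler_wpM2l// ler_pM2r// ler_pM2l// ge_min lexx.
        rewrite /c.
        (* The width of the ball supplies the factor [s] that makes [s * normal_peak s] scale
           invariant and at most 1; what remains decays like 2^-j. *)
        have -> : normal_peak s * 8 * 4^-1 ^+ j * (2 * (2 ^+ j * s) * e) =
            (s * normal_peak s) * (16 * e * (4^-1 * 2) ^+ j).
          by rewrite exprMn; ring.
        rewrite normal_peak_scale// (_ : 4^-1 * 2 = 2^-1 :> R); last by field.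
        by rewrite ler_piMl ?normal_peak1// !mulr_ge0 ?exprn_ge0 ?invr_ge0// ltW.
      rewrite sumEFin lee_fin -mulr_sumr.
      rewrite (_ : 32 * e = 16 * e * 2); last by ring.
      rewrite ler_wpM2l ?mulr_ge0 ?ltW//.
      elim: J {rJ pw} => [|J IH]; first by rewrite big_ord_recl big_ord0 expr0 addr0; lra.
      rewrite big_ord_recl expr0; under eq_bigr do rewrite exprS.
      by rewrite -mulr_sumr; move: IH; lra.
    under eq_integral do rewrite EFinM.
    rewrite ge0_integralZl_EFin//; last 2 first.
      - by move=> y _; rewrite lee_fin mulr_ge0// normal_pdf_ge0.
      - by apply/measurable_EFinP; exact: mhp.
    rewrite Rintegral_fin; last exact: ih.
    rewrite -EFinM lee_fin ler_wpM2r//.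
    rewrite /q /s invrK exprVn invrK.
    by near: n.
  by move: lem; rewrite (Rintegral_fin (ih _ (ifn n))) lee_fin.
apply/cvgrPdist_le => e e0.
have e'0 : 0 < e / (32 + A).
  by rewrite divr_gt0// ltr_wpDr.
apply: filterS (key _ e'0) => n hn.
have ee : 32 * (e / (32 + A)) + e / (32 + A) * A = e.
  by field; rewrite gt_eqF// ltr_wpDr.
rewrite ee in hn; apply: le_trans hn.
rewrite [X in X - _](_ : f x = Rintegral mu setT (fun y => f x * normal_pdf x n.+1%:R^-1 y)); last first.
  rewrite RintegralZl//; last exact: integrable_normal_pdf.
  by rewrite /Rintegral integral_normal_pdf mulr1.
rewrite distrC.
rewrite -(RintegralB measurableT (ifn n) (integrableZR (f x) (integrable_normal_pdf x _))).
apply: le_trans (le_normr_Rintegral measurableT _) _.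
  have := integrableDR (ifn n) (integrableZR (- f x) (integrable_normal_pdf x n.+1%:R^-1)).
  by under [X in _.-integrable _ (_ \o X)]eq_fun do rewrite mulNr.
rewrite le_eqVlt; apply/orP; left; apply/eqP; apply: eq_Rintegral => y _.
by rewrite -mulrBl normrM [X in _ * X]ger0_norm ?normal_pdf_ge0.
Unshelve. all: by end_near. Qed.

End GaussianApproximation.

(** * Gaussian plane waves are Schwartz functions *)

Section GaussianSchwartz.
Context {R : realType} {V : normedModType R}.

(** Both sides are limits of the same difference quotient. It reduces the chain rule on a normed
    space to the one for functions of a real variable. *)
Lemma is_derive_line (f : V -> R) (z v : V) (df : R) :
  is_derive z v f df <-> is_derive (0 : R) 1 (fun t : R => f (t *: v + z)) df.
Proof.
have e : (fun h : R => h^-1 *: (((fun t : R => f (t *: v + z)) \o shift 0) (h *: (1 : R)) -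
     (fun t : R => f (t *: v + z)) 0)) =
  (fun h : R => h^-1 *: ((f \o shift z) (h *: v) - f z)).
  apply/funext => h; congr (_ *: (f _ - f _)); last by rewrite scale0r add0r.
  by rewrite /shift/= addr0 [h *: (1 : R)]mulr1.
by split=> -[h1 h2]; split; rewrite /derivable /derive ?e// in h1 h2 *.
Qed.

Lemma is_derive_compR (f : R -> R) (g : V -> R) (z v : V) (df dg : R) :
  is_derive (g z) 1 f df -> is_derive z v g dg ->
  is_derive z v (f \o g) (df * dg).
Proof.
move=> fd /is_derive_line gd; apply/is_derive_line.
apply: (@is_derive1_comp _ f (fun t : R => g (t *: v + z))) => //.
by rewrite scale0r add0r.
Qed.

Variable X : set (V -> R).
Hypothesis Xlin : forall l, X l -> forall z v : V, is_derive z v l (l v).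
Hypothesis Xcont : forall l, X l -> continuous l.
Hypothesis Xle : forall l, X l -> forall z, `|l z| <= `|z|.

(** Polynomials in the coordinate functions collected in [X], which is the identity on the line and
    the pair of projections on the plane. One development then serves both spaces. *)
Inductive polyfun : (V -> R) -> Prop :=
| polyfun_cst c : polyfun (fun=> c)
| polyfun_coord l : X l -> polyfun l
| polyfunD p q : polyfun p -> polyfun q -> polyfun (fun z => p z + q z)
| polyfunM p q : polyfun p -> polyfun q -> polyfun (fun z => p z * q z).

Lemma polyfun_continuous p : polyfun p -> continuous p.
Proof.
elim=> {p} [c|l Xl|p q _ cp _ cq|p q _ cp _ cq] z.
- exact: cvg_cst.
- exact: Xcont.
- by apply: cvgD; [exact: cp|exact: cq].
- by apply: cvgM; [exact: cp|exact: cq].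
Qed.

Lemma polyfun_derive p v : polyfun p ->
  exists2 p', polyfun p' & forall z, is_derive z v p (p' z).
Proof.
elim=> {p} [c|l Xl|p q pp [p' pp' hp] pq [q' pq' hq]|p q pp [p' pp' hp] pq [q' pq' hq]].
- by exists (fun=> 0); [exact: polyfun_cst|move=> z; exact: is_derive_cst].
- by exists (fun=> l v); [exact: polyfun_cst|move=> z; exact: Xlin].
- exists (fun z => p' z + q' z); first exact: polyfunD.
  by move=> z; have := hp z; have := hq z => ? ?; exact: is_deriveD.
- exists (fun z => p z * q' z + q z * p' z).
    by apply: polyfunD; apply: polyfunM.
  by move=> z; have := hp z; have := hq z => ? ?; exact: is_deriveM.
Qed.

Lemma polyfun_bound p : polyfun p ->
  exists n C, 0 <= C /\ forall z, `|p z| <= C * (1 + `|z|) ^+ n.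
Proof.
have b1 (z : V) : 1 <= 1 + `|z| by rewrite lerDl.
elim=> {p} [c|l Xl|p q _ [m [C [C0 hC]]] _ [n [D [D0 hD]]]|
    p q _ [m [C [C0 hC]]] _ [n [D [D0 hD]]]].
- by exists 0%N, `|c|; split => // z; rewrite expr0 mulr1.
- exists 1%N, 1; split => // z; rewrite expr1 mul1r.
  by apply: le_trans (Xle Xl z) _; rewrite lerDr.
- exists (m + n)%N, (C + D); split => [|z]; first exact: addr_ge0.
  apply: le_trans (ler_normD _ _) _; rewrite mulrDl; apply: lerD.
  + apply: le_trans (hC z) _; rewrite ler_wpM2l// exprD ler_peMr ?exprn_ege1//.
  + apply: le_trans (hD z) _; rewrite ler_wpM2l// exprD ler_peMl ?exprn_ege1//.
- exists (m + n)%N, (C * D); split => [|z]; first exact: mulr_ge0.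
  by rewrite normrM exprD mulrACA ler_pM.
Qed.

Variables (L E : V -> R) (dL : V -> R) (dQ : V -> V -> R).
Hypothesis LD : forall z v, is_derive z v L (dL v).
Hypothesis ED : forall z v, is_derive z v E (- dQ v z * E z).
Hypothesis dQP : forall v, polyfun (dQ v).
Hypothesis Lcont : continuous L.
Hypothesis Econt : continuous E.
Hypothesis E0 : forall z, 0 <= E z.
Hypothesis Ebound : forall n : nat, exists C, forall z, (1 + `|z|) ^+ n * E z <= C.

(** A class stable under directional derivatives, since differentiating [L] or [E] only changes the
    polynomial coefficients. All iterated derivatives stay in it, so a single decay estimate for the
    class yields the Schwartz property. *)
Definition gaussfun (f : V -> R) := exists p q, [/\ polyfun p, polyfun q &
  forall z, f z = (p z * cos (L z) + q z * sin (L z)) * E z].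

Lemma gaussfun_derive f v : gaussfun f ->
  exists2 f', gaussfun f' & forall z, is_derive z v f (f' z).
Proof.
move=> [p [q [pp pq fE]]].
have [p' pp' hp] := polyfun_derive v pp.
have [q' pq' hq] := polyfun_derive v pq.
exists (fun z => ((p' z + (q z * dL v + (-1) * (p z * dQ v z))) * cos (L z)
  + (q' z + (-1) * (p z * dL v + q z * dQ v z)) * sin (L z)) * E z).
  exists (fun z => p' z + (q z * dL v + (-1) * (p z * dQ v z))),
    (fun z => q' z + (-1) * (p z * dL v + q z * dQ v z)); split => //.
  - apply: polyfunD => //; apply: polyfunD.
      by apply: polyfunM => //; exact: (polyfun_cst (dL v)).
    by apply: polyfunM; [exact: (polyfun_cst (-1))|exact: polyfunM].
  - apply: polyfunD => //; apply: polyfunM; first exact: (polyfun_cst (-1)).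
    apply: polyfunD; last exact: polyfunM.
    by apply: polyfunM => //; exact: (polyfun_cst (dL v)).
move=> z; rewrite (_ : f = fun z => (p z * (cos \o L) z + q z * (sin \o L) z) * E z); last first.
  by apply/funext.
have ? := hp z; have ? := hq z; have ? := LD z v; have ? := ED z v.
have ? := is_derive_compR (is_derive_cos (L z)) (LD z v).
have ? := is_derive_compR (is_derive_sin (L z)) (LD z v).
apply: is_derive_eq; rewrite /GRing.scale/=; ring.
Qed.

Lemma gaussfun_continuous f : gaussfun f -> continuous f.
Proof.
move=> [p [q [pp pq fE]]] z.
rewrite (_ : f = fun z => (p z * cos (L z) + q z * sin (L z)) * E z); last first.
  by apply/funext.
apply: cvgM; last exact: Econt.
apply: cvgD; apply: cvgM.
- exact: polyfun_continuous.
- by apply: continuous_comp; [exact: Lcont|exact: continuous_cos].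
- exact: polyfun_continuous.
- by apply: continuous_comp; [exact: Lcont|exact: continuous_sin].
Qed.

Lemma gaussfun_iter vs f : gaussfun f -> gaussfun (iter_derive vs f).
Proof.
move=> gf; elim: vs => //= v vs IH.
have [f' gf' hf] := gaussfun_derive v IH.
rewrite (_ : (fun x => _) = f')//; apply/funext => x.
by have [_ ->] := hf x.
Qed.

Lemma gaussfun_bound f (k : nat) : gaussfun f ->
  exists M, forall z, `|z| ^+ k * `|f z| <= M.
Proof.
move=> [p [q [pp pq fE]]].
have [m [C [C0 hC]]] := polyfun_bound pp.
have [n [D [D0 hD]]] := polyfun_bound pq.
have [M hM] := Ebound (k + (m + n)).
exists ((C + D) * M) => z; rewrite fE.
have b1 : 1 <= 1 + `|z| by rewrite lerDl.
have b0 : 0 <= 1 + `|z| by rewrite addr_ge0.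
have h : `|p z * cos (L z) + q z * sin (L z)| <= (C + D) * (1 + `|z|) ^+ (m + n).
  apply: le_trans (ler_normD _ _) _; rewrite mulrDl !normrM; apply: lerD.
  - apply: (@le_trans _ _ (`|p z| * 1)).
      by rewrite ler_wpM2l// ler_norml cos_geN1 cos_le1.
    rewrite mulr1; apply: le_trans (hC z) _.
    by rewrite ler_wpM2l// exprD ler_peMr ?exprn_ege1// exprn_ge0.
  - apply: (@le_trans _ _ (`|q z| * 1)).
      by rewrite ler_wpM2l// ler_norml sin_geN1 sin_le1.
    rewrite mulr1; apply: le_trans (hD z) _.
    by rewrite ler_wpM2l// exprD ler_peMl ?exprn_ege1// exprn_ge0.
apply: (@le_trans _ _ ((C + D) * ((1 + `|z|) ^+ (k + (m + n)) * E z))); last first.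
  by rewrite ler_wpM2l// addr_ge0.
rewrite normrM [`|E z|]ger0_norm// !mulrA ler_wpM2r//.
rewrite exprD [leRHS]mulrCA; apply: ler_pM => //.
by rewrite lerXn2r ?nnegrE// lerDr.
Qed.

Lemma gaussfun_schwartzR f : gaussfun f -> schwartzR f.
Proof.
move=> gf; split=> [vs|k vs]; last exact/gaussfun_bound/gaussfun_iter.
split; first exact/gaussfun_continuous/gaussfun_iter.
move=> x v; have [f' _ hf] := gaussfun_derive v (gaussfun_iter vs gf).
by have [] := hf x.
Qed.

Lemma gaussian_cis_schwartz : schwartz (fun z => cis (L z) * (E z)%:C).
Proof.
split; apply: gaussfun_schwartzR.
- exists (fun=> 1), (fun=> 0); split; [exact: polyfun_cst|exact: polyfun_cst|].
  by move=> z; rewrite /= mulr0 subr0 mul1r mul0r addr0.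
- exists (fun=> 0), (fun=> 1); split; [exact: polyfun_cst|exact: polyfun_cst|].
  by move=> z; rewrite /= mulr0 add0r mul0r mul1r add0r.
Qed.

End GaussianSchwartz.

Section GaussianSchwartz12.
Context {R : realType}.

Lemma gaussian_schwartz1 (s x : R) : s != 0 ->
  schwartz1 (fun xi : R => cis (x * xi) * (gaus s xi)%:C).
Proof.
move=> s0.
apply: (@gaussian_cis_schwartz R R^o [set id] _ _ _ (fun xi => x * xi) (gaus s)
  (fun v => x * v) (fun v z => s ^+ 2 * v * z)).
- by move=> l -> z v; exact: is_derive_id.
- by move=> l -> z; exact: cvg_id.
- by move=> l ->.
- move=> z v; apply/is_derive_line.
  have := is_derive_gaus s z => h.
  have : is_derive (0 : R) 1 (gaus s \o (fun t : R => t * v + z)) ((- (s ^+ 2 * z) * gaus s z) * v).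
    apply: is_derive1_comp; first by rewrite mul0r add0r.
    by apply: is_derive_eq; rewrite /GRing.scale/=; ring.
  by move=> h2; apply: is_derive_eq; ring.
- by move=> v; apply: polyfunM; [exact: (polyfun_cst _ (s ^+ 2 * v))|exact: polyfun_coord].
- by move=> z; apply: cvgM; [exact: cvg_cst|exact: cvg_id].
- exact: continuous_gaus.
- exact: gaus_ge0.
- by move=> n; have [C _ hC] := gaus_bound n s0; exists C.
Qed.

Lemma is_derive_fst_comp (f : R -> R) (df : R) (z v : R^o * R^o) :
  is_derive z.1 1 f df -> is_derive z v (fun y : R^o * R^o => f y.1) (df * v.1).
Proof.
move=> h; apply/is_derive_line.
have : is_derive (0 : R) 1 (f \o (fun t : R => t * v.1 + z.1)) (df * v.1).
  apply: is_derive1_comp; first by rewrite mul0r add0r.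
  by apply: is_derive_eq; rewrite /GRing.scale/=; ring.
by [].
Qed.

Lemma is_derive_snd_comp (f : R -> R) (df : R) (z v : R^o * R^o) :
  is_derive z.2 1 f df -> is_derive z v (fun y : R^o * R^o => f y.2) (df * v.2).
Proof.
move=> h; apply/is_derive_line.
have : is_derive (0 : R) 1 (f \o (fun t : R => t * v.2 + z.2)) (df * v.2).
  apply: is_derive1_comp; first by rewrite mul0r add0r.
  by apply: is_derive_eq; rewrite /GRing.scale/=; ring.
by [].
Qed.

(** Testing the Fourier transform of [u] against this function produces a Gaussian mean of [u]
    centred at (x, t). With x = t = 0 it also yields integrability against Gaussians. *)
Lemma gaussian_schwartz2 (s1 s2 x t : R) : s1 != 0 -> s2 != 0 ->
  schwartz2 (fun z : R * R => cis (x * z.1 + t * z.2) * (gaus s1 z.1 * gaus s2 z.2)%:C).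
Proof.
move=> s10 s20.
have d1 (z v : R^o * R^o) : is_derive z v (fun y : R^o * R^o => y.1) v.1.
  by have := is_derive_fst_comp v (is_derive_id z.1 (1 : R)); rewrite mul1r.
have d2 (z v : R^o * R^o) : is_derive z v (fun y : R^o * R^o => y.2) v.2.
  by have := is_derive_snd_comp v (is_derive_id z.2 (1 : R)); rewrite mul1r.
have c1 : continuous (fun y : R^o * R^o => y.1) by move=> z; exact: cvg_fst.
have c2 : continuous (fun y : R^o * R^o => y.2) by move=> z; exact: cvg_snd.
have g1 : continuous (fun y : R^o * R^o => gaus s1 y.1).
  move=> z; apply: (@continuous_comp _ _ _ (fun y : R^o * R^o => y.1) (gaus s1)).
    exact: c1.
  exact: continuous_gaus.
have g2 : continuous (fun y : R^o * R^o => gaus s2 y.2).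
  move=> z; apply: (@continuous_comp _ _ _ (fun y : R^o * R^o => y.2) (gaus s2)).
    exact: c2.
  exact: continuous_gaus.
pose X : set (R^o * R^o -> R) := [set l | l = (fun y => y.1) \/ l = (fun y => y.2)].
have X1 : X (fun y => y.1) by left.
have X2 : X (fun y => y.2) by right.
have n1 (z : R^o * R^o) : `|z.1| <= `|z| by rewrite prod_normE le_max lexx.
have n2 (z : R^o * R^o) : `|z.2| <= `|z| by rewrite prod_normE le_max lexx orbT.
apply: (@gaussian_cis_schwartz R (R^o * R^o)%type X _ _ _
  (fun z => x * z.1 + t * z.2) (fun z => gaus s1 z.1 * gaus s2 z.2)
  (fun v => x * v.1 + t * v.2) (fun v z => s1 ^+ 2 * v.1 * z.1 + s2 ^+ 2 * v.2 * z.2)).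
- by move=> l [->|->] z v.
- by move=> l [->|->].
- by move=> l [->|->].
- move=> z v.
  have ? := is_derive_fst_comp v (is_derive_gaus s1 z.1).
  have ? := is_derive_snd_comp v (is_derive_gaus s2 z.2).
  by apply: is_derive_eq; rewrite /GRing.scale/=; ring.
- move=> v; apply: polyfunD; apply: polyfunM; try exact: polyfun_coord.
  + exact: (polyfun_cst _ (s1 ^+ 2 * v.1)).
  + exact: (polyfun_cst _ (s2 ^+ 2 * v.2)).
- move=> z; apply: cvgD; (apply: cvgM; first exact: cvg_cst); [exact: c1|exact: c2].
- move=> z; apply: cvgM.
  + exact: g1.
  + exact: g2.
- by move=> z; rewrite mulr_ge0 ?gaus_ge0.
- move=> n.
  have [C C0 hC] := gaus_bound n s10; have [D D0 hD] := gaus_bound n s20.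
  exists (C * D) => z.
  apply: (@le_trans _ _ (((1 + `|z.1|) ^+ n * gaus s1 z.1) * ((1 + `|z.2|) ^+ n * gaus s2 z.2))); last first.
    by apply: ler_pM => //; rewrite mulr_ge0 ?gaus_ge0// exprn_ge0// addr_ge0.
  rewrite mulrACA -exprMn ler_wpM2r ?mulr_ge0 ?gaus_ge0//.
  rewrite lerXn2r ?nnegrE ?mulr_ge0 ?addr_ge0//.
  rewrite prod_normE mulrDl mul1r mulrDr mulr1.
  have a0 := normr_ge0 z.1; have b0 := normr_ge0 z.2.
  have ab : 0 <= `|z.1| * `|z.2| by rewrite mulr_ge0.
  move: a0 b0 ab; rewrite /Num.max; case: ifP => _; lra.
Qed.

End GaussianSchwartz12.

(** * Weights and the resonance function *)

Section MeasurableHelpers.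
Context d {V : measurableType d} {R : realType}.
Implicit Types f g : V -> R.

Lemma measurable_fun_powR f (p : R) :
  measurable_fun setT f -> measurable_fun setT (fun x => f x `^ p).
Proof. by move=> mf; exact: (measurableT_comp (measurable_powR p) mf). Qed.

Lemma measurable_fun_norm f :
  measurable_fun setT f -> measurable_fun setT (fun x => `|f x|).
Proof. by move=> mf; exact: measurableT_comp. Qed.

Lemma measurable_funZ f (c : R) :
  measurable_fun setT f -> measurable_fun setT (fun x => c * f x).
Proof. by move=> mf; exact: (measurable_funM (measurable_cst c) mf). Qed.

Lemma measurable_fun_maxc f (c : R) :
  measurable_fun setT f -> measurable_fun setT (fun x => Num.max (f x) c).
Proof. by move=> mf; exact: (measurable_maxr mf (measurable_cst c)). Qed.

Lemma measurable_fun_bracket f :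
  measurable_fun setT f -> measurable_fun setT (fun x => bracket (f x)).
Proof.
move=> mf; rewrite /bracket.
exact: (measurable_funD (measurable_cst (1 : R)) (measurable_fun_norm mf)).
Qed.

Lemma measurable_fun_indic_comp f (A : set R) : measurable A ->
  measurable_fun setT f -> measurable_fun setT (fun x => \1_A (f x) : R).
Proof.
move=> mA mf.
have mi : measurable_fun [set: R] (\1_A : R -> R) by exact: measurable_indic.
exact: (measurableT_comp mi mf).
Qed.

End MeasurableHelpers.

(** * Integrals of powers and of singular weights *)

Section PowerIntegrals.
Context {R : realType}.
Local Notation mu := (@lebesgue_measure R).

Lemma measurable_negR : measurable_fun setT (fun x : R => - x).
Proof. exact: measurableT_comp. Qed.

Lemma lebesgue_measureN (A : set R) : measurable A ->
  mu ((fun x => - x) @^-1` A) = mu A.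
Proof.
move=> mA.
have mN := measurable_negR.
pose nu : {measure set (measurableTypeR R) -> \bar R} :=
  pushforward mu (fun x : measurableTypeR R => (- x : measurableTypeR R)).
suff: mu A = nu mN A by [].
apply: lebesgue_measure_unique => // _ [[a b] _ <-] /=.
rewrite /nu/= /pushforward/=.
rewrite (_ : _ @^-1` _ = `[- b, - a[%classic); last first.
  by apply/seteqP; split => x /=; rewrite !in_itv/= ltrNr lerNl andbC.
rewrite !lebesgue_measure_itv/= !lte_fin ltrN2.
by case: ifP => // _; rewrite -!EFinD; congr _%:E; ring.
Qed.

Lemma ge0_integralN (f : R -> \bar R) : measurable_fun setT f ->
  (forall x, 0 <= f x)%E ->
  (\int[mu]_x f (- x)%R = \int[mu]_x f x)%E.
Proof.
move=> mf f0.
have mN := measurable_negR.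
have := @ge0_integral_pushforward _ _ _ _ R (fun x : measurableTypeR R => (- x : measurableTypeR R))
  mN mu setT f measurableT mf (fun x _ => f0 x).
rewrite preimage_setT => <-.
apply: eq_measure_integral => A mA _.
change (mu ((fun x : R => - x) @^-1` (A : set R)) = mu (A : set R)).
exact: lebesgue_measureN.
Qed.

Lemma continuous_powR (r x : R) : 0 < x -> {for x, continuous (fun y : R => y `^ r)}.
Proof.
move=> x0; apply/differentiable_continuous/derivable1_diffP.
by have [] := is_derive1_powR r x0.
Qed.

Lemma powRDp (x r t : R) : 0 < x -> x `^ (r + t) = x `^ r * x `^ t.
Proof. by move=> x0; rewrite powRD// (gt_eqF x0) implybT. Qed.

Lemma integral_powR (u v r : R) : 0 < u -> u < v -> r + 1 != 0 ->
  (\int[mu]_(x in `[u, v]) (x `^ r)%:E =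
   ((v `^ (r + 1) - u `^ (r + 1)) / (r + 1))%:E)%E.
Proof.
move=> u0 uv r1; have v0 := lt_trans u0 uv.
rewrite (@continuous_FTC2 _ _ (fun x => (r + 1)^-1 * x `^ (r + 1)) _ _ uv).
- by rewrite -EFinB -mulrBr mulrC.
- apply: continuous_in_subspaceT => x; rewrite inE/= in_itv/= => /andP[ux _].
  exact/continuous_powR/(lt_le_trans u0 ux).
- have cF x : 0 < x -> {for x, continuous (fun y : R => (r + 1)^-1 * y `^ (r + 1))}.
    by move=> x0; apply: cvgM; [exact: cvg_cst|exact: continuous_powR].
  split.
  + move=> x; rewrite in_itv/= => /andP[ux _].
    have x0 := lt_trans u0 ux.
    by apply: derivableM => //; have [] := is_derive1_powR (r + 1) x0.
  + exact: cvg_at_right_filter (cF _ u0).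
  + exact: cvg_at_left_filter (cF _ v0).
- move=> x; rewrite in_itv/= => /andP[ux _].
  have x0 := lt_trans u0 ux; have := is_derive1_powR (r + 1) x0 => ?.
  rewrite derive1E; apply: derive_val; apply: is_derive_eq.
  by rewrite /GRing.scale/= addrK mulKf// addr0.
Qed.

Lemma integral_powR_near0 (u v r : R) : 0 < u -> 0 < v -> -1 < r ->
  (\int[mu]_(x in `[u, v]) (x `^ r)%:E <= (v `^ (r + 1) / (r + 1))%:E)%E.
Proof.
move=> u0 v0 r1; have rp : 0 < r + 1 by lra.
have [uv|vu|->] := ltgtP u v.
- rewrite integral_powR// ?gt_eqF// lee_fin ler_pM2r ?invr_gt0//.
  by rewrite gerDl oppr_le0 powR_ge0.
- rewrite set_itv_ge ?integral_set0 ?lee_fin ?divr_ge0 ?powR_ge0 ?ltW//.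
  by rewrite bnd_simp -ltNge.
- by rewrite set_itv1 integral_set1 lee_fin divr_ge0 ?powR_ge0// ltW.
Qed.

Lemma integral_powR_nearoo (u v r : R) : 0 < u -> 0 < v -> r < -1 ->
  (\int[mu]_(x in `[u, v]) (x `^ r)%:E <= (u `^ (r + 1) / (- (r + 1)))%:E)%E.
Proof.
move=> u0 v0 r1; have rp : 0 < - (r + 1) by lra.
have [uv|vu|->] := ltgtP u v.
- rewrite integral_powR//; last by rewrite lt_eqF// -oppr_gt0.
  rewrite lee_fin -[leLHS]mulrNN -invrN ler_pM2r ?invr_gt0//.
  by rewrite opprB gerDl oppr_le0 powR_ge0.
- rewrite set_itv_ge ?integral_set0 ?lee_fin ?divr_ge0 ?powR_ge0 ?ltW//.
  by rewrite bnd_simp -ltNge.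
- by rewrite set_itv1 integral_set1 lee_fin divr_ge0 ?powR_ge0// ltW.
Qed.

(* The indicator of {0} makes [sing] dominate functions that do not vanish at
   0, where 0 `^ (- a) = 0. *)
Definition sing (a b c x : R) : R :=
  \1_[set (0 : R)] x + `|x| `^ (- a) * (Num.max `|x| c) `^ (- b).

Lemma sing_ge0 a b c x : 0 <= sing a b c x.
Proof. by rewrite /sing addr_ge0 ?mulr_ge0 ?powR_ge0// indicE. Qed.

Lemma singN a b c x : sing a b c (- x) = sing a b c x.
Proof.
rewrite /sing normrN !indicE; congr (_%:R + _).
suff -> : (- x \in [set (0 : R)]) = (x \in [set (0 : R)]) by [].
apply/idP/idP; rewrite !inE/=; first by move/eqP; rewrite oppr_eq0 => /eqP.
by move=> ->; rewrite oppr0.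
Qed.

Lemma measurable_sing a b c : measurable_fun setT (sing a b c).
Proof.
apply: measurable_funD; first exact: measurable_indic.
apply: measurable_funM; apply: measurable_fun_powR.
  exact: measurable_fun_norm.
by apply: measurable_fun_maxc; exact: measurable_fun_norm.
Qed.

(** Split at |x| = c: inside, the integrand is c^-b |x|^-a, integrable since a < 1; outside it is
    |x|^{-a-b}, integrable since a + b > 1; both pieces scale like c^{1-a-b}. The fundamental
    theorem applies on compact intervals away from 0, hence the truncations [g n] followed by Fatou,
    and the doubled constant accounts for the two half-lines. *)
Lemma integral_sing (a b : R) : 0 <= a -> a < 1 -> 0 <= b -> 1 < a + b ->
  exists2 K, 0 <= K & forall c, 0 < c ->
    (\int[mu]_x (sing a b c x)%:E <= (K * c `^ (1 - a - b))%:E)%E.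
Proof.
move=> a0 a1 b0 ab1.
pose K0 := (1 - a)^-1 + (a + b - 1)^-1.
have K00 : 0 <= K0 by rewrite addr_ge0// invr_ge0; lra.
exists (K0 + K0) => [|c c0]; first exact: addr_ge0.
pose g (n : nat) (x : R) : R :=
  c `^ (- b) * (x `^ (- a) * \1_(`[n.+1%:R^-1, c]%classic) x) +
  x `^ (- a - b) * \1_(`[c, n.+1%:R]%classic) x.
have g0 n x : 0 <= g n x.
  by rewrite addr_ge0// !mulr_ge0 ?powR_ge0// indicE.
have mg1 n : measurable_fun setT
    (fun x : R => x `^ (- a) * \1_(`[n.+1%:R^-1, c]%classic) x).
  by apply: measurable_funM; [exact: measurable_powR|exact: measurable_indic].
have mg2 n : measurable_fun setT
    (fun x : R => x `^ (- a - b) * \1_(`[c, n.+1%:R]%classic) x).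
  by apply: measurable_funM; [exact: measurable_powR|exact: measurable_indic].
have mg1' n := measurable_funZ (c `^ (- b)) (mg1 n).
have mg n : measurable_fun setT (g n) by exact: (measurable_funD (mg1' n) (mg2 n)).
have mgN n : measurable_fun setT (fun x : R => g n (- x)).
  exact: (measurableT_comp (mg n) measurable_negR).
have ig n : (\int[mu]_x (g n x)%:E <= (K0 * c `^ (1 - a - b))%:E)%E.
  under eq_integral do rewrite EFinD.
  rewrite ge0_integralD//; last 4 first.
  - by move=> x _; rewrite lee_fin !mulr_ge0 ?powR_ge0// indicE.
  - by apply/measurable_EFinP; exact: mg1'.
  - by move=> x _; rewrite lee_fin !mulr_ge0 ?powR_ge0// indicE.
  - by apply/measurable_EFinP; exact: mg2.
  rewrite /K0 mulrDl EFinD; apply: leeD.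
    under eq_integral do rewrite EFinM.
    rewrite ge0_integralZl_EFin ?powR_ge0//; last 2 first.
    - by move=> x _; rewrite lee_fin !mulr_ge0 ?powR_ge0// indicE.
    - by apply/measurable_EFinP; exact: mg1.
    rewrite integral_indicR.
    apply: le_trans (lee_wpmul2l _ (integral_powR_near0 _ c0 _)) _.
    - by rewrite lee_fin powR_ge0.
    - by rewrite invr_gt0.
    - by rewrite ltrN2.
    rewrite -EFinM lee_fin mulrA -powRDp//.
    by rewrite mulrC (_ : - b + (- a + 1) = 1 - a - b) 1?(addrC (- a)); [|ring].
  rewrite integral_indicR.
  apply: le_trans (integral_powR_nearoo c0 _ _) _ => //; first lra.
  rewrite lee_fin mulrC (_ : - a - b + 1 = 1 - a - b); last by ring.
  by rewrite (_ : - (1 - a - b) = a + b - 1)//; ring.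
rewrite (_ : (\int[mu]_x _)%E = \int[mu]_x (`|x| `^ (- a) * (Num.max `|x| c) `^ (- b))%:E)%E; last first.
  apply: ae_eq_integral => //.
  - by apply/measurable_EFinP; exact: measurable_sing.
  - apply/measurable_EFinP; apply: measurable_funM; apply: measurable_fun_powR.
      exact: measurable_fun_norm.
    by apply: measurable_fun_maxc; exact: measurable_fun_norm.
  - exists [set (0 : R)]; split => //; first exact: lebesgue_measure_set1.
    move=> x /= h; apply: contrapT => x0; apply: h => _.
    by rewrite /sing indicE (_ : (x \in [set 0]) = false) ?add0r//; apply/negP; rewrite inE.
pose f (n : nat) (x : R) : R := `|x| `^ (- a) * (Num.max `|x| c) `^ (- b) *
  \1_(`[n.+1%:R^-1, n.+1%:R]%classic) `|x|.
have mf0 : measurable_fun setT (fun x : R => `|x| `^ (- a) * (Num.max `|x| c) `^ (- b)).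
  apply: measurable_funM; apply: measurable_fun_powR.
    exact: measurable_fun_norm.
  by apply: measurable_fun_maxc; exact: measurable_fun_norm.
have mf n : measurable_fun setT (f n).
  apply: measurable_funM => //.
  exact: measurable_fun_indic_comp.
have fg n x : f n x <= g n x + g n (- x).
  wlog x0 : x / 0 <= x.
    move=> h; have [/h//|x0] := leP 0 x.
    have := h (- x); rewrite opprK addrC {1}/f normrN; apply; lra.
  have gN : 0 <= g n (- x) by exact: g0.
  rewrite /f ger0_norm// -[leLHS]addr0 lerD// /g !indicE.
  have mI (u v : R) : (x \in `[u, v]%classic) = (u <= x) && (x <= v).
    by apply/idP/idP; rewrite inE/= in_itv.
  rewrite !mI.
  have [nx|nx] /= := leP n.+1%:R^-1 x; last first.
    by rewrite mulr0 addr_ge0// !mulr_ge0 ?powR_ge0.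
  have xp : 0 < x by apply: lt_le_trans nx; rewrite invr_gt0.
  have [xn|xn] /= := leP x n.+1%:R; last first.
    by rewrite mulr0 addr_ge0// !mulr_ge0 ?powR_ge0.
  rewrite andbT mulr1; have [xc|cx] := leP x c.
    by rewrite mulr1 mulrC lerDl mulr_ge0// powR_ge0.
  by rewrite (ltW cx) mulr1 !mulr0 add0r -powRDp.
apply: (@fatou_bound _ _ _ mu f _ _ mf mf0).
- by move=> n x; rewrite !mulr_ge0 ?powR_ge0// indicE.
- exists [set (0 : R)]; split => //; first exact: lebesgue_measure_set1.
  move=> x /= h; apply: contrapT => x0; apply: h.
  have {}x0 : 0 < `|x| by rewrite normr_gt0; apply/eqP.
  apply: cvg_near_cst; near=> n.
  rewrite /f indicE mem_set ?mulr1//= in_itv/=; apply/andP; split.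
    rewrite -[`|x|]invrK lef_pV2 ?posrE ?invr_gt0//.
    apply: (@le_trans _ _ n%:R); last by rewrite ler_nat.
    by near: n; exact: nbhs_infty_ger.
  apply: (@le_trans _ _ n%:R); last by rewrite ler_nat.
  by near: n; exact: nbhs_infty_ger.
- near=> n.
  apply: (@le_trans _ _ (\int[mu]_x ((g n x)%:E + (g n (- x))%:E))%E).
    apply: ge0_le_integral => //.
    + by move=> x _; rewrite lee_fin !mulr_ge0 ?powR_ge0// indicE.
    + by apply/measurable_EFinP; exact: mf.
    + by apply: emeasurable_funD; apply/measurable_EFinP; [exact: mg|exact: mgN].
    + by move=> x _; rewrite -EFinD lee_fin.
  rewrite ge0_integralD//; last 4 first.
  + by move=> x _; rewrite lee_fin.
  + by apply/measurable_EFinP; exact: mg.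
  + by move=> x _; rewrite lee_fin.
  + by apply/measurable_EFinP; exact: mgN.
  rewrite (@ge0_integralN (fun x => (g n x)%:E)); last 2 first.
  + by apply/measurable_EFinP; exact: mg.
  + by move=> x; rewrite lee_fin.
  by rewrite mulrDl EFinD; exact: leeD.
Unshelve. all: by end_near. Qed.

End PowerIntegrals.

(** * Integrals of products of brackets *)

Section Weights.
Context {R : realType}.
Local Notation mu := (@lebesgue_measure R).
Local Notation mu2 := (mu \x mu)%E.

Lemma bracket_ge1 (x : R) : 1 <= bracket x.
Proof. by rewrite /bracket lerDl. Qed.

Lemma bracket_gt0 (x : R) : 0 < bracket x.
Proof. exact: lt_le_trans ltr01 (bracket_ge1 x). Qed.

Lemma bracketD (x y : R) : bracket (x + y) <= bracket x * bracket y.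
Proof.
rewrite /bracket; have := ler_normD x y; have := normr_ge0 x; have := normr_ge0 y.
by move: `|x| `|y| `|x + y| => p q t; nra.
Qed.

Lemma bracketN (x : R) : bracket (- x) = bracket x.
Proof. by rewrite /bracket normrN. Qed.

Lemma powR_antitone (x y r : R) : 0 < x -> x <= y -> 0 <= r -> y `^ (- r) <= x `^ (- r).
Proof.
move=> x0 xy r0; have y0 := lt_le_trans x0 xy.
by rewrite !powRN lef_pV2 ?posrE ?powR_gt0// ge0_ler_powR// ?nnegrE ltW.
Qed.

Lemma sing_bracket (b x : R) : 0 <= b -> bracket x `^ (- b) <= sing 0 b 1 x.
Proof.
move=> b0; rewrite /sing oppr0 powRr0 mul1r.
apply: (@le_trans _ _ (Num.max `|x| 1 `^ (- b))); last by rewrite lerDr indicE.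
apply: powR_antitone => //.
by rewrite ge_max /bracket lerDr lerDl ler01 normr_ge0.
Qed.

(** From <A - B> <= <x + A> <x + B> the factor <x + A>^-p is at most <A - B>^-p <x + B>^p. The
    remaining power <x + B>^{-(2 - p)} is integrable because p < 1. *)
Lemma integral_bracket2 (p : R) : 0 <= p -> p < 1 ->
  exists2 C, 0 <= C & forall A B,
  (\int[mu]_x (bracket (x + A) `^ (- p) * bracket (x + B) `^ (- 2))%:E <=
   (C * bracket (A - B) `^ (- p))%:E)%E.
Proof.
move=> p0 p1.
have h1 : 0 <= 2 - p by lra.
have h2 : 1 < 0 + (2 - p) by lra.
have [K K0 hK] := integral_sing (lexx 0) ltr01 h1 h2.
exists K => // A B.
have pw (x : R) : bracket (x + A) `^ (- p) * bracket (x + B) `^ (- 2) <=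
    bracket (A - B) `^ (- p) * sing 0 (2 - p) 1 (x + B).
  apply: (@le_trans _ _ (bracket (A - B) `^ (- p) * (bracket (x + B) `^ (- (2 - p))))); last first.
    by rewrite ler_wpM2l ?powR_ge0// sing_bracket.
  rewrite (_ : - (2 - p) = p + (- 2)); last by ring.
  rewrite powRDp ?bracket_gt0// mulrA ler_wpM2r ?powR_ge0//.
  rewrite !powRN -[X in _ <= _ * X]invrK -invfM lef_pV2 ?posrE; last 2 first.
  - by rewrite powR_gt0 ?bracket_gt0.
  - by rewrite mulr_gt0// ?invr_gt0 powR_gt0 ?bracket_gt0.
  rewrite ler_pdivrMr ?powR_gt0 ?bracket_gt0// -powRM ?(ltW (bracket_gt0 _))//.
  rewrite ge0_ler_powR// ?nnegrE ?mulr_ge0 ?(ltW (bracket_gt0 _))//.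
  rewrite (_ : A - B = (x + A) + - (x + B)); last by ring.
  by apply: le_trans (bracketD _ _) _; rewrite bracketN.
have ms : measurable_fun setT (fun x : R => sing 0 (2 - p) 1 (x + B)).
  exact: (measurableT_comp (measurable_sing _ _ _) (measurable_addr B)).
apply: (@le_trans _ _ (\int[mu]_x ((bracket (A - B) `^ (- p))%:E * (sing 0 (2 - p) 1 (x + B))%:E))%E).
  apply: ge0_le_integral => //.
  - by move=> x _; rewrite lee_fin mulr_ge0 ?powR_ge0.
  - apply/measurable_EFinP; apply: measurable_funM; apply: measurable_fun_powR;
    by apply: measurable_fun_bracket; exact: measurable_addr.
  - by apply/measurable_EFinP; exact: measurable_funZ.
  - by move=> x _; rewrite lee_fin.
rewrite ge0_integralZl_EFin ?powR_ge0//; last 2 first.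
- by move=> x _; rewrite lee_fin sing_ge0.
- by apply/measurable_EFinP; exact: ms.
rewrite (@ge0_integral_shift _ B (fun x => (sing 0 (2 - p) 1 x)%:E)); last 2 first.
- by apply/measurable_EFinP; exact: measurable_sing.
- by move=> x; rewrite lee_fin sing_ge0.
apply: le_trans (lee_wpmul2l _ (hK 1 ltr01)) _; first by rewrite lee_fin powR_ge0.
by rewrite -EFinM lee_fin powR1 mulr1 mulrC.
Qed.

(** |x|^-t, corrected at 0, where the power convention gives 0 for t <> 0: an upper bound by a
    negative power must not vanish where the resonance does. *)
Definition spow (t x : R) : R := \1_[set (0 : R)] x + `|x| `^ (- t).

Lemma spow_ge0 t x : 0 <= spow t x.
Proof. by rewrite /spow addr_ge0 ?powR_ge0// indicE. Qed.

Lemma spow0 t : t != 0 -> spow t 0 = 1.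
Proof.
by move=> t0; rewrite /spow indicE mem_set// normr0 powR0 ?addr0// oppr_eq0.
Qed.

Lemma spow_n0 t x : x != 0 -> spow t x = `|x| `^ (- t).
Proof.
move=> /eqP x0; rewrite /spow indicE (_ : (x \in [set 0]) = false) ?add0r//.
by apply/negP; rewrite inE.
Qed.

Lemma measurable_spow t : measurable_fun setT (spow t).
Proof.
apply: measurable_funD; first exact: measurable_indic.
by apply: measurable_fun_powR; exact: measurable_fun_norm.
Qed.

Lemma bracket_powR_le1 (x r : R) : 0 <= r -> bracket x `^ (- r) <= 1.
Proof.
move=> r0; have <- : 1 `^ (- r) = 1 :> R by rewrite powR1.
by apply: powR_antitone => //; exact: bracket_ge1.
Qed.

Lemma bracket2_sing (q p x y c : R) : 0 < q -> q <= p -> 0 < c ->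
  2 * c <= `|x - y| -> `|x| <= `|y| ->
  bracket x `^ (- p) * bracket y `^ (- p) <= sing q q c x.
Proof.
move=> q0 qp c0 cxy xy; have p0 : 0 < p by lra.
have [->|x0] := eqVneq x 0.
  rewrite /sing indicE mem_set// normr0 powR0 ?mul0r ?addr0; last by rewrite oppr_eq0 gt_eqF.
  by rewrite mulr_ile1 ?powR_ge0 ?bracket_powR_le1// ltW.
rewrite /sing; apply: (@le_trans _ _ (`|x| `^ (- q) * Num.max `|x| c `^ (- q))); last first.
  by rewrite lerDr indicE.
have h (z : R) : bracket z `^ (- p) <= bracket z `^ (- q).
  by apply: ler_powR; [exact: bracket_ge1|rewrite lerN2].
have cy : c <= `|y|.
  by have := ler_normB x y; move: cxy xy; lra.
apply: ler_pM; rewrite ?powR_ge0//.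
- apply: le_trans (h x) _; apply: powR_antitone; rewrite ?normr_gt0// ?(ltW q0)//.
  by rewrite /bracket lerDr.
- apply: le_trans (h y) _; apply: powR_antitone; rewrite ?lt_max ?c0 ?orbT// ?(ltW q0)//.
  have yb : `|y| <= bracket y by rewrite /bracket lerDr.
  by rewrite ge_max (le_trans xy yb) (le_trans cy yb).
Qed.

(** At each point the larger of |x + A| and |x + B| is at least |A - B| / 2, so the product is
    dominated by two copies of [sing q q] at that scale. Here q < 1 gives integrability at the
    singularity and 2q > 1 at infinity. The constant is uniform in p >= q, so a weaker exponent than
    the available one can be chosen. *)
Lemma integral_bracket11 (q : R) : 1 / 2 < q -> q < 1 ->
  exists2 C, 0 <= C & forall p A B, q <= p ->
  (\int[mu]_x (bracket (x + A) `^ (- p) * bracket (x + B) `^ (- p))%:E <=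
   (C * spow (2 * q - 1) (A - B))%:E)%E.
Proof.
move=> q2 q1.
have q0 : 0 <= q by lra.
have qp0 : 0 < q by lra.
have h1 : 1 < q + q by lra.
have [K K0 hK] := integral_sing q0 q1 q0 h1.
have h2 : 1 < 0 + (q + q) by lra.
have h3 : 0 <= q + q by lra.
have [K' K'0 hK'] := integral_sing (lexx 0) ltr01 h3 h2.
have c20 : 0 <= 2^-1 `^ (1 - q - q) :> R by exact: powR_ge0.
exists ((K + K) * 2^-1 `^ (1 - q - q) + K') => [|p A B qp].
  by rewrite addr_ge0// mulr_ge0// addr_ge0.
have p0 : 0 <= p by lra.
have mf : measurable_fun setT (fun x : R =>
    (bracket (x + A) `^ (- p) * bracket (x + B) `^ (- p))%:E).
  apply/measurable_EFinP; apply: measurable_funM; apply: measurable_fun_powR;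
  by apply: measurable_fun_bracket; exact: measurable_addr.
have msh c d (a e : R) : measurable_fun setT (fun x : R => sing a e c (x + d)).
  exact: (measurableT_comp (measurable_sing _ _ _) (measurable_addr d)).
(* When the centres coincide there is no scale |A - B| to split at; the bound is then taken at scale
   1, matching the value 1 of [spow] at 0. *)
have [AB|AB] := eqVneq A B.
  rewrite AB subrr spow0; last by rewrite gt_eqF//; lra.
  rewrite mulr1; apply: (@le_trans _ _ (\int[mu]_x (sing 0 (q + q) 1 (x + B))%:E)%E).
    apply: ge0_le_integral => //.
    - by move=> x _; rewrite lee_fin mulr_ge0 ?powR_ge0.
    - by rewrite AB in mf; exact: mf.
    - by apply/measurable_EFinP; exact: msh.
    - move=> x _; rewrite lee_fin; apply: le_trans (sing_bracket _ _) => //.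
      rewrite -powRDp ?bracket_gt0//; apply: ler_powR; first exact: bracket_ge1.
      by move: qp; lra.
  rewrite (@ge0_integral_shift _ B (fun x => (sing 0 (q + q) 1 x)%:E)); last 2 first.
  - by apply/measurable_EFinP; exact: measurable_sing.
  - by move=> x; rewrite lee_fin sing_ge0.
  apply: le_trans (hK' 1 ltr01) _.
  by rewrite powR1 mulr1 lee_fin lerDr mulr_ge0// addr_ge0.
have AB0 : 0 < `|A - B| by rewrite normr_gt0 subr_eq0.
have c0 : 0 < `|A - B| / 2 by rewrite divr_gt0.
rewrite spow_n0 ?subr_eq0//.
apply: (@le_trans _ _ (\int[mu]_x ((sing q q (`|A - B| / 2) (x + A))%:E +
    (sing q q (`|A - B| / 2) (x + B))%:E))%E).
  apply: ge0_le_integral => //.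
  - by move=> x _; rewrite lee_fin mulr_ge0 ?powR_ge0.
  - by apply: emeasurable_funD; apply/measurable_EFinP; exact: msh.
  - move=> x _; rewrite -EFinD lee_fin.
    have [xAB|xBA] := leP `|x + A| `|x + B|.
      rewrite -[leLHS]addr0 lerD ?sing_ge0//; apply: bracket2_sing => //.
      rewrite mulrC divfK//.
      by rewrite (_ : x + A - (x + B) = A - B)//; ring.
    rewrite -[leLHS]add0r lerD ?sing_ge0// mulrC; apply: bracket2_sing => //; last exact: ltW.
    rewrite mulrC divfK//.
    by rewrite distrC (_ : B - A = x + B - (x + A))//; ring.
rewrite ge0_integralD//; last 4 first.
- by move=> x _; rewrite lee_fin sing_ge0.
- by apply/measurable_EFinP; exact: msh.
- by move=> x _; rewrite lee_fin sing_ge0.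
- by apply/measurable_EFinP; exact: msh.
rewrite (@ge0_integral_shift _ A (fun x => (sing q q (`|A - B| / 2) x)%:E)); last 2 first.
- by apply/measurable_EFinP; exact: measurable_sing.
- by move=> x; rewrite lee_fin sing_ge0.
rewrite (@ge0_integral_shift _ B (fun x => (sing q q (`|A - B| / 2) x)%:E)); last 2 first.
- by apply/measurable_EFinP; exact: measurable_sing.
- by move=> x; rewrite lee_fin sing_ge0.
apply: le_trans (leeD (hK _ c0) (hK _ c0)) _.
rewrite -EFinD lee_fin powRM ?invr_ge0//.
rewrite (_ : - (2 * q - 1) = 1 - q - q); last by ring.
have := powR_ge0 `|A - B| (1 - q - q).
move: c20; move: (2^-1 `^ _) (`|A - B| `^ _) => u v u0 v0.
have : 0 <= K' * v by rewrite mulr_ge0.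
by lra.
Qed.

(** Integrating in [y] merges the last two brackets into <x + B - A2>^-p, and integrating in [x]
    then leaves a power of A1 + A2 - B, in which both variables have cancelled. In the application
    this combination is the resonance function. *)
Lemma integral_bracket3 (q p : R) : 1 / 2 < q -> q <= p -> p < 1 ->
  exists2 C, 0 <= C & forall A1 A2 B,
  (\int[mu]_x \int[mu]_y (bracket (x + A1) `^ (- p) * bracket (y + A2) `^ (- p) *
     bracket (x + y + B) `^ (- 2))%:E <= (C * spow (2 * q - 1) (A1 + A2 - B))%:E)%E.
Proof.
move=> q2 qp p1; have q1 : q < 1 by lra.
have p0 : 0 <= p by lra.
have [C C0 hC] := integral_bracket2 p0 p1.
have [D D0 hD] := integral_bracket11 q2 q1.
exists (C * D) => [|A1 A2 B]; first exact: mulr_ge0.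
have mb A : measurable_fun setT (fun x : R => bracket (x + A) `^ (- p)).
  by apply: measurable_fun_powR; apply: measurable_fun_bracket; exact: measurable_addr.
apply: (@le_trans _ _ (\int[mu]_x (C%:E * (bracket (x + A1) `^ (- p) * bracket (x + (B - A2)) `^ (- p))%:E))%E).
  apply: ge0_le_integral => //.
  - by move=> x _; apply: integral_ge0 => y _; rewrite lee_fin !mulr_ge0 ?powR_ge0.
  - apply: (@measurable_fun_fubini_tonelli_F _ _ _ _ _ mu
      (fun z : R * R => (bracket (z.1 + A1) `^ (- p) * bracket (z.2 + A2) `^ (- p) *
     bracket (z.1 + z.2 + B) `^ (- 2))%:E)).
      apply/measurable_EFinP; apply: measurable_funM.
        apply: measurable_funM; apply: measurable_fun_powR; apply: measurable_fun_bracket;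
        exact: measurable_funD.
      apply: measurable_fun_powR; apply: measurable_fun_bracket.
      by apply: measurable_funD => //; exact: measurable_funD.
    by move=> z; rewrite lee_fin !mulr_ge0 ?powR_ge0.
  - apply/measurable_EFinP; apply: measurable_funZ.
    exact: (measurable_funM (mb _) (mb _)).
  - move=> x _.
    have e y : bracket (x + y + B) = bracket (y + (x + B)).
      by congr bracket; ring.
    under eq_integral do rewrite e -mulrA EFinM.
    rewrite ge0_integralZl_EFin ?powR_ge0//; last 2 first.
    + by move=> y _; rewrite lee_fin mulr_ge0 ?powR_ge0.
    + apply/measurable_EFinP; apply: (measurable_funM (mb _)).
      by apply: measurable_fun_powR; apply: measurable_fun_bracket; exact: measurable_addr.
    apply: le_trans (lee_wpmul2l _ (hC _ _)) _; first by rewrite lee_fin powR_ge0.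
    rewrite -!EFinM lee_fin -[bracket (A2 - _)]bracketN (_ : - (A2 - (x + B)) = x + (B - A2)); last by ring.
    by rewrite mulrCA.
rewrite ge0_integralZl_EFin//; last 2 first.
- by move=> x _; rewrite lee_fin mulr_ge0 ?powR_ge0.
- by apply/measurable_EFinP; exact: (measurable_funM (mb _) (mb _)).
apply: le_trans (lee_wpmul2l _ (hD p _ _ qp)) _; first by rewrite lee_fin.
rewrite -EFinM lee_fin mulrA (_ : A1 - (B - A2) = A1 + A2 - B)//; ring.
Qed.

End Weights.

(** * Size of the resonance function *)

Section TrilinearBound.
Context {R : realType}.
Local Notation mu := (@lebesgue_measure R).
Local Notation mu2 := (mu \x mu)%E.

Lemma eq_ler (x y : R) : x = y -> x <= y.
Proof. by move=> ->. Qed.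

Lemma resonance (x y : R) :
  x ^+ 5 + y ^+ 5 - (x + y) ^+ 5 =
  - (5 / 2 * (x + y) * x * y * ((x + y) ^+ 2 + x ^+ 2 + y ^+ 2)).
Proof. by field. Qed.

(** In the factorization of [resonance], the larger input frequency |y| dominates |x| and also |x +
    y| / 2, and |y| times the quadratic factor is at least |y|^3 up to 5/2. The resonance is
    therefore at least |x + y| |x| max(|x|, |x + y| / 2)^3, which is the origin of the exponents [t]
    and [3 * t] in [sing]. *)
Lemma spow_resonance (t x y : R) : 0 < t -> x + y != 0 -> `|x| <= `|y| ->
  spow t (x ^+ 5 + y ^+ 5 - (x + y) ^+ 5) <=
  \1_[set (0 : R)] x + `|x + y| `^ (- t) * sing t (3 * t) (`|x + y| / 2) x.
Proof.
move=> t0 xy0 xy.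
have r0 : 0 <= `|x + y| `^ (- t) * sing t (3 * t) (`|x + y| / 2) x.
  by rewrite mulr_ge0 ?powR_ge0 ?sing_ge0.
have [->|x0] := eqVneq x 0.
  rewrite (_ : _ - _ = 0); last by ring.
  by rewrite spow0 ?gt_eqF// indicE mem_set// lerDl mulr_ge0 ?powR_ge0 ?sing_ge0.
have xy2 : `|x + y| <= 2 * `|y| by have := ler_normD x y; lra.
have y0 : 0 < `|y| by apply: lt_le_trans xy; rewrite normr_gt0.
set c := `|x + y| / 2.
have c0 : 0 < c by rewrite divr_gt0// normr_gt0.
have m0 : 0 < Num.max `|x| c by rewrite lt_max c0 orbT.
have my : Num.max `|x| c <= `|y| by rewrite ge_max xy/= /c; lra.
have s0 : 0 < `|x + y| by rewrite normr_gt0.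
have xp : 0 < `|x| by rewrite normr_gt0.
apply: (@le_trans _ _ (`|x + y| `^ (- t) * (`|x| `^ (- t) * (Num.max `|x| c) `^ (- (3 * t))))); last first.
  apply: (@le_trans _ _ (`|x + y| `^ (- t) * sing t (3 * t) c x)).
    by rewrite ler_wpM2l ?powR_ge0// /sing lerDr indicE.
  by rewrite lerDr indicE.
rewrite resonance.
have h0 : 0 < (x + y) ^+ 2 + x ^+ 2 + y ^+ 2.
  by rewrite ltr_wpDl// ?addr_ge0 ?sqr_ge0// -real_normK ?num_real// exprn_gt0.
rewrite spow_n0; last first.
  have yn0 : y != 0 by rewrite -normr_gt0.
  by rewrite oppr_eq0 !mulf_neq0 ?invr_neq0 ?(gt_eqF h0)// pnatr_eq0.
have -> : Num.max `|x| c `^ (- (3 * t)) = (Num.max `|x| c ^+ 3) `^ (- t).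
  by rewrite -powR_mulrn ?(ltW m0)// -powRrM mulrN.
rewrite -!powRM ?exprn_ge0 ?(ltW m0)//; last by rewrite mulr_ge0// exprn_ge0 ?(ltW m0).
apply: powR_antitone; rewrite ?(ltW t0)// ?mulr_gt0// ?exprn_gt0//.
rewrite normrN (_ : 5 / 2 * (x + y) * x * y * _ =
  (x + y) * x * y * (5 / 2 * ((x + y) ^+ 2 + x ^+ 2 + y ^+ 2))); last by ring.
rewrite normrM [X in _ <= _ * X]gtr0_norm; last by rewrite mulr_gt0//; lra.
rewrite !normrM.
have h1 : Num.max `|x| c ^+ 3 <= `|y| ^+ 3.
  by rewrite lerXn2r ?nnegrE ?(ltW m0).
have h2 : `|y| ^+ 3 <= 5 / 2 * (`|y| * ((x + y) ^+ 2 + x ^+ 2 + y ^+ 2)).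
  rewrite -(real_normK (num_real y)).
  have := sqr_ge0 (x + y); have := sqr_ge0 x.
  have : 0 <= `|y| ^+ 3 by rewrite exprn_ge0.
  have -> : `|y| * ((x + y) ^+ 2 + x ^+ 2 + `|y| ^+ 2) =
     `|y| * ((x + y) ^+ 2 + x ^+ 2) + `|y| ^+ 3 by ring.
  move: ((x + y) ^+ 2) (x ^+ 2) => u v h3 v0 u0.
  have : 0 <= `|y| * (u + v) by rewrite mulr_ge0 ?addr_ge0// ltW.
  lra.
rewrite (_ : `|x + y| * `|x| * `|y| * _ =
  `|x + y| * (`|x| * (5 / 2 * (`|y| * ((x + y) ^+ 2 + x ^+ 2 + y ^+ 2))))); last by ring.
by rewrite !ler_pM2l// (le_trans h1 h2).
Qed.

(** The resonance is homogeneous of degree 5 in the two frequencies, hence the power 1 - 5t. It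
    vanishes at y = 0 and y = x, where t < 1 gives integrability, while 4t > 1 suffices at infinity.
    The substitution y -> x - y exchanges the two zeros, so one majorant [M] and its translate cover
    both. *)
Lemma singular_resonance_integral (t : R) : 3 / 5 <= t -> t < 1 ->
  exists2 C, 0 <= C & forall x, x != 0 ->
  (\int[mu]_y (spow t (y ^+ 5 + (x - y) ^+ 5 - x ^+ 5))%:E <=
   (C * `|x| `^ (1 - 5 * t))%:E)%E.
Proof.
move=> t1 t2; have t0 : 0 < t by lra.
have h1 : 0 <= 3 * t by lra.
have h2 : 1 < t + 3 * t by lra.
have [K K0 hK] := integral_sing (ltW t0) t2 h1 h2.
exists (2 * K * 2^-1 `^ (1 - t - 3 * t)) => [|x x0].
  by rewrite !mulr_ge0// powR_ge0.
have xp : 0 < `|x| by rewrite normr_gt0.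
pose M y := \1_[set (0 : R)] y + `|x| `^ (- t) * sing t (3 * t) (`|x| / 2) y.
have M0 y : 0 <= M y by rewrite addr_ge0 ?mulr_ge0 ?powR_ge0 ?sing_ge0// indicE.
have mM : measurable_fun setT M.
  apply: measurable_funD; first exact: measurable_indic.
  by apply: measurable_funZ; exact: measurable_sing.
have mMs : measurable_fun setT (fun y : R => M (y + - x)).
  exact: (measurableT_comp mM (measurable_addr _)).
have MN y : M (- y) = M y.
  rewrite /M singN; congr (_ + _); rewrite !indicE.
  suff -> : (- y \in [set (0 : R)]) = (y \in [set (0 : R)]) by [].
  apply/idP/idP; rewrite !inE/=; first by move/eqP; rewrite oppr_eq0 => /eqP.
  by move=> ->; rewrite oppr0.
have iM : (\int[mu]_y (M y)%:E <= (K * 2^-1 `^ (1 - t - 3 * t) * `|x| `^ (1 - 5 * t))%:E)%E.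
  rewrite /M; under eq_integral do rewrite EFinD.
  rewrite ge0_integralD//; last 3 first.
  - by apply/measurable_EFinP; exact: measurable_indic.
  - by move=> y _; rewrite lee_fin mulr_ge0 ?powR_ge0 ?sing_ge0.
  - by apply/measurable_EFinP; apply: measurable_funZ; exact: measurable_sing.
  have -> : (\int[mu]_y (\1_[set (0 : R)] y)%:E = 0)%E.
    by rewrite integral_indic// setIT; exact: lebesgue_measure_set1.
  rewrite add0e.
  under eq_integral do rewrite EFinM.
  rewrite ge0_integralZl_EFin ?powR_ge0//; last 2 first.
  - by move=> y _; rewrite lee_fin sing_ge0.
  - by apply/measurable_EFinP; exact: measurable_sing.
  have c0 : 0 < `|x| / 2 by rewrite divr_gt0.
  apply: le_trans (lee_wpmul2l _ (hK _ c0)) _; first by rewrite lee_fin powR_ge0.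
  rewrite -EFinM lee_fin powRM ?invr_ge0//.
  rewrite (_ : 1 - 5 * t = - t + (1 - t - 3 * t)); last by ring.
  by rewrite (powRDp (- t) (1 - t - 3 * t) xp); apply: eq_ler; ring.
apply: (@le_trans _ _ (\int[mu]_y ((M y)%:E + (M (y + - x))%:E))%E).
  apply: ge0_le_integral => //.
  - by move=> y _; rewrite lee_fin spow_ge0.
  - apply/measurable_EFinP; apply: (measurableT_comp (measurable_spow t)).
    apply: measurable_funB => //; apply: measurable_funD; first exact: measurable_funX.
    by apply: measurable_funX; exact: measurable_funB.
  - by apply: emeasurable_funD; apply/measurable_EFinP; [exact: mM|exact: mMs].
  - move=> y _; rewrite -EFinD lee_fin.
    have e : y + (x - y) = x by ring.
    have [h|h] := leP `|y| `|x - y|.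
      apply: (@le_trans _ _ (M y)); last by rewrite lerDl.
      by have := spow_resonance t0 _ h; rewrite e; exact.
    rewrite -[y + - x]opprK MN opprB.
    apply: (@le_trans _ _ (M (x - y))); last by rewrite lerDr.
    have := @spow_resonance t (x - y) y t0; rewrite subrK (ltW h).
    by rewrite [(x - y) ^+ 5 + _]addrC => /(_ x0 isT).
rewrite ge0_integralD//; last 4 first.
- by move=> y _; rewrite lee_fin.
- by apply/measurable_EFinP; exact: mM.
- by move=> y _; rewrite lee_fin.
- by apply/measurable_EFinP; exact: mMs.
rewrite (@ge0_integral_shift _ (- x) (fun y => (M y)%:E)); last 2 first.
- by apply/measurable_EFinP; exact: mM.
- by move=> y; rewrite lee_fin.
apply: le_trans (leeD iM iM) _.
by rewrite -EFinD lee_fin; apply: eq_ler; ring.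
Qed.

End TrilinearBound.

(** * The bilinear weight estimate in frequency space *)

Section MainEstimate.
Context {R : realType}.
Local Notation mu := (@lebesgue_measure R).
Local Notation mu2 := (mu \x mu)%E.

Definition Xweight (s b : R) (z : R * R) : R :=
  bracket z.1 `^ s * bracket (z.2 + z.1 ^+ 5) `^ b.

Lemma Xweight_gt0 s b z : 0 < Xweight s b z.
Proof. by rewrite mulr_gt0// powR_gt0// bracket_gt0. Qed.

Lemma measurable_Xweight s b : measurable_fun setT (Xweight s b).
Proof.
apply: measurable_funM; apply: measurable_fun_powR; apply: measurable_fun_bracket => //.
by apply: measurable_funD => //; exact: measurable_funX.
Qed.

Definition low (x : R) : R := \1_(`[(-1)%R, 1%R]%classic : set R) x.

Lemma low_cases x : (`|x| <= 1 /\ low x = 1) \/ (1 < `|x| /\ low x = 0).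
Proof.
have e : (x \in (`[(-1)%R, 1%R]%classic : set R)) = (`|x| <= 1).
  by apply/idP/idP; rewrite inE/= in_itv/= ler_norml.
by rewrite /low indicE e; have [h|h] := leP `|x| 1; [left|right].
Qed.

(** What remains after the two modulations are integrated out: [x] is the output frequency, [y] and
    [x - y] are the inputs, and [h] is the resonance up to sign. The exponent depends on the output
    frequency only. *)
Definition reskernel (b x y : R) : R :=
  let h := y ^+ 5 + (x - y) ^+ 5 - x ^+ 5 in
  low x * spow (3 / 5) h + (1 - low x) * spow (4 * b - 1) h.

Lemma reskernel_ge0 b x y : 0 <= reskernel b x y.
Proof.
by rewrite /reskernel; case: (low_cases x) => -[_ ->];
  rewrite ?subrr ?subr0 !(mul0r, mul1r, add0r, addr0) spow_ge0.
Qed.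

Lemma measurable_reskernel b : measurable_fun setT
  (fun z : R * R => reskernel b z.1 z.2).
Proof.
have mh : measurable_fun setT (fun z : R * R => z.2 ^+ 5 + (z.1 - z.2) ^+ 5 - z.1 ^+ 5).
  apply: measurable_funB; last exact: measurable_funX.
  apply: measurable_funD; first exact: measurable_funX.
  by apply: measurable_funX; exact: measurable_funB.
have ml : measurable_fun setT (fun z : R * R => low z.1) by exact: measurable_fun_indic_comp.
apply: measurable_funD; apply: measurable_funM => //.
- exact: (measurableT_comp (measurable_spow _) mh).
- exact: measurable_funB.
- exact: (measurableT_comp (measurable_spow _) mh).
Qed.

(** For |x| > 1 the powers of |x| add up to 2 + 2a + 1 - 5(4b - 1) = 2a + 8 - 20b, which is
    nonpositive exactly when a <= 10b - 4. For |x| <= 1 the exponent 3/5 makes x^2 and |x|^{1 - 5 *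
    3/5} cancel, and the bracket is at most 2, whence the factor 2^{2a}. *)
Lemma reskernel_integral (b a : R) : 2 / 5 < b < 1 / 2 -> 0 <= a <= 10 * b - 4 ->
  exists2 C, 0 <= C & forall x,
  (\int[mu]_y (x ^+ 2 * bracket x `^ (2 * a) * reskernel b x y)%:E <= C%:E)%E.
Proof.
move=> /andP[b1 b2] /andP[a0 a1].
have [C1 C10 h1] := @singular_resonance_integral R (3 / 5) (lexx _) ltac:(lra).
have [C2 C20 h2] := @singular_resonance_integral R (4 * b - 1) ltac:(lra) ltac:(lra).
have p0 : 0 <= 2 `^ (2 * a) :> R by exact: powR_ge0.
exists (2 `^ (2 * a) * (C1 + C2)) => [|x]; first by rewrite mulr_ge0// addr_ge0.
have mh : measurable_fun setT (fun y : R => y ^+ 5 + (x - y) ^+ 5 - x ^+ 5).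
  apply: measurable_funB => //; apply: measurable_funD; first exact: measurable_funX.
  by apply: measurable_funX; exact: measurable_funB.
have ms t : measurable_fun setT (fun y : R => (spow t (y ^+ 5 + (x - y) ^+ 5 - x ^+ 5))%:E).
  by apply/measurable_EFinP; exact: (measurableT_comp (measurable_spow _) mh).
have c0 : 0 <= x ^+ 2 * bracket x `^ (2 * a) by rewrite mulr_ge0 ?sqr_ge0 ?powR_ge0.
have [->|x0] := eqVneq x 0.
  under eq_integral do rewrite expr0n/= !mul0r.
  by rewrite integral0 lee_fin mulr_ge0// addr_ge0.
have xp : 0 < `|x| by rewrite normr_gt0.
have x2 : x ^+ 2 = `|x| `^ 2 by rewrite powR_mulrn// real_normK ?num_real.
under eq_integral do rewrite EFinM.
rewrite ge0_integralZl_EFin//; last 2 first.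
- by move=> y _; rewrite lee_fin reskernel_ge0.
- apply/measurable_EFinP; rewrite /reskernel.
  apply: measurable_funD; apply: measurable_funZ;
  exact: (measurableT_comp (measurable_spow _) mh).
rewrite /reskernel; case: (low_cases x) => -[hx ->].
  under eq_integral do rewrite subrr mul0r addr0 mul1r.
  apply: le_trans (lee_wpmul2l _ (h1 _ x0)) _; first by rewrite lee_fin.
  rewrite -EFinM lee_fin.
  rewrite (_ : x ^+ 2 * bracket x `^ (2 * a) * (C1 * `|x| `^ (1 - 5 * (3 / 5))) =
     bracket x `^ (2 * a) * C1 * (`|x| `^ 2 * `|x| `^ (1 - 5 * (3 / 5)))); last first.
    by rewrite x2; ring.
  rewrite -powRDp// (_ : 2 + (1 - 5 * (3 / 5)) = 0); last by field.
  rewrite powRr0 mulr1; apply: ler_pM; rewrite ?powR_ge0//; last by rewrite lerDl.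
  rewrite ge0_ler_powR ?nnegrE ?(ltW (bracket_gt0 _)) ?mulr_ge0//.
  by rewrite /bracket; lra.
under eq_integral do rewrite subr0 mul0r add0r mul1r.
apply: le_trans (lee_wpmul2l _ (h2 _ x0)) _; first by rewrite lee_fin.
rewrite -EFinM lee_fin.
apply: (@le_trans _ _ ((2 `^ (2 * a) * `|x| `^ (2 * a)) * C2 *
   (`|x| `^ 2 * `|x| `^ (1 - 5 * (4 * b - 1))))).
  rewrite (_ : x ^+ 2 * bracket x `^ (2 * a) * (C2 * `|x| `^ (1 - 5 * (4 * b - 1))) =
     bracket x `^ (2 * a) * C2 * (`|x| `^ 2 * `|x| `^ (1 - 5 * (4 * b - 1)))); last first.
    by rewrite x2; ring.
  apply: ler_wpM2r; first by rewrite mulr_ge0 ?powR_ge0.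
  apply: ler_wpM2r => //; rewrite -powRM//.
  rewrite ge0_ler_powR ?nnegrE ?(ltW (bracket_gt0 _)) ?mulr_ge0//.
  by rewrite /bracket; lra.
rewrite -!mulrA; apply: ler_wpM2l => //.
rewrite mulrCA -!powRDp//.
apply: (@le_trans _ _ (C2 * 1)); last by rewrite mulr1 lerDr.
apply: ler_wpM2l => //.
apply: (@le_trans _ _ (`|x| `^ 0)); last by rewrite powRr0.
apply: ler_powR; first exact: ltW.
lra.
Qed.

Lemma tau_integral (b : R) : 2 / 5 < b < 1 / 2 ->
  exists2 C, 0 <= C & forall x y A1 A2 B, A1 + A2 - B = y ^+ 5 + (x - y) ^+ 5 - x ^+ 5 ->
  (\int[mu]_t1 \int[mu]_t2 (bracket (t1 + A1) `^ (- (2 * b)) *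
     bracket (t2 + A2) `^ (- (2 * b)) * bracket (t1 + t2 + B) `^ (- 2))%:E <=
   (C * reskernel b x y)%:E)%E.
Proof.
move=> /andP[b1 b2].
(* The choice q = 4/5 is admissible because 4/5 < 2b and produces the exponent 2q - 1 = 3/5; the
   choice q = 2b below produces 4b - 1. *)
have [C1 C10 h1] := @integral_bracket3 R (4 / 5) (2 * b) ltac:(lra) ltac:(lra) ltac:(lra).
have [C2 C20 h2] := @integral_bracket3 R (2 * b) (2 * b) ltac:(lra) ltac:(lra) ltac:(lra).
exists (C1 + C2) => [|x y A1 A2 B e]; first exact: addr_ge0.
have sg t : 0 <= spow t (y ^+ 5 + (x - y) ^+ 5 - x ^+ 5) by exact: spow_ge0.
rewrite /reskernel; case: (low_cases x) => -[_ ->].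
  apply: le_trans (h1 A1 A2 B) _; rewrite e lee_fin subrr mul0r addr0 mul1r.
  rewrite (_ : 2 * (4 / 5) - 1 = 3 / 5); last by field.
  by rewrite ler_wpM2r// lerDl.
apply: le_trans (h2 A1 A2 B) _; rewrite e lee_fin subr0 mul0r add0r mul1r.
rewrite (_ : 2 * (2 * b) - 1 = 4 * b - 1); last by ring.
by rewrite ler_wpM2r// lerDr.
Qed.

(** As s >= 0, the bracket of the sum raised to 2s is absorbed by the two input brackets. The
    regularity [s] thus disappears, and only the gain [a] has to be paid for by the resonance. *)
Lemma Xweight_product (s b a : R) (v : (R * R) * (R * R)) : 0 <= s ->
  bracket (v.1.1 + v.2.1) `^ (2 * (s + a)) *
    ((Xweight s b v.1 ^+ 2)^-1 * (Xweight s b v.2 ^+ 2)^-1) <=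
  bracket (v.1.1 + v.2.1) `^ (2 * a) *
    (bracket (v.1.2 + v.1.1 ^+ 5) `^ (- (2 * b)) *
     bracket (v.2.2 + v.2.1 ^+ 5) `^ (- (2 * b))).
Proof.
move=> s0; rewrite /Xweight.
have pw (x r : R) : (bracket x `^ r ^+ 2)^-1 = bracket x `^ (- (2 * r)).
  by rewrite powRN -powR_mulrn ?powR_ge0// -powRrM mulrC.
have pw2 (x y : R) : ((bracket x `^ s * bracket y `^ b) ^+ 2)^-1 =
    bracket x `^ (- (2 * s)) * bracket y `^ (- (2 * b)).
  by rewrite exprMn invfM !pw.
rewrite !pw2 mulrDr powRDp ?bracket_gt0//.
have h : bracket (v.1.1 + v.2.1) `^ (2 * s) *
    (bracket v.1.1 `^ (- (2 * s)) * bracket v.2.1 `^ (- (2 * s))) <= 1.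
  rewrite -powRM ?(ltW (bracket_gt0 _))// powRN ler_pdivrMr; last first.
    by rewrite powR_gt0// mulr_gt0 ?bracket_gt0.
  rewrite mul1r ge0_ler_powR ?nnegrE ?mulr_ge0 ?(ltW (bracket_gt0 _))//.
  exact: bracketD.
set A := bracket (v.1.1 + v.2.1) `^ (2 * a).
set B1 := bracket (_ + v.1.1 ^+ 5) `^ _; set B2 := bracket (_ + v.2.1 ^+ 5) `^ _.
rewrite (_ : _ * A * _ = A * (B1 * B2) * (bracket (v.1.1 + v.2.1) `^ (2 * s) *
    (bracket v.1.1 `^ (- (2 * s)) * bracket v.2.1 `^ (- (2 * s))))); last by ring.
by rewrite -[leRHS]mulr1 ler_wpM2l// !mulr_ge0 ?powR_ge0.
Qed.

Section PlanarMeasure.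
Context d {P : measurableType d} (m : {sigma_finite_measure set P -> \bar R}).
Variables (px pt : P -> R).
Hypothesis mpx : measurable_fun setT px.
Hypothesis mpt : measurable_fun setT pt.
(** An abstract copy of the plane: [m] is tied to Lebesgue measure by this Tonelli identity alone.
    It is instantiated with [sigma_prod] of two Lebesgue measures, whose sigma-finiteness makes
    [m \x m] usable. *)
Hypothesis planar : forall F : R * R -> \bar R, measurable_fun setT F ->
  (forall z, 0 <= F z)%E ->
  (\int[m]_z F (px z, pt z) = \int[mu]_x \int[mu]_t F (x, t))%E.

Definition pweight (s b : R) (z : P) : R := Xweight s b (px z, pt z).

Lemma measurable_pweight s b : measurable_fun setT (pweight s b).
Proof.
apply: (measurableT_comp (measurable_Xweight s b)).
by apply/measurable_fun_pairP; split.
Qed.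

(** The dual form of a supremum over the output frequency: a slice where the two frequencies have a
    fixed sum is negligible in the product, so an arbitrary nonnegative function [f] of the sum is
    integrated instead. After the modulations are integrated out and the second frequency is
    replaced by the sum, [reskernel_integral] bounds the coefficient of [f]. *)
Lemma main_estimate (s b a : R) : 0 <= s -> 2 / 5 < b < 1 / 2 -> 0 <= a <= 10 * b - 4 ->
  exists2 C, 0 <= C & forall f : R -> R, measurable_fun setT f -> (forall x, 0 <= f x) ->
  (\int[m \x m]_v (f (px v.1 + px v.2)%R * (px v.1 + px v.2)%R ^+ 2 *
     (bracket (px v.1 + px v.2)%R `^ (2 * (s + a)) *
      ((pweight s b v.1 ^+ 2)^-1 * (pweight s b v.2 ^+ 2)^-1)) *
     bracket (pt v.1 + pt v.2 + (px v.1 + px v.2) ^+ 5)%R `^ (- 2))%:E <=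
   C%:E * \int[mu]_x (f x)%:E)%E.
Proof.
move=> s0 hb ha.
have [C C0 hC] := tau_integral hb.
have [D D0 hD] := reskernel_integral hb ha.
exists (C * D) => [|f mf f0]; first exact: mulr_ge0.
pose N x := f x * (x ^+ 2 * bracket x `^ (2 * a)).
have N0 x : 0 <= N x by rewrite mulr_ge0// mulr_ge0 ?sqr_ge0 ?powR_ge0.
have mN : measurable_fun setT N.
  apply: measurable_funM => //; apply: measurable_funM; first exact: measurable_funX.
  by apply: measurable_fun_powR; exact: measurable_fun_bracket.
pose T (x1 t1 x2 t2 : R) : R := bracket (t1 + x1 ^+ 5) `^ (- (2 * b)) *
     bracket (t2 + x2 ^+ 5) `^ (- (2 * b)) * bracket (t1 + t2 + (x1 + x2) ^+ 5) `^ (- 2).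
have T0 x1 t1 x2 t2 : 0 <= T x1 t1 x2 t2 by rewrite !mulr_ge0 ?powR_ge0.
pose G x1 t1 x2 t2 := N (x1 + x2) * T x1 t1 x2 t2.
have G0 x1 t1 x2 t2 : (0 <= (G x1 t1 x2 t2)%:E)%E by rewrite lee_fin mulr_ge0.
have mG d' (V : measurableType d') (x1 t1 x2 t2 : V -> R) :
    measurable_fun setT x1 -> measurable_fun setT t1 ->
    measurable_fun setT x2 -> measurable_fun setT t2 ->
    measurable_fun setT (fun v => (G (x1 v) (t1 v) (x2 v) (t2 v))%:E).
  move=> m1 m2 m3 m4; apply/measurable_EFinP.
  have mx : measurable_fun setT (fun v => x1 v + x2 v) by exact: (measurable_funD m1 m3).
  apply: measurable_funM; first exact: (measurableT_comp mN mx).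
  apply: measurable_funM.
    apply: measurable_funM; apply: measurable_fun_powR; apply: measurable_fun_bracket.
      exact: (measurable_funD m2 (measurable_funX 5 m1)).
    exact: (measurable_funD m4 (measurable_funX 5 m3)).
  apply: measurable_fun_powR; apply: measurable_fun_bracket.
  exact: (measurable_funD (measurable_funD m2 m4) (measurable_funX 5 mx)).
pose GG (v : P * P) := (G (px v.1) (pt v.1) (px v.2) (pt v.2))%:E.
have mGG : measurable_fun setT GG.
  by apply: mG; [exact: (measurableT_comp mpx measurable_fst)|
    exact: (measurableT_comp mpt measurable_fst)|
    exact: (measurableT_comp mpx measurable_snd)|
    exact: (measurableT_comp mpt measurable_snd)].
apply: (@le_trans _ _ (\int[m \x m]_v GG v)%E).
  apply: ge0_le_integral_nm => v.
    rewrite lee_fin; apply: mulr_ge0; last exact: powR_ge0.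
    apply: mulr_ge0; first by rewrite mulr_ge0// sqr_ge0.
    by rewrite mulr_ge0 ?powR_ge0// mulr_ge0// invr_ge0 sqr_ge0.
  rewrite lee_fin /G /T /N.
  have h := @Xweight_product s b a ((px v.1, pt v.1), (px v.2, pt v.2)) s0.
  rewrite /= in h; set x := px v.1 + px v.2 in h *.
  have fx0 : 0 <= f x * x ^+ 2 by rewrite mulr_ge0// sqr_ge0.
  apply: le_trans (ler_wpM2r (powR_ge0 _ _) (ler_wpM2l fx0 h)) _.
  by apply: eq_ler; ring.
rewrite (fubini_tonelli1 GG)//; last by move=> v; exact: G0.
pose F1 (p : R * R) := (\int[mu]_x2 \int[mu]_t2 (G p.1 p.2 x2 t2)%:E)%E.
have F10 p : (0 <= F1 p)%E.
  by apply: integral_ge0 => x2 _; apply: integral_ge0 => t2 _.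
have mF1 : measurable_fun setT F1.
  apply: (@measurable_fun_fubini_tonelli_F _ _ _ _ _ mu
    (fun z : (R * R) * R => \int[mu]_t2 (G z.1.1 z.1.2 z.2 t2)%:E)%E); last first.
    by move=> z; apply: integral_ge0.
  apply: (@measurable_fun_fubini_tonelli_F _ _ _ _ _ mu
    (fun z : ((R * R) * R) * R => (G z.1.1.1 z.1.1.2 z.1.2 z.2)%:E)) => //.
  apply: mG.
  - exact: (measurableT_comp measurable_fst (measurableT_comp measurable_fst measurable_fst)).
  - exact: (measurableT_comp measurable_snd (measurableT_comp measurable_fst measurable_fst)).
  - exact: (measurableT_comp measurable_snd measurable_fst).
  - exact: measurable_snd.
rewrite (_ : \int[m]_x _ = \int[m]_z F1 (px z, pt z))%E; last first.
  apply: eq_integral => z _; rewrite /fubini_F /GG/=.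
  rewrite (planar (F := fun p => (G (px z) (pt z) p.1 p.2)%:E))//.
  by apply: mG => //; exact: measurable_cst.
rewrite planar// /F1/=.
(* For a fixed first frequency, [t1] and [x2] are exchanged so that both modulations become the
   inner variables and [tau_integral] applies for each pair of frequencies. *)
have step2 (x1 : R) : (\int[mu]_t1 \int[mu]_x2 \int[mu]_t2 (G x1 t1 x2 t2)%:E <=
    \int[mu]_x2 (C * (N (x2 + x1)%R * reskernel b (x2 + x1)%R x1))%:E)%E.
  rewrite (@fubini_tonelli _ _ _ _ _ mu mu
    (fun z => \int[mu]_t2 (G x1 z.1 z.2 t2)%:E)%E); last 2 first.
  - apply: (@measurable_fun_fubini_tonelli_F _ _ _ _ _ mu
      (fun z : (R * R) * R => (G x1 z.1.1 z.1.2 z.2)%:E)) => //.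
    apply: mG; [exact: measurable_cst| | |exact: measurable_snd].
      exact: (measurableT_comp measurable_fst measurable_fst).
    exact: (measurableT_comp measurable_snd measurable_fst).
  - by move=> z; apply: integral_ge0.
  apply: ge0_le_integral_nm => x2.
    by apply: integral_ge0 => t1 _; apply: integral_ge0 => t2 _.
  rewrite /G/= [(x2 + x1)%R]addrC.
  have mT d' (V : measurableType d') (t1 t2 : V -> R) : measurable_fun setT t1 ->
      measurable_fun setT t2 -> measurable_fun setT (fun v => (T x1 (t1 v) x2 (t2 v))%:E).
    move=> m1 m2; apply/measurable_EFinP; apply: measurable_funM.
      apply: measurable_funM; apply: measurable_fun_powR; apply: measurable_fun_bracket.
        exact: (measurable_funD m1 (measurable_cst _)).
      exact: (measurable_funD m2 (measurable_cst _)).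
    apply: measurable_fun_powR; apply: measurable_fun_bracket.
    exact: (measurable_funD (measurable_funD m1 m2) (measurable_cst _)).
  under eq_integral => t1 _.
    under eq_integral => t2 _ do rewrite EFinM.
    rewrite ge0_integralZl_EFin//; last 2 first.
    + by move=> t2 _; rewrite lee_fin.
    + by apply: mT => //; exact: measurable_cst.
    over.
  rewrite ge0_integralZl_EFin//; last 2 first.
  + by move=> t1 _; apply: integral_ge0 => t2 _; rewrite lee_fin.
  + apply: (@measurable_fun_fubini_tonelli_F _ _ _ _ _ mu
      (fun z : R * R => (T x1 z.1 x2 z.2)%:E)).
      by apply: mT; [exact: measurable_fst|exact: measurable_snd].
    by move=> z; rewrite lee_fin.
  apply: le_trans (lee_wpmul2l _ (hC (x1 + x2) x1 _ _ _ _)) _.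
  + by rewrite lee_fin.
  + by rewrite [_ + _ - x1]addrAC subrr add0r.
  + by rewrite -EFinM lee_fin mulrCA.
have mK : measurable_fun setT (fun z : R * R => (C * (N z.1 * reskernel b z.1 z.2))%:E).
  apply/measurable_EFinP; apply: measurable_funZ.
  apply: measurable_funM; last exact: measurable_reskernel.
  exact: (measurableT_comp mN measurable_fst).
have K0 x y : (0 <= (C * (N x * reskernel b x y))%:E)%E.
  by rewrite lee_fin mulr_ge0// mulr_ge0// reskernel_ge0.
apply: (@le_trans _ _ (\int[mu]_x1 \int[mu]_x (C * (N x * reskernel b x x1))%:E)%E).
  apply: ge0_le_integral_nm => x1; first by apply: integral_ge0 => t1 _; exact: (F10 (x1, t1)).
  apply: le_trans (step2 x1) _.
  rewrite le_eqVlt; apply/orP; left; apply/eqP.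
  exact: (@ge0_integral_shift R x1 (fun x => (C * (N x * reskernel b x x1))%:E)
    (measurableT_comp mK (measurable_pair2 x1)) (fun x => K0 x x1)).
rewrite -(@fubini_tonelli _ _ _ _ _ mu mu (fun z => (C * (N z.1 * reskernel b z.1 z.2))%:E))//.
rewrite -ge0_integralZl_EFin//; last 3 first.
- by move=> x _; rewrite lee_fin.
- exact/measurable_EFinP.
- exact: mulr_ge0.
apply: ge0_le_integral_nm => x; first by apply: integral_ge0 => y _; exact: K0.
have e y : C * (N x * reskernel b x y) =
   (C * f x) * (x ^+ 2 * bracket x `^ (2 * a) * reskernel b x y).
  by rewrite /N; ring.
under eq_integral do rewrite e EFinM.
rewrite ge0_integralZl_EFin ?mulr_ge0//; last 2 first.
+ by move=> y _; rewrite lee_fin mulr_ge0 ?reskernel_ge0// mulr_ge0 ?sqr_ge0 ?powR_ge0.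
+ apply/measurable_EFinP; apply: measurable_funZ.
  exact: (measurableT_comp (measurable_reskernel b) (measurable_pair1 x)).
apply: le_trans (lee_wpmul2l _ (hD x)) _; first by rewrite lee_fin mulr_ge0.
by rewrite -!EFinM lee_fin mulrAC.
Qed.

End PlanarMeasure.

End MainEstimate.

(** * Plancherel and Gaussian regularization *)

(* The library's canonical sigma-finite structure on [m1 \x m2] only applies to
   subprobabilities. *)
Section SigmaProduct.
Context d1 d2 {T1 : measurableType d1} {T2 : measurableType d2} {R : realType}.
Variables (m1 : {sigma_finite_measure set T1 -> \bar R})
          (m2 : {sigma_finite_measure set T2 -> \bar R}).

Definition sigma_prod : set (T1 * T2) -> \bar R := (m1 \x m2)%E.

HB.instance Definition _ := Measure.on sigma_prod.

Let sigma_finite_prod : sigma_finite setT sigma_prod.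
Proof.
have [F TF Ffin] := sigma_finiteT m1; have [G TG Gfin] := sigma_finiteT m2.
pose p (n : nat) : nat * nat := odflt (0, 0)%N (unpickle n).
exists (fun n => F (p n).1 `*` G (p n).2).
  apply/seteqP; split => // -[x y] _.
  have [i _ Fi] : (\bigcup_i F i) x by rewrite -TF.
  have [j _ Gj] : (\bigcup_i G i) y by rewrite -TG.
  by exists (pickle (i, j)) => //; rewrite /p pickleK.
move=> k; have [mF Foo] := Ffin (p k).1; have [mG Goo] := Gfin (p k).2.
split; first exact: measurableX.
by rewrite /sigma_prod product_measure1E// lte_mul_pinfty// ge0_fin_numE.
Qed.

HB.instance Definition _ :=
  Measure_isSigmaFinite.Build _ _ _ sigma_prod sigma_finite_prod.

End SigmaProduct.

(** A bounded kernel between two integrable functions makes the triple product integrable on the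
    product space, so Fubini applies. The exchanges of integrals against characters below take this
    form. *)
Lemma cintegral_swapM d1 d2 {Y : measurableType d1} {V : measurableType d2} {R : realType}
    (N : {sigma_finite_measure set Y -> \bar R}) (M : {sigma_finite_measure set V -> \bar R})
    (G : Y -> R[i]) (rho : V -> R[i]) (k : Y * V -> R[i]) (B : R) :
  cintegrable N G -> cintegrable M rho -> cmeasurable k -> (forall z, normc (k z) <= B) ->
  cintegral N setT (fun y => G y * cintegral M setT (fun v => k (y, v) * rho v)) =
  cintegral M setT (fun v => rho v * cintegral N setT (fun y => k (y, v) * G y)).
Proof.
move=> iG irho mk kB.
have fi := cintegrableM (cintegrable_prodM iG irho) mk kB.
have mk1 y : cmeasurable (fun v => k (y, v)).
  by split; [exact: (measurableT_comp mk.1 (measurable_pair1 y))|exact: (measurableT_comp mk.2 (measurable_pair1 y))].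
have mk2 v : cmeasurable (fun y => k (y, v)).
  by split; [exact: (measurableT_comp mk.1 (measurable_pair2 v))|exact: (measurableT_comp mk.2 (measurable_pair2 v))].
have := cintegral_swap fi.
rewrite (_ : (fun y => cintegral M setT _) = (fun y => G y * cintegral M setT (fun v => k (y, v) * rho v))); last first.
  apply/funext => y /=; rewrite -cintegralZ; last exact: (cintegrableM irho (mk1 y) (fun v => kB (y, v))).
  by congr cintegral; apply/funext => v; rewrite mulrCA.
rewrite (_ : (fun v => cintegral N setT _) = (fun v => rho v * cintegral N setT (fun y => k (y, v) * G y)))//.
apply/funext => v /=; rewrite -cintegralZ; last exact: (cintegrableM iG (mk2 v) (fun y => kB (y, v))).
by congr cintegral; apply/funext => y; rewrite [rho v * _]mulrC mulrA.
Qed.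

Section CharacterIntegrals.
Context d {V : measurableType d} {R : realType} (M : {sigma_finite_measure set V -> \bar R}).
Local Notation mu := (@lebesgue_measure R).
Local Notation mu2 := (mu \x mu)%E.
Variables (rho : V -> R[i]) (a c : V -> R).
Hypothesis irho : cintegrable M rho.
Hypothesis ma : measurable_fun setT a.
Hypothesis mc : measurable_fun setT c.

(** A Fourier integral whose frequencies are read off a point of [V] by [a] and [c]. Taking for [V]
    pairs of frequencies, with [a] and [c] the sums or the differences of coordinates, represents a
    product of transforms or a squared modulus without forming a convolution. *)
Definition charint (y : R * R) : R[i] :=
  cintegral M setT (fun v => cis (y.1 * a v + y.2 * c v) * rho v).

Lemma cmeasurable_charint_integrand :
  cmeasurable (fun z : (R * R) * V => cis (z.1.1 * a z.2 + z.1.2 * c z.2) * rho z.2).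
Proof.
have [mr mi] := cintegrable_measurable irho.
have m1 : measurable_fun setT (fun z : (R * R) * V => z.1.1).
  exact: (measurableT_comp measurable_fst measurable_fst).
have m2 : measurable_fun setT (fun z : (R * R) * V => z.1.2).
  exact: (measurableT_comp measurable_snd measurable_fst).
apply: cmeasurableM.
  apply: cmeasurable_cis.
  exact: (measurable_funD (measurable_funM m1 (measurableT_comp ma measurable_snd))
    (measurable_funM m2 (measurableT_comp mc measurable_snd))).
by split; [exact: (measurableT_comp mr measurable_snd)|exact: (measurableT_comp mi measurable_snd)].
Qed.

Lemma cmeasurable_charint : cmeasurable charint.
Proof. exact: (cmeasurable_cintegral2 M cmeasurable_charint_integrand). Qed.

Lemma integral_gauss_charint (s1 s2 : R) : s1 != 0 -> s2 != 0 ->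
  cintegral mu2 setT (fun y => (gaus s1 y.1 * gaus s2 y.2)%:C * charint y) =
  cintegral M setT (fun v => ((normal_peak s1^-1)^-1 * gaus s1^-1 (a v) *
    ((normal_peak s2^-1)^-1 * gaus s2^-1 (c v)))%:C * rho v).
Proof.
move=> s10 s20.
have iG : cintegrable mu2 (fun y : R * R => (gaus s1 y.1 * gaus s2 y.2)%:C).
  by apply: cintegrable_real; exact: (integrable_prodM (integrable_gaus s10) (integrable_gaus s20)).
have mph : measurable_fun setT (fun z : (R * R) * V => z.1.1 * a z.2 + z.1.2 * c z.2).
  have m1 : measurable_fun setT (fun z : (R * R) * V => z.1.1).
    exact: (measurableT_comp measurable_fst measurable_fst).
  have m2 : measurable_fun setT (fun z : (R * R) * V => z.1.2).
    exact: (measurableT_comp measurable_snd measurable_fst).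
  exact: (measurable_funD (measurable_funM m1 (measurableT_comp ma measurable_snd))
    (measurable_funM m2 (measurableT_comp mc measurable_snd))).
rewrite (@cintegral_swapM _ _ _ V R (sigma_prod mu mu) M _ rho
  (fun z => cis (z.1.1 * a z.2 + z.1.2 * c z.2)) 1 iG irho (cmeasurable_cis mph) (fun z => eq_ler (normc_cis _))).
congr cintegral; apply/funext => v; rewrite mulrC; congr (_ * _).
rewrite (_ : (fun y => _) = (fun y : R * R =>
   (cis (a v * y.1) * (gaus s1 y.1)%:C) * (cis (c v * y.2) * (gaus s2 y.2)%:C))); last first.
  apply/funext => y /=; rewrite rmorphM cisD [y.1 * a v]mulrC [y.2 * c v]mulrC.
  by rewrite -!mulrA; congr (_ * _); rewrite mulrCA.
rewrite (cintegral_prodM (integrable_cis_gaus (a v) s10) (integrable_cis_gaus (c v) s20)).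
by rewrite !integral_cis_gaus// -rmorphM.
Qed.

End CharacterIntegrals.

Lemma cvg_gaus1 {R : realType} (x : R) : (fun n : nat => gaus (n.+1%:R^-1) x) @ \oo --> (1 : R).
Proof.
have e0 : 0 = - ((0 * 0) * x ^+ 2 / 2) :> R by rewrite !mul0r oppr0.
have h : (fun n : nat => - (n.+1%:R^-1 ^+ 2 * x ^+ 2 / 2)) @ \oo --> (0 : R).
  rewrite e0; apply: cvgN; apply: cvgM; last exact: cvg_cst.
  by apply: cvgM; [apply: cvgM; exact: cvg_harmonic|exact: cvg_cst].
by have := cvg_comp _ expR h (@continuous_expR R 0); rewrite expR0; apply.
Qed.

(** * Plancherel's inequality *)

Section Plancherel.
Context d {P : measurableType d} {R : realType} (m : {sigma_finite_measure set P -> \bar R}).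
Local Notation mu := (@lebesgue_measure R).
Local Notation mu2 := (mu \x mu)%E.
Variables (px pt : P -> R).
Hypothesis mpx : measurable_fun setT px.
Hypothesis mpt : measurable_fun setT pt.
Hypothesis planar : forall F : R * R -> \bar R, measurable_fun setT F ->
  (forall z, 0 <= F z)%E ->
  (\int[m]_z F (px z, pt z) = \int[mu]_x \int[mu]_t F (x, t))%E.

Lemma normal_pdfC (x y s : R) : s != 0 -> normal_pdf x s y = normal_pdf y s x.
Proof. by move=> s0; rewrite !normal_pdf_gaus// /gaus -[y - x]opprB sqrrN. Qed.

Lemma planar_gauss (s x t : R) :
  (\int[m]_z (normal_pdf x s (px z) * normal_pdf t s (pt z))%:E = 1)%E.
Proof.
rewrite (planar (F := fun p => (normal_pdf x s p.1 * normal_pdf t s p.2)%:E)); last 2 first.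
- apply/measurable_EFinP; apply: measurable_funM.
    exact: (measurableT_comp (measurable_normal_pdf x s) measurable_fst).
  exact: (measurableT_comp (measurable_normal_pdf t s) measurable_snd).
- by move=> z; rewrite lee_fin mulr_ge0// normal_pdf_ge0.
rewrite /=; under eq_integral => p _.
  under eq_integral => q _ do rewrite EFinM.
  rewrite ge0_integralZl_EFin ?normal_pdf_ge0//; last 2 first.
  - by move=> q _; rewrite lee_fin normal_pdf_ge0.
  - by apply/measurable_EFinP; exact: measurable_normal_pdf.
  rewrite integral_normal_pdf mule1.
  over.
exact: integral_normal_pdf.
Qed.

Definition gauss_kernel (s : R) (z z' : P) : R :=
  normal_pdf (px z) s (px z') * normal_pdf (pt z) s (pt z').

Lemma gauss_kernel_ge0 s z z' : 0 <= gauss_kernel s z z'.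
Proof. by rewrite mulr_ge0// normal_pdf_ge0. Qed.

Lemma gauss_kernelC s z z' : s != 0 -> gauss_kernel s z z' = gauss_kernel s z' z.
Proof. by move=> s0; rewrite /gauss_kernel (normal_pdfC _ _ s0) [X in _ * X](normal_pdfC _ _ s0). Qed.

Lemma measurable_gauss_kernel s : s != 0 ->
  measurable_fun setT (fun w : P * P => gauss_kernel s w.1 w.2).
Proof.
move=> s0; rewrite /gauss_kernel; under eq_fun do rewrite !normal_pdf_gaus//.
have mg1 (p : P -> R) : measurable_fun setT p -> measurable_fun setT
    (fun w : P * P => normal_peak s * gaus s^-1 (p w.2 - p w.1)).
  move=> mp; apply: measurable_funZ; apply: (measurableT_comp (measurable_gaus _)).
  exact: (measurable_funB (measurableT_comp mp measurable_snd) (measurableT_comp mp measurable_fst)).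
exact: (measurable_funM (mg1 _ mpx) (mg1 _ mpt)).
Qed.

(* Schur's test: the kernel has total mass 1 in each variable. *)
Lemma gauss_kernel_schur (s : R) (h : P -> R) : s != 0 -> measurable_fun setT h ->
  (forall z, 0 <= h z) ->
  (\int[m \x m]_w (gauss_kernel s w.1 w.2 * (h w.1 * h w.2))%:E <=
   \int[m]_z (h z ^+ 2)%:E)%E.
Proof.
move=> s0 mh h0.
pose H (w : P * P) := ((h w.1 ^+ 2 / 2)%:E * (gauss_kernel s w.1 w.2)%:E)%E.
pose H' (w : P * P) := ((h w.2 ^+ 2 / 2)%:E * (gauss_kernel s w.2 w.1)%:E)%E.
have hh0 z : 0 <= h z ^+ 2 / 2 by rewrite divr_ge0// sqr_ge0.
have H0 w : (0 <= H w)%E by rewrite mule_ge0// lee_fin ?gauss_kernel_ge0.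
have H'0 w : (0 <= H' w)%E by rewrite mule_ge0// lee_fin ?gauss_kernel_ge0.
have mh2 : measurable_fun setT (fun z => h z ^+ 2 / 2).
  by under eq_fun do rewrite mulrC; apply: measurable_funZ; exact: measurable_funX.
have mh1w : measurable_fun setT (fun w : P * P => h w.1 ^+ 2 / 2) by exact: (measurableT_comp mh2 measurable_fst).
have mh2w : measurable_fun setT (fun w : P * P => h w.2 ^+ 2 / 2) by exact: (measurableT_comp mh2 measurable_snd).
have mK := measurable_gauss_kernel s0.
have mH : measurable_fun setT H.
  by rewrite /H; under eq_fun do rewrite -EFinM; apply/measurable_EFinP; exact: measurable_funM.
have mH' : measurable_fun setT H'.
  rewrite /H'; under eq_fun do rewrite -EFinM gauss_kernelC//.
  by apply/measurable_EFinP; exact: measurable_funM.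
have mKz z : measurable_fun setT (fun z' => (gauss_kernel s z z')%:E).
  by apply/measurable_EFinP; exact: (measurableT_comp mK (measurable_pair1 z)).
have mhe : measurable_fun setT (fun z => (h z ^+ 2 / 2)%:E) by exact/measurable_EFinP.
have e1 : (\int[m \x m]_w H w = \int[m]_z (h z ^+ 2 / 2)%:E)%E.
  rewrite (fubini_tonelli1 _ mH)//; apply: eq_integral => z _.
  by rewrite /fubini_F/H/= ge0_integralZl ?lee_fin// ?planar_gauss ?mule1// => z' _; rewrite lee_fin gauss_kernel_ge0.
have e2 : (\int[m \x m]_w H' w = \int[m]_z (h z ^+ 2 / 2)%:E)%E.
  rewrite (fubini_tonelli2 _ mH')//; apply: eq_integral => z _.
  by rewrite /fubini_G/H'/= ge0_integralZl ?lee_fin// ?planar_gauss ?mule1// => z' _; rewrite lee_fin gauss_kernel_ge0.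
apply: (@le_trans _ _ (\int[m \x m]_w (H w + H' w))%E).
  apply: ge0_le_integral_nm => w; first by rewrite lee_fin mulr_ge0 ?gauss_kernel_ge0// mulr_ge0.
  rewrite /H /H' -!EFinM -EFinD lee_fin (gauss_kernelC w.2)// -mulrDl mulrC ler_wpM2r ?gauss_kernel_ge0//.
  have : 0 <= (h w.1 - h w.2) ^+ 2 by exact: sqr_ge0.
  by nra.
rewrite ge0_integralD// e1 e2 -ge0_integralD//; [|by move=> z _; rewrite lee_fin..].
rewrite le_eqVlt; apply/orP; left; apply/eqP; apply: eq_integral => z _; by rewrite -EFinD -splitr.
Qed.

(** The squared modulus of the transform is a [charint] of g(z) conj g(z') in the differences of
    frequencies. Integrating it against a Gaussian turns the characters into [gauss_kernel], and
    Schur's test gives a bound independent of the width; Fatou removes the Gaussian. For the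
    inequality no convergence of the Gaussian means is involved. *)
Lemma plancherel_le (g : P -> R[i]) : cintegrable m g ->
  (\int[mu2]_y (normc (charint m g px pt y) ^+ 2)%:E <=
   ((2 * pi) ^+ 2)%:E * \int[m]_z (normc (g z) ^+ 2)%:E)%E.
Proof.
move=> ig; set v := charint m g px pt.
pose a (w : P * P) := px w.1 - px w.2.
pose c (w : P * P) := pt w.1 - pt w.2.
have ma : measurable_fun setT a.
  exact: (measurable_funB (measurableT_comp mpx measurable_fst) (measurableT_comp mpx measurable_snd)).
have mc : measurable_fun setT c.
  exact: (measurable_funB (measurableT_comp mpt measurable_fst) (measurableT_comp mpt measurable_snd)).
pose rho (w : P * P) : R[i] := g w.1 * conjc (g w.2).
have [mgr mgi] := cintegrable_measurable ig.
have igc : cintegrable m (fun z => conjc (g z)).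
  apply: le_cintegrable (cintegrable_norm ig) _; last by move=> z; rewrite normc_conj.
  by apply: cmeasurable_conj; exact: (cintegrable_measurable ig).
have irho : cintegrable (m \x m)%E rho by exact: (cintegrable_prodM ig igc).
have mn : measurable_fun setT (fun z => normc (g z)).
  by apply: measurable_normc; exact: (cintegrable_measurable ig).
have mv : cmeasurable v by apply: cmeasurable_charint.
have mnv : measurable_fun setT (fun y => normc (v y) ^+ 2).
  exact/measurable_funX/measurable_normc.
have icis (y : R * R) : cintegrable m (fun z => cis (y.1 * px z + y.2 * pt z) * g z).
  apply: (@cintegrableM _ _ _ _ _ _ 1) => //.
    by apply: cmeasurable_cis; apply: measurable_funD; exact: measurable_funZ.
  by move=> z; rewrite normc_cis.
have vv (y : R * R) : (normc (v y) ^+ 2)%:C = charint (sigma_prod m m) rho a c y.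
  rewrite -mulc_conj.
  have -> : conjc (v y) = cintegral m setT (fun z => conjc (cis (y.1 * px z + y.2 * pt z) * g z)).
    apply: complex_eq; rewrite /v /charint /=.
    - by apply: eq_Rintegral => z _; case: (cis _ * g z).
    - rewrite -mulN1r -RintegralZl//; last by have [] := icis y.
      by apply: eq_Rintegral => z _; rewrite mulN1r; case: (cis _ * g z).
  rewrite /v /charint -cintegral_prodM//; last first.
    apply: le_cintegrable (cintegrable_norm (icis y)) _; last by move=> z; rewrite normc_conj.
    by apply: cmeasurable_conj; exact: (cintegrable_measurable (icis y)).
  congr cintegral; apply/funext => w; rewrite /rho /a /c.
  have -> : y.1 * (px w.1 - px w.2) + y.2 * (pt w.1 - pt w.2) =
    (y.1 * px w.1 + y.2 * pt w.1) + - (y.1 * px w.2 + y.2 * pt w.2) by ring.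
  rewrite rmorphM; move: (y.1 * px w.1 + _) (y.1 * px w.2 + _) => p q.
  by rewrite cisD cisN; ring.
have vb : exists B, forall y, normc (v y) <= B.
  exists (Rintegral m setT (fun z => normc (g z))) => y.
  apply: normc_cintegral_le.
  - exact: cintegrable_measurable.
  - exact: cintegrable_norm.
  - by move=> z; rewrite ComplexField.Normc.normcM normc_cis mul1r.
have [B vB] := vb.
have B0 : 0 <= B by apply: le_trans (vB 0); exact: normc_ge0.
have key s : 0 < s -> (\int[mu2]_y (gaus s y.1 * gaus s y.2 * normc (v y) ^+ 2)%:E <=
   ((2 * pi) ^+ 2)%:E * \int[m]_z (normc (g z) ^+ 2)%:E)%E.
  move=> s0; have sn0 : s != 0 by rewrite gt_eqF.
  have iG : mu2.-integrable setT (EFin \o (fun y => gaus s y.1 * gaus s y.2)).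
    exact: (integrable_prodM (integrable_gaus sn0) (integrable_gaus sn0)).
  have iGv : mu2.-integrable setT (EFin \o (fun y => gaus s y.1 * gaus s y.2 * normc (v y) ^+ 2)).
    apply: le_integrableR (integrableZR (B ^+ 2) iG) _.
      exact: (measurable_funM (integrable_measurable iG) mnv).
    move=> y; rewrite ger0_norm; last by apply: mulr_ge0; [apply: mulr_ge0; exact: gaus_ge0|exact: sqr_ge0].
    rewrite [leRHS]mulrC; apply: ler_wpM2l; first by apply: mulr_ge0; exact: gaus_ge0.
    by rewrite lerXn2r ?nnegrE ?normc_ge0.
  rewrite (Rintegral_fin iGv).
  pose K := gauss_kernel s.
  have K0 z z' : 0 <= K z z' by exact: gauss_kernel_ge0.
  have e1 : (Rintegral mu2 setT (fun y => gaus s y.1 * gaus s y.2 * normc (v y) ^+ 2))%:C =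
      cintegral (m \x m)%E setT (fun w => ((2 * pi) ^+ 2 * K w.1 w.2)%:C * rho w).
    rewrite -cintegral_real.
    transitivity (cintegral mu2 setT (fun y => (gaus s y.1 * gaus s y.2)%:C * charint (sigma_prod m m) rho a c y)).
      by congr cintegral; apply/funext => y; rewrite -vv -rmorphM.
    rewrite integral_gauss_charint//; congr cintegral; apply/funext => w.
    congr (_%:C * _); rewrite /K /gauss_kernel !normal_pdf_gaus// !normal_peakVM//.
    have e (p q : R) : gaus s^-1 (p - q) = gaus s^-1 (q - p).
      by rewrite /gaus -[p - q]opprB sqrrN.
    by rewrite /a /c [gaus _ (px _ - _)]e [gaus _ (pt _ - _)]e; ring.
  have mK : measurable_fun setT (fun w : P * P => K w.1 w.2) by exact: measurable_gauss_kernel.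
  have mn1 : measurable_fun setT (fun w : P * P => normc (g w.1)) by exact: (measurableT_comp mn measurable_fst).
  have mn2 : measurable_fun setT (fun w : P * P => normc (g w.2)) by exact: (measurableT_comp mn measurable_snd).
  pose c0 : R := (2 * pi) ^+ 2.
  have c00 : 0 <= c0 by exact: sqr_ge0.
  have Kb w : K w.1 w.2 <= normal_peak s ^+ 2.
    by rewrite /K /gauss_kernel expr2 ler_pM ?normal_pdf_ge0 ?normal_pdf_ub.
  have iN : cintegrable (m \x m)%E (fun w => (c0 * K w.1 w.2)%:C * rho w).
    apply: (@cintegrableM _ _ _ _ _ _ (c0 * normal_peak s ^+ 2)) => //.
      by apply: cmeasurable_real; exact: measurable_funZ.
    move=> w; rewrite normc_real ger0_norm; last exact: (mulr_ge0 c00 (K0 _ _)).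
    exact: (ler_wpM2l c00 (Kb w)).
  have le1 : Rintegral mu2 setT (fun y => gaus s y.1 * gaus s y.2 * normc (v y) ^+ 2) <=
      Rintegral (m \x m)%E setT (fun w => normc ((c0 * K w.1 w.2)%:C * rho w)).
    apply: le_trans (normc_cintegral iN); rewrite -e1 normc_real ler_norm//.
  apply: (@le_trans _ _ (Rintegral (m \x m)%E setT (fun w => normc ((c0 * K w.1 w.2)%:C * rho w)))%:E).
    by rewrite lee_fin.
  rewrite -(Rintegral_fin (cintegrable_norm iN)).
  have e2 w : normc ((c0 * K w.1 w.2)%:C * rho w) = c0 * (K w.1 w.2 * (normc (g w.1) * normc (g w.2))).
    rewrite ComplexField.Normc.normcM normc_real ger0_norm; last exact: (mulr_ge0 c00 (K0 _ _)).
    by rewrite [normc (rho w)]ComplexField.Normc.normcM normc_conj -mulrA.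
  under eq_integral do rewrite e2 EFinM.
  rewrite ge0_integralZl//; last 2 first.
  - by apply/measurable_EFinP; apply: measurable_funM => //; exact: measurable_funM.
  - by move=> w _; rewrite lee_fin mulr_ge0// mulr_ge0 ?normc_ge0.
  rewrite lee_wpmul2l// gauss_kernel_schur// => z; exact: normc_ge0.
apply: (@fatou_bound _ _ _ mu2 (fun n y => gaus n.+1%:R^-1 y.1 * gaus n.+1%:R^-1 y.2 * normc (v y) ^+ 2)) => //.
- move=> n; apply: measurable_funM => //; apply: measurable_funM.
    exact: (measurableT_comp (measurable_gaus _) measurable_fst).
  exact: (measurableT_comp (measurable_gaus _) measurable_snd).
- by move=> n y; apply: mulr_ge0; [apply: mulr_ge0; exact: gaus_ge0|exact: sqr_ge0].
- apply: aeW => y; have e : normc (v y) ^+ 2 = 1 * 1 * normc (v y) ^+ 2 by rewrite !mul1r.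
  rewrite [X in _ --> X]e; apply: cvgM; last exact: cvg_cst.
  by apply: cvgM; exact: cvg_gaus1.
- by apply: nearW => n; apply: key.
Qed.

End Plancherel.

Section SectionwiseFatou.
Context d1 d2 {T1 : measurableType d1} {T2 : measurableType d2} {R : realType}.
Variables (m1 : {sigma_finite_measure set T1 -> \bar R})
          (m2 : {sigma_finite_measure set T2 -> \bar R}).
Variables (f_ : nat -> T1 * T2 -> R) (f : T1 * T2 -> R) (B : \bar R).
Hypothesis mf_ : forall n, measurable_fun setT (f_ n).
Hypothesis mf : measurable_fun setT f.
Hypothesis f0_ : forall n z, 0 <= f_ n z.
Hypothesis f0 : forall z, 0 <= f z.
Hypothesis leB : (\forall n \near \oo, \int[m1 \x m2]_z (f_ n z)%:E <= B)%E.

Let mEf : measurable_fun setT (EFin \o f). Proof. exact/measurable_EFinP. Qed.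
Let mlf := measurable_liminfR mf_.

(** Convergence is known almost everywhere on each section, which does not at once give it almost
    everywhere on the product, as the exceptional set would have to be measurable. Tonelli moves the
    comparison with the lower limit to the sections. *)
Lemma fatou_section1 :
  (forall x, {ae m2, forall y, (fun n => f_ n (x, y)) @ \oo --> f (x, y)}) ->
  (\int[m1 \x m2]_z (f z)%:E <= B)%E.
Proof.
move=> cf; apply: le_trans (integral_liminfR mf_ f0_ leB).
rewrite (fubini_tonelli1 (EFin \o f) mEf)/=; last by move=> z; rewrite lee_fin.
rewrite (fubini_tonelli1 _ mlf)/=; last by move=> z; exact: liminfR_ge0.
rewrite le_eqVlt; apply/orP; left; apply/eqP; apply: eq_integral => x _.
rewrite /fubini_F/=; apply: (integral_ae_liminfR (f_ := fun n y => f_ n (x, y))).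
- by move=> n; exact: (measurableT_comp (mf_ n) (measurable_pair1 x)).
- exact: (measurableT_comp mf (measurable_pair1 x)).
- exact: cf.
Qed.

Lemma fatou_section2 :
  (forall y, {ae m1, forall x, (fun n => f_ n (x, y)) @ \oo --> f (x, y)}) ->
  (\int[m1 \x m2]_z (f z)%:E <= B)%E.
Proof.
move=> cf; apply: le_trans (integral_liminfR mf_ f0_ leB).
rewrite (fubini_tonelli2 (EFin \o f) mEf)/=; last by move=> z; rewrite lee_fin.
rewrite (fubini_tonelli2 _ mlf)/=; last by move=> z; exact: liminfR_ge0.
rewrite le_eqVlt; apply/orP; left; apply/eqP; apply: eq_integral => y _.
rewrite /fubini_G/=; apply: (integral_ae_liminfR (f_ := fun n x => f_ n (x, y))).
- by move=> n; exact: (measurableT_comp (mf_ n) (measurable_pair2 y)).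
- exact: (measurableT_comp mf (measurable_pair2 y)).
- exact: cf.
Qed.

End SectionwiseFatou.

Section GaussianRegularization.
Context {R : realType}.
Local Notation mu := (@lebesgue_measure R).
Local Notation mu2 := (mu \x mu)%E.

Definition epsn (n : nat) : R := n.+1%:R^-1.

Lemma epsn_gt0 n : 0 < epsn n. Proof. by rewrite invr_gt0. Qed.
Lemma epsn_neq0 n : epsn n != 0. Proof. by rewrite gt_eqF ?epsn_gt0. Qed.

(** The identity 2 (y - x)^2 + 2 x^2 - y^2 = (y - 2x)^2 lets a wider centred Gaussian dominate a
    shifted one. Integrability against centred Gaussians then covers all translates. *)
Lemma normal_pdf_le_gaus (x s : R) : s != 0 ->
  exists2 C, 0 <= C & forall y, normal_pdf x s y <= C * gaus (s^-1 / 2) y.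
Proof.
move=> s0; exists (normal_peak s * expR ((s^-1) ^+ 2 * x ^+ 2 / 2)).
  by rewrite mulr_ge0 ?normal_peak_ge0// expR_ge0.
move=> y; rewrite normal_pdf_gaus// -[leRHS]mulrA; apply: ler_wpM2l; first exact: normal_peak_ge0.
rewrite /gaus -expRD ler_expR.
have : 0 <= (s^-1) ^+ 2 by exact: sqr_ge0.
have : (s^-1 / 2) ^+ 2 = (s^-1) ^+ 2 / 4 by field.
move=> ->; move: (s^-1 ^+ 2) => k k0.
have h : 0 <= 2 * (y - x) ^+ 2 + 2 * x ^+ 2 - y ^+ 2.
  have -> : 2 * (y - x) ^+ 2 + 2 * x ^+ 2 - y ^+ 2 = (y - 2 * x) ^+ 2 by ring.
  exact: sqr_ge0.
have := mulr_ge0 k0 h.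
have : 0 <= k * y ^+ 2 by rewrite mulr_ge0// sqr_ge0.
nra.
Qed.

(** Lebesgue differentiation asks for local integrability. It follows from the weighted hypothesis
    because [gaus 1] is bounded below on a compact set, the constant [c] being the inverse of that
    lower bound. *)
Lemma gauss_ae (f : R -> R) : measurable_fun setT f ->
  (forall s, s != 0 -> mu.-integrable setT (EFin \o (fun x => f x * gaus s x))) ->
  {ae mu, forall x, (fun n => Rintegral mu setT (fun y => f y * normal_pdf x (epsn n) y)) @ \oo --> f x}.
Proof.
move=> mf fi.
have lf : locally_integrable setT f.
  split => //; first exact: openT.
  move=> K _ cK; have [M [Mr hM]] := compact_bounded cK.
  pose A : R := `|M| + 1.
  have hA x : K x -> `|x| <= A.
    by apply: hM; rewrite /A (le_lt_trans (ler_norm M))// ltrDl.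
  pose c := expR (A ^+ 2 / 2).
  have i1 : mu.-integrable setT (EFin \o (fun x => c * (`|f x| * gaus 1 x))).
    apply: integrableZR; have := integrable_norm (fi 1 (oner_neq0 _)).
    rewrite (_ : _ \o _ = (fun x => `|f x| * gaus 1 x))//.
    by apply/funext => x /=; rewrite normrM (ger0_norm (gaus_ge0 _ _)).
  have mK : measurable K by exact: compact_measurable.
  have := @integrableS _ _ _ mu setT K _ measurableT mK (@subsetT _ K) i1.
  move=> /integrableP[_]; apply: le_lt_trans.
  apply: ge0_le_integral => //=.
  - by apply: measurable_funTS; apply/measurable_EFinP; exact: measurableT_comp.
  - apply: measurable_funTS; apply/measurable_EFinP; apply: measurableT_comp => //.
    exact: (integrable_measurable i1).
  - move=> x Kx; rewrite lee_fin.
    have h0 : 0 <= c * (`|f x| * gaus 1 x).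
      by apply: mulr_ge0; [exact: expR_ge0|apply: mulr_ge0 => //; exact: gaus_ge0].
    rewrite (ger0_norm h0) mulrCA ler_peMr// /c /gaus -expRD -[leLHS]expR0 ler_expR.
    have := hA x Kx; rewrite ler_norml; nra.
apply: negligibleS (lebesgue_differentiation lf); apply: subsetC => x lx.
apply: gauss_lebesgue_pt => // n.
have [C C0 hC] := normal_pdf_le_gaus x (epsn_neq0 n).
have s0 : (epsn n)^-1 / 2 != 0 by rewrite mulf_neq0 ?invr_eq0 ?epsn_neq0.
apply: (@le_integrableR _ _ _ mu _ (fun y => C * `|f y * gaus ((epsn n)^-1 / 2) y|)).
- by apply: measurable_funM => //; exact: measurable_normal_pdf.
- by apply: integrableZR; exact: integrable_norm (fi _ s0).
- move=> y; rewrite !normrM mulrCA ler_wpM2l// ger0_norm ?normal_pdf_ge0//.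
  by rewrite ger0_norm ?gaus_ge0// hC.
Qed.

End GaussianRegularization.

(** * Gaussian regularization and integrability of the square *)

Section Regularization.
Context d {P : measurableType d} {R : realType} (m : {sigma_finite_measure set P -> \bar R}).
Local Notation mu := (@lebesgue_measure R).
Local Notation mu2 := (mu \x mu)%E.
Variables (px pt : P -> R) (u : R * R -> R[i]) (g : P -> R[i]).
Hypothesis mpx : measurable_fun setT px.
Hypothesis mpt : measurable_fun setT pt.
Hypothesis planar : forall F : R * R -> \bar R, measurable_fun setT F ->
  (forall z, 0 <= F z)%E ->
  (\int[m]_z F (px z, pt z) = \int[mu]_x \int[mu]_t F (x, t))%E.
Hypothesis measurable_u : cmeasurable u.
Hypothesis measurable_g : cmeasurable g.
Hypothesis iu2 : forall s1 s2, s1 != 0 -> s2 != 0 ->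
  cintegrable mu2 (fun y => u y * (gaus s1 y.1 * gaus s2 y.2)%:C).
Hypothesis iu1 : forall t s, s != 0 ->
  cintegrable mu (fun x => u (x, t) * (gaus s x)%:C).
Hypothesis ig : forall s1 s2, s1 != 0 -> s2 != 0 ->
  cintegrable m (fun z => g z * (gaus s1 (px z) * gaus s2 (pt z))%:C).

(** Space and time have separate indices because the limits are taken one variable at a time, so
    that differentiation on the line suffices. *)
Definition damp n k z : R := gaus (epsn n) (px z) * gaus (epsn k) (pt z).
Definition greg n k z : R[i] := g z * (damp n k z)%:C.
Definition ureg n k (y : R * R) : R[i] := cintegral mu2 setT (fun y' => u y' *
  (normal_pdf y.1 (epsn n) y'.1 * normal_pdf y.2 (epsn k) y'.2)%:C).

(** The link between [u] and [g], obtained by testing their distributional relation against Gaussian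
    plane waves: a Gaussian mean of [u] is the transform of [g] damped by Gaussians. *)
Hypothesis ureg_greg : forall n k y,
  ((2 * pi) ^+ 2)%:C * ureg n k y = charint m (greg n k) px pt y.

Let c2 : R := (2 * pi) ^+ 2.
Let c20 : 0 < c2. Proof. by rewrite exprn_gt0// mulr_gt0// pi_gt0. Qed.

Lemma uregE n k y : ureg n k y = (c2^-1)%:C * charint m (greg n k) px pt y.
Proof. by rewrite -ureg_greg mulrA -rmorphM mulVf ?mul1r// gt_eqF. Qed.

Lemma integrable_greg n k : cintegrable m (greg n k).
Proof. by apply: ig; exact: epsn_neq0. Qed.

Lemma damp_ge0 n k z : 0 <= damp n k z. Proof. by rewrite mulr_ge0// gaus_ge0. Qed.
Lemma damp_le1 n k z : damp n k z <= 1.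
Proof. by rewrite -[leRHS]mulr1 ler_pM// ?gaus_ge0// gaus_le1. Qed.

Lemma gaus_epsn_le n N (x : R) : (N <= n)%N -> gaus (epsn N) x <= gaus (epsn n) x.
Proof.
move=> Nn; rewrite ler_expR lerN2 ler_pM2r// ler_wpM2r ?sqr_ge0//.
have e : (epsn n : R) <= epsn N by rewrite /epsn lef_pV2 ?posrE// ler_nat ltnS.
by apply: lerXn2r => //; rewrite nnegrE ltW// epsn_gt0.
Qed.

Lemma measurable_damp n k : measurable_fun setT (damp n k).
Proof.
apply: measurable_funM; [exact: (measurableT_comp (measurable_gaus _) mpx)
  |exact: (measurableT_comp (measurable_gaus _) mpt)].
Qed.

Lemma cmeasurable_ureg n k : cmeasurable (ureg n k).
Proof.
rewrite (_ : ureg n k = (fun y => (c2^-1)%:C * charint m (greg n k) px pt y)).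
  apply: cmeasurableM; first exact: cmeasurable_cst.
  exact: (cmeasurable_charint (integrable_greg n k) mpx mpt).
by apply/funext => y; rewrite uregE.
Qed.

Lemma charintB (g1 g2 : P -> R[i]) y : cintegrable m g1 -> cintegrable m g2 ->
  charint m (fun z => g1 z - g2 z) px pt y = charint m g1 px pt y - charint m g2 px pt y.
Proof.
move=> i1 i2.
have mc : cmeasurable (fun z => cis (y.1 * px z + y.2 * pt z)).
  by apply: cmeasurable_cis; apply: measurable_funD; exact: measurable_funZ.
have ic (h : P -> R[i]) : cintegrable m h -> cintegrable m (fun z => cis (y.1 * px z + y.2 * pt z) * h z).
  by move=> ih; apply: (cintegrableM ih mc (B := 1)) => z; rewrite normc_cis.
rewrite /charint -cintegralB; [|exact: ic..].
by congr cintegral; apply/funext => z; rewrite mulrBr.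
Qed.

Definition reg_error N : \bar R :=
  ((c2^-1)%:E * \int[m]_z (normc (g z) ^+ 2 * (1 - damp N N z) ^+ 2)%:E)%E.

(** Damping increases to 1, so |damp N N - damp n k| <= 1 - damp N N. Plancherel then gives a bound
    independent of [n] and [k], which survives both limits. *)
Lemma ureg_cauchy N n k : (N <= n)%N -> (N <= k)%N ->
  (\int[mu2]_y (normc (ureg N N y - ureg n k y) ^+ 2)%:E <= reg_error N)%E.
Proof.
move=> Nn Nk; set h := fun z => greg N N z - greg n k z.
have ih : cintegrable m h by apply: cintegrableB; exact: integrable_greg.
have e y : (normc (ureg N N y - ureg n k y) ^+ 2)%:E =
    ((c2^-1 ^+ 2)%:E * (normc (charint m h px pt y) ^+ 2)%:E)%E.
  rewrite !uregE -mulrBr -charintB; [|exact: integrable_greg..].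
  by rewrite ComplexField.Normc.normcM normc_real exprMn ger0_norm ?EFinM// invr_ge0 ltW.
under eq_integral do rewrite e.
rewrite ge0_integralZl//; last 3 first.
- apply/measurable_EFinP/measurable_funX/measurable_normc.
  exact: (cmeasurable_charint ih mpx mpt).
- by move=> y _; rewrite lee_fin sqr_ge0.
- by rewrite lee_fin sqr_ge0.
apply: (@le_trans _ _ ((c2^-1 ^+ 2)%:E * (c2%:E * \int[m]_z (normc (h z) ^+ 2)%:E))%E).
  apply: lee_wpmul2l; first by rewrite lee_fin sqr_ge0.
  exact: (plancherel_le mpx mpt planar ih).
rewrite muleA -EFinM expr2 -mulrA mulVf ?gt_eqF// mulr1.
apply: lee_wpmul2l; first by rewrite lee_fin invr_ge0 ltW.
apply: ge0_le_integral_nm => z; first by rewrite lee_fin sqr_ge0.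
rewrite lee_fin /h /greg -mulrBr -rmorphB ComplexField.Normc.normcM normc_real exprMn.
rewrite ler_wpM2l ?sqr_ge0// lerXn2r ?nnegrE// ?subr_ge0 ?damp_le1//.
rewrite distrC ger0_norm ?lerB ?damp_le1// subr_ge0.
by rewrite /damp ler_pM ?gaus_ge0 ?gaus_epsn_le.
Qed.

Definition ureg1 n (y : R * R) : R[i] := cintegral mu setT (fun x' => u (x', y.2) *
  (normal_pdf y.1 (epsn n) x')%:C).

Lemma measurable_pdf2 s : s != 0 ->
  measurable_fun setT (fun p : R * R => normal_pdf p.1 s p.2).
Proof.
move=> s0; under eq_fun do rewrite normal_pdf_gaus//.
apply: measurable_funZ; apply: (measurableT_comp (measurable_gaus _)).
exact: (measurable_funB measurable_snd measurable_fst).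
Qed.

Lemma cmeasurable_ureg1 n : cmeasurable (ureg1 n).
Proof.
have h : cmeasurable (fun z : (R * R) * R => u (z.2, z.1.2) * (normal_pdf z.1.1 (epsn n) z.2)%:C).
  have m12 : measurable_fun setT (fun z : (R * R) * R => z.1.2) by exact: (measurableT_comp measurable_snd measurable_fst).
  have m11 : measurable_fun setT (fun z : (R * R) * R => z.1.1) by exact: (measurableT_comp measurable_fst measurable_fst).
  have mz : measurable_fun setT (fun z : (R * R) * R => (z.2, z.1.2)).
    exact: (measurable_fun_pair measurable_snd m12).
  apply: cmeasurableM.
    by split; [exact: (measurableT_comp measurable_u.1 mz)|exact: (measurableT_comp measurable_u.2 mz)].
  apply: cmeasurable_real.
  exact: (measurableT_comp (measurable_pdf2 (@epsn_neq0 R n)) (measurable_fun_pair m11 measurable_snd)).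
exact: (cmeasurable_cintegral2 mu h).
Qed.

Lemma integrable_u_pdf (x : R) n s : s != 0 ->
  cintegrable mu2 (fun y => u y * (normal_pdf x (epsn n) y.1 * gaus s y.2)%:C).
Proof.
move=> s0; have [C C0 hC] := normal_pdf_le_gaus x (@epsn_neq0 R n).
have s10 : (epsn n : R)^-1 / 2 != 0 by rewrite mulf_neq0 ?invr_eq0 ?epsn_neq0.
apply: (@le_cintegrable _ _ _ mu2 _ (fun y : R * R => C * normc (u y * (gaus ((epsn n)^-1 / 2) y.1 * gaus s y.2)%:C))).
- apply: cmeasurableM => //; apply: cmeasurable_real; apply: measurable_funM.
    exact: (measurableT_comp (measurable_normal_pdf _ _) measurable_fst).
  exact: (measurableT_comp (measurable_gaus _) measurable_snd).
- by apply: integrableZR; apply: cintegrable_norm; exact: iu2.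
- move=> y; rewrite !ComplexField.Normc.normcM !normc_real mulrCA ler_wpM2l ?normc_ge0//.
  rewrite !normrM (ger0_norm (normal_pdf_ge0 _ _ _)) !(ger0_norm (gaus_ge0 _ _)) mulrA.
  by rewrite ler_wpM2r ?gaus_ge0.
Qed.

Lemma ureg1M n (x t r : R) :
  cintegral mu setT (fun x' => u (x', t) * (normal_pdf x (epsn n) x' * r)%:C) =
  ureg1 n (x, t) * r%:C.
Proof.
rewrite mulrC -cintegralZ.
  by congr cintegral; apply/funext => x' /=; rewrite rmorphM; ring.
have [C' C'0 hC'] := normal_pdf_le_gaus x (@epsn_neq0 R n).
have s1 : (epsn n : R)^-1 / 2 != 0 by rewrite mulf_neq0 ?invr_eq0 ?epsn_neq0.
apply: (@le_cintegrable _ _ _ mu _ (fun x' : R => C' * normc (u (x', t) * (gaus ((epsn n)^-1 / 2) x')%:C))).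
- apply: cmeasurableM.
    by split; [exact: (measurableT_comp measurable_u.1 (measurable_pair2 t))
      |exact: (measurableT_comp measurable_u.2 (measurable_pair2 t))].
  by apply: cmeasurable_real; exact: measurable_normal_pdf.
- by apply: integrableZR; apply: cintegrable_norm; exact: iu1.
- move=> x'; rewrite !ComplexField.Normc.normcM !normc_real mulrCA ler_wpM2l ?normc_ge0//.
  by rewrite (ger0_norm (normal_pdf_ge0 _ _ _)) (ger0_norm (gaus_ge0 _ _)).
Qed.

Lemma integrable_u_pdf2 n k (x t : R) : cintegrable mu2 (fun y => u y *
  (normal_pdf x (epsn n) y.1 * normal_pdf t (epsn k) y.2)%:C).
Proof.
have [C C0 hC] := normal_pdf_le_gaus t (@epsn_neq0 R k).
have s0 : (epsn k : R)^-1 / 2 != 0 by rewrite mulf_neq0 ?invr_eq0 ?epsn_neq0.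
apply: (@le_cintegrable _ _ _ mu2 _ (fun y : R * R => C * normc (u y * (normal_pdf x (epsn n) y.1 * gaus ((epsn k)^-1 / 2) y.2)%:C))).
- apply: cmeasurableM => //; apply: cmeasurable_real; apply: measurable_funM.
    exact: (measurableT_comp (measurable_normal_pdf _ _) measurable_fst).
  exact: (measurableT_comp (measurable_normal_pdf _ _) measurable_snd).
- by apply: integrableZR; apply: cintegrable_norm; exact: integrable_u_pdf.
- move=> y; rewrite !ComplexField.Normc.normcM !normc_real mulrCA ler_wpM2l ?normc_ge0//.
  rewrite !normrM !(ger0_norm (normal_pdf_ge0 _ _ _)) !(ger0_norm (gaus_ge0 _ _)) mulrCA.
  by rewrite ler_wpM2l ?normal_pdf_ge0.
Qed.

Lemma uregE1 n k x t : ureg n k (x, t) =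
  cintegral mu setT (fun t' => ureg1 n (x, t') * (normal_pdf t (epsn k) t')%:C).
Proof.
rewrite /ureg cintegral_Fubini2/=; last exact: integrable_u_pdf2.
congr cintegral; apply/funext => t'.
exact: ureg1M.
Qed.

Lemma cvg_sqr_normcB (a : nat -> R[i]) (l c : R[i]) :
  (fun n => Re (a n)) @ \oo --> Re l -> (fun n => Im (a n)) @ \oo --> Im l ->
  (fun n => normc (c - a n) ^+ 2) @ \oo --> normc (c - l) ^+ 2.
Proof.
move=> ar ai; rewrite sqr_normc; under eq_fun do rewrite sqr_normc.
rewrite !ReD !ImD !ReN !ImN; under eq_fun do rewrite !ReD !ImD !ReN !ImN.
have h (p q : R) (v : nat -> R) : v @ \oo --> q -> (fun n => (p - v n) ^+ 2) @ \oo --> (p - q) ^+ 2.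
  by move=> vq; apply: cvgM; (apply: cvgB; [exact: cvg_cst|exact: vq]).
by apply: cvgD; exact: h.
Qed.

Lemma gauss_cae (f : R -> R[i]) (c : R -> R[i]) : cmeasurable f ->
  (forall s, s != 0 -> cintegrable mu (fun x => f x * (gaus s x)%:C)) ->
  {ae mu, forall x, (fun n => normc (c x - cintegral mu setT (fun y => f y * (normal_pdf x (epsn n) y)%:C)) ^+ 2)
    @ \oo --> normc (c x - f x) ^+ 2}.
Proof.
move=> [fr fi] hf.
have hr : {ae mu, forall x, (fun n => Rintegral mu setT (fun y => Re (f y) * normal_pdf x (epsn n) y)) @ \oo --> Re (f x)}.
  apply: gauss_ae => // s s0; have [+ _] := hf s s0.
  by under eq_fun do rewrite ReM /= mulr0 subr0.
have hi : {ae mu, forall x, (fun n => Rintegral mu setT (fun y => Im (f y) * normal_pdf x (epsn n) y)) @ \oo --> Im (f x)}.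
  apply: gauss_ae => // s s0; have [_ +] := hf s s0.
  by under eq_fun do rewrite ImM /= mulr0 add0r.
apply: (negligibleS _ (negligibleU hr hi)); rewrite -setCI; apply: subsetC => x [cr ci].
apply: cvg_sqr_normcB => /=.
- rewrite (_ : (fun n => _) = (fun n => Rintegral mu setT (fun y => Re (f y) * normal_pdf x (epsn n) y)))//.
  by apply/funext => n; apply: eq_Rintegral => y _; rewrite ReM /= mulr0 subr0.
- rewrite (_ : (fun n => _) = (fun n => Rintegral mu setT (fun y => Im (f y) * normal_pdf x (epsn n) y)))//.
  by apply/funext => n; apply: eq_Rintegral => y _; rewrite ImM /= mulr0 add0r.
Qed.

Lemma measurable_sqr_normcB (a b : R * R -> R[i]) : cmeasurable a -> cmeasurable b ->
  measurable_fun setT (fun y => normc (a y - b y) ^+ 2).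
Proof.
move=> ma mb; apply: measurable_funX; apply: measurable_normc.
by apply: cmeasurableD => //; exact: cmeasurableN.
Qed.

(** First k tends to infinity, with Gaussian means in time on each vertical line leading to [ureg1];
    then n does, with means in space on each time slice leading to [u]. Fatou by sections carries
    the uniform bound through both limits. As a by-product [u] is square integrable. *)
Lemma ureg_error N :
  (\int[mu2]_y (normc (ureg N N y - u y) ^+ 2)%:E <= reg_error N)%E.
Proof.
have h1 n : (N <= n)%N ->
    (\int[mu2]_y (normc (ureg N N y - ureg1 n y) ^+ 2)%:E <= reg_error N)%E.
  move=> Nn; apply: (@fatou_section1 _ _ _ _ _ mu mu (fun k (y : R * R) => normc (ureg N N y - ureg n k y) ^+ 2)).
  - by move=> k; apply: measurable_sqr_normcB; exact: cmeasurable_ureg.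
  - by apply: measurable_sqr_normcB; [exact: cmeasurable_ureg|exact: cmeasurable_ureg1].
  - by move=> k y; exact: sqr_ge0.
  - by move=> y; exact: sqr_ge0.
  - by exists N => // k /= Nk; exact: ureg_cauchy.
  - move=> x; have h : {ae mu, forall t, (fun k => normc (ureg N N (x, t) -
        cintegral mu setT (fun t' => ureg1 n (x, t') * (normal_pdf t (epsn k) t')%:C)) ^+ 2) @ \oo -->
        normc (ureg N N (x, t) - ureg1 n (x, t)) ^+ 2}.
      apply: (gauss_cae (f := fun t => ureg1 n (x, t)) (fun t => ureg N N (x, t))).
        have [mr mi] := cmeasurable_ureg1 n.
        by split; [exact: (measurableT_comp mr (measurable_pair1 x))|exact: (measurableT_comp mi (measurable_pair1 x))].
      move=> s s0; have := cintegrable_cintegral2 (integrable_u_pdf x n s0).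
      rewrite (_ : (fun y => cintegral _ _ _) = (fun t => ureg1 n (x, t) * (gaus s t)%:C))//.
      by apply/funext => t; exact: (ureg1M n x t (gaus s t)).
    apply: negligibleS h; apply: subsetC => t; apply: cvg_trans; apply: near_eq_cvg.
    by apply: nearW => k; rewrite (uregE1 n k x t).
apply: (@fatou_section2 _ _ _ _ _ mu mu (fun n (y : R * R) => normc (ureg N N y - ureg1 n y) ^+ 2)).
- by move=> n; apply: measurable_sqr_normcB; [exact: cmeasurable_ureg|exact: cmeasurable_ureg1].
- by apply: measurable_sqr_normcB => //; exact: cmeasurable_ureg.
- by move=> n y; exact: sqr_ge0.
- by move=> y; exact: sqr_ge0.
- by exists N => // n /= Nn; exact: h1.
- move=> t; apply: (gauss_cae (f := fun x => u (x, t)) (fun x => ureg N N (x, t))).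
    by split; [exact: (measurableT_comp measurable_u.1 (measurable_pair2 t))
      |exact: (measurableT_comp measurable_u.2 (measurable_pair2 t))].
  by move=> s s0; exact: iu1.
Qed.

Hypothesis L2g : (\int[m]_z (normc (g z) ^+ 2)%:E < +oo)%E.

Let mng : measurable_fun setT (fun z => normc (g z) ^+ 2).
Proof. by apply: measurable_funX; exact: measurable_normc. Qed.

Let ing : m.-integrable setT (EFin \o (fun z => normc (g z) ^+ 2)).
Proof. by apply: integrable_lty => // z; exact: sqr_ge0. Qed.

Lemma reg_error_cvg : exists2 r : nat -> R, r @ \oo --> 0 &
  forall N, 0 <= r N /\ (reg_error N <= (r N)%:E)%E.
Proof.
pose e N z : R := normc (g z) ^+ 2 * (1 - damp N N z) ^+ 2.
have me N : measurable_fun setT (e N).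
  apply: measurable_funM => //; apply: measurable_funX.
  by apply: measurable_funB; [exact: measurable_cst|exact: measurable_damp].
have e0 N z : 0 <= e N z by rewrite mulr_ge0 ?sqr_ge0.
have ele N z : e N z <= normc (g z) ^+ 2.
  rewrite ler_piMr ?sqr_ge0// expr_le1// ?subr_ge0 ?damp_le1//.
  by rewrite lerBlDr lerDl damp_ge0.
exists (fun N => c2^-1 * Rintegral m setT (e N)).
  rewrite -[X in _ --> X](mulr0 c2^-1) -[X in _ * X](_ : Rintegral m setT (fun z => normc (g z) ^+ 2 * (1 - 1) ^+ 2) = 0); last first.
    by rewrite /Rintegral integral0_eq// => z _; rewrite subrr expr0n/= mulr0.
  apply: cvgM; first exact: cvg_cst.
  apply: (Rintegral_cvg me _ ing).
  - by apply: measurable_funM => //; exact: measurable_cst.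
  - by move=> N z; rewrite ger0_norm.
  - move=> z; rewrite /e; apply: cvgM; first exact: cvg_cst.
    have h : (fun N => 1 - damp N N z) @ \oo --> (1 - 1 * 1 : R).
      by apply: cvgB; [exact: cvg_cst|apply: cvgM; exact: cvg_gaus1].
    by rewrite mulr1 in h; apply: cvgM.
move=> N; split.
  apply: mulr_ge0; first by rewrite invr_ge0 ltW.
  by apply: Rintegral_ge0 => z _; exact: e0.
rewrite /reg_error Rintegral_fin ?EFinM//.
by apply: (le_integrableR (me N) ing) => z; rewrite ger0_norm.
Qed.

Lemma ureg_L2 N : (\int[mu2]_y (normc (ureg N N y) ^+ 2)%:E < +oo)%E.
Proof.
have e y : (normc (ureg N N y) ^+ 2)%:E =
    ((c2^-1 ^+ 2)%:E * (normc (charint m (greg N N) px pt y) ^+ 2)%:E)%E.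
  by rewrite uregE ComplexField.Normc.normcM normc_real exprMn ger0_norm ?EFinM// invr_ge0 ltW.
under eq_integral do rewrite e.
rewrite ge0_integralZl//; last 3 first.
- apply/measurable_EFinP; apply: measurable_funX; apply: measurable_normc.
  exact: (cmeasurable_charint (integrable_greg N N) mpx mpt).
- by move=> y _; rewrite lee_fin sqr_ge0.
- by rewrite lee_fin sqr_ge0.
apply: lte_mul_pinfty; rewrite ?lee_fin ?sqr_ge0//.
apply: (le_lt_trans (plancherel_le mpx mpt planar (integrable_greg N N))).
apply: lte_mul_pinfty; rewrite ?lee_fin ?sqr_ge0//; apply: le_lt_trans L2g.
apply: ge0_le_integral_nm => z; first by rewrite lee_fin sqr_ge0.
rewrite lee_fin lerXn2r ?nnegrE ?normc_ge0// /greg ComplexField.Normc.normcM normc_real.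
by rewrite ler_piMr ?normc_ge0// ger0_norm ?damp_ge0 ?damp_le1.
Qed.

Lemma sqr_normcD_le (a b : R[i]) : normc (a + b) ^+ 2 <= 2 * normc a ^+ 2 + 2 * normc b ^+ 2.
Proof.
apply: (@le_trans _ _ ((normc a + normc b) ^+ 2)).
  by rewrite lerXn2r ?nnegrE ?addr_ge0 ?normc_ge0//; exact: normcD.
have : 0 <= (normc a - normc b) ^+ 2 by exact: sqr_ge0.
nra.
Qed.

Let mn2 (v : R * R -> R[i]) : cmeasurable v -> measurable_fun setT (fun y => normc (v y) ^+ 2).
Proof. by move=> mv; apply: measurable_funX; exact: measurable_normc. Qed.

Lemma integrable_sqr_ureg N : mu2.-integrable setT (EFin \o (fun y => normc (ureg N N y) ^+ 2)).
Proof.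
apply: integrable_lty; [exact: mn2 (cmeasurable_ureg N N)|by move=> y; exact: sqr_ge0|exact: ureg_L2].
Qed.

Lemma integrable_sqr_uregB N : mu2.-integrable setT (EFin \o (fun y => normc (ureg N N y - u y) ^+ 2)).
Proof.
apply: integrable_lty.
- by apply: measurable_sqr_normcB => //; exact: cmeasurable_ureg.
- by move=> y; exact: sqr_ge0.
- have [r _ rN] := reg_error_cvg.
  by apply: (le_lt_trans (ureg_error N)); apply: (le_lt_trans (rN N).2); exact: ltry.
Qed.

Lemma integrable_sqr_u : mu2.-integrable setT (EFin \o (fun y => normc (u y) ^+ 2)).
Proof.
apply: (@le_integrableR _ _ _ mu2 _
  (fun y => 2 * normc (ureg 0 0 y - u y) ^+ 2 + 2 * normc (ureg 0 0 y) ^+ 2)).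
- exact: mn2.
- apply: integrableDR; apply: integrableZR; [exact: integrable_sqr_uregB|exact: integrable_sqr_ureg].
- move=> y; rewrite ger0_norm ?sqr_ge0// -[normc (ureg 0 0 y - u y)]normcN opprB.
  by apply: le_trans (sqr_normcD_le _ _); rewrite subrK.
Qed.

Lemma cvg_sqr_ureg : exists2 q : nat -> R, q @ \oo --> 0 &
  forall N, mu2.-integrable setT (EFin \o (fun y => normc (ureg N N y ^+ 2 - u y ^+ 2))) /\
    Rintegral mu2 setT (fun y => normc (ureg N N y ^+ 2 - u y ^+ 2)) <= q N.
Proof.
have [r r0 rN] := reg_error_cvg.
pose M := Rintegral mu2 setT (fun y => normc (u y) ^+ 2).
(* With A = |ureg - u|, the difference of squares is at most A^2 + 2 A |u| <= (1 + 1/dl) A^2 + dl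
   |u|^2. The choice of [dl] gives r / dl <= sqrt r, and the term [epsn N] keeps [dl] positive when
   r vanishes. *)
pose dl N := Num.sqrt (r N) + epsn N.
have dl0 N : 0 < dl N by rewrite ltr_wpDl ?sqrtr_ge0// epsn_gt0.
have sr0 : (fun N => Num.sqrt (r N)) @ \oo --> (0 : R).
  by rewrite -[X in _ --> X](@sqrtr0 R); apply: (cvg_comp _ _ r0); exact: sqrt_continuous.
exists (fun N => r N + Num.sqrt (r N) + dl N * M).
  have h0 : (0 : R) = 0 + 0 + (0 + 0) * M by ring.
  rewrite [X in _ --> X]h0.
  apply: cvgD; first exact: cvgD.
  by apply: cvgM; [apply: cvgD => //; exact: cvg_harmonic|exact: cvg_cst].
move=> N; pose h y := (1 + (dl N)^-1) * normc (ureg N N y - u y) ^+ 2 + dl N * normc (u y) ^+ 2.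
have ih : mu2.-integrable setT (EFin \o h).
  by apply: integrableDR; apply: integrableZR; [exact: integrable_sqr_uregB|exact: integrable_sqr_u].
have le1 y : normc (ureg N N y ^+ 2 - u y ^+ 2) <= h y.
  rewrite subr_sqr ComplexField.Normc.normcM.
  set A := normc (_ - _).
  have : normc (ureg N N y + u y) <= A + 2 * normc (u y).
    rewrite (_ : ureg N N y + u y = (ureg N N y - u y) + (u y + u y)); last by ring.
    apply: (le_trans (normcD _ _)); rewrite lerD2l.
    by apply: (le_trans (normcD _ _)); rewrite -mulr2n mulr_natl.
  have A0 : 0 <= A by exact: normc_ge0.
  move=> h1; apply: (le_trans (ler_wpM2l A0 h1)); rewrite /h -/A.
  have := dl0 N; move: (dl N) (normc (u y)) => e w e0.
  have : 0 <= e^-1 * (A - e * w) ^+ 2 by rewrite mulr_ge0 ?invr_ge0 ?(ltW e0)// sqr_ge0.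
  rewrite (_ : e^-1 * _ = e^-1 * A ^+ 2 - 2 * A * w + e * w ^+ 2); last by field; rewrite gt_eqF.
  nra.
have mD : cmeasurable (fun y => ureg N N y ^+ 2 - u y ^+ 2).
  have mU := cmeasurable_ureg N N.
  exact: (cmeasurableD (cmeasurableM mU mU) (cmeasurableN (cmeasurableM measurable_u measurable_u))).
have iD : mu2.-integrable setT (EFin \o (fun y => normc (ureg N N y ^+ 2 - u y ^+ 2))).
  apply: (@le_integrableR _ _ _ mu2 _ h _ ih); first exact: (measurable_normc mD).
  by move=> y; rewrite ger0_norm ?normc_ge0.
split => //; apply: le_trans.
  by apply: (le_Rintegral measurableT iD ih) => y _; exact: le1.
rewrite /h RintegralD//; [|by apply: integrableZR; exact: integrable_sqr_uregB
  |by apply: integrableZR; exact: integrable_sqr_u].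
rewrite !RintegralZl//; [|exact: integrable_sqr_u|exact: integrable_sqr_uregB].
rewrite -/M lerD2r.
have rr : Rintegral mu2 setT (fun y => normc (ureg N N y - u y) ^+ 2) <= r N.
  rewrite -lee_fin -(Rintegral_fin (integrable_sqr_uregB N)).
  by apply: (le_trans (ureg_error N)); exact: (rN N).2.
have r0N := (rN N).1.
rewrite mulrDl mul1r; apply: lerD => //.
apply: (@le_trans _ _ ((dl N)^-1 * r N)); first by rewrite ler_wpM2l// invr_ge0 ltW.
rewrite ler_pdivrMl// -{1}(sqr_sqrtr r0N) expr2 ler_wpM2r ?sqrtr_ge0//.
by rewrite /dl lerDl ltW// epsn_gt0.
Qed.

(** The product of two characters is the character of the sum: this is the convolution theorem with
    the convolution kept as an integral over pairs. *)
Lemma charintM (g1 g2 : P -> R[i]) y : cintegrable m g1 -> cintegrable m g2 ->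
  charint m g1 px pt y * charint m g2 px pt y =
  charint (sigma_prod m m) (fun w => g1 w.1 * g2 w.2)
    (fun w => px w.1 + px w.2) (fun w => pt w.1 + pt w.2) y.
Proof.
move=> i1 i2.
have mc : cmeasurable (fun z => cis (y.1 * px z + y.2 * pt z)).
  by apply: cmeasurable_cis; apply: measurable_funD; exact: measurable_funZ.
have ic (h : P -> R[i]) : cintegrable m h -> cintegrable m (fun z => cis (y.1 * px z + y.2 * pt z) * h z).
  by move=> ih; apply: (cintegrableM ih mc (B := 1)) => z; rewrite normc_cis.
rewrite /charint -(cintegral_prodM (ic _ i1) (ic _ i2)); congr cintegral; apply/funext => w.
rewrite (_ : y.1 * (px w.1 + px w.2) + y.2 * (pt w.1 + pt w.2) =
  (y.1 * px w.1 + y.2 * pt w.1) + (y.1 * px w.2 + y.2 * pt w.2)); last by ring.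
by move: (y.1 * px w.1 + _) (y.1 * px w.2 + _) => p q; rewrite cisD; ring.
Qed.

(** All that later sections retain of the regularization: L^1 approximations of [u^2] that are exact
    Fourier integrals over pairs of frequencies, with densities dominated by |g| |g| independently
    of the index. *)
Lemma sqr_approx : cintegrable mu2 (fun y => u y ^+ 2) /\
  exists (v_ : nat -> R * R -> R[i]) (rho_ : nat -> P * P -> R[i]) (q : nat -> R),
  [/\ forall N, cintegrable mu2 (v_ N) /\ cintegrable (sigma_prod m m) (rho_ N),
      forall N y, v_ N y = charint (sigma_prod m m) (rho_ N)
        (fun w => px w.1 + px w.2) (fun w => pt w.1 + pt w.2) y,
      forall N w, normc (rho_ N w) <= normc (g w.1) * normc (g w.2),
      q @ \oo --> 0 &
      forall N, mu2.-integrable setT (EFin \o (fun y => normc (v_ N y - u y ^+ 2))) /\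
        Rintegral mu2 setT (fun y => normc (v_ N y - u y ^+ 2)) <= q N].
Proof.
have sq (f : R * R -> R[i]) : cmeasurable f ->
    mu2.-integrable setT (EFin \o (fun y => normc (f y) ^+ 2)) -> cintegrable mu2 (fun y => f y ^+ 2).
  move=> mf fi; apply: (@le_cintegrable _ _ _ mu2 _ _ (cmeasurableM mf mf) fi) => y.
  by rewrite ComplexField.Normc.normcM.
split; first exact: (sq _ measurable_u integrable_sqr_u).
have [q q0 hq] := cvg_sqr_ureg.
have c21 : c2^-1 <= 1.
  rewrite invf_le1//; have := pi_ge2 R; rewrite /c2; move: (pi : R) => p p2.
  by apply: exprn_ege1; lra.
exists (fun N y => ureg N N y ^+ 2).
exists (fun N w => (c2^-1)%:C * greg N N w.1 * ((c2^-1)%:C * greg N N w.2)), q; split => //.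
- move=> N; split; first exact: (sq _ (cmeasurable_ureg N N) (integrable_sqr_ureg N)).
  have ic := cintegrableZ (c2^-1)%:C (integrable_greg N N); exact: (cintegrable_prodM ic ic).
- move=> N y; have ic := cintegrableZ (c2^-1)%:C (integrable_greg N N).
  rewrite -(charintM y ic ic); have -> // : charint m (fun z => (c2^-1)%:C * greg N N z) px pt y = ureg N N y.
  have mc : cmeasurable (fun z => cis (y.1 * px z + y.2 * pt z)).
    by apply: cmeasurable_cis; apply: measurable_funD; exact: measurable_funZ.
  rewrite uregE /charint -cintegralZ.
    by congr cintegral; apply/funext => z; rewrite mulrCA.
  by apply: (cintegrableM (integrable_greg N N) mc (B := 1)) => z; rewrite normc_cis.
- move=> N w.
  have gb z : normc ((c2^-1)%:C * greg N N z) <= normc (g z).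
    rewrite /greg !ComplexField.Normc.normcM !normc_real !ger0_norm ?damp_ge0 ?invr_ge0 ?(ltW c20)//.
    rewrite mulrCA ler_piMr ?normc_ge0// mulr_ile1 ?invr_ge0 ?(ltW c20) ?damp_ge0 ?damp_le1//.
  by rewrite ComplexField.Normc.normcM ler_pM ?normc_ge0.
Qed.

End Regularization.

Section ComplexSequences.
Context {R : realType}.
Local Notation mu := (@lebesgue_measure R).
Implicit Types (a b : nat -> R[i]) (l : R[i]).

Definition ccvg a l :=
  (fun n => Re (a n)) @ \oo --> Re l /\ (fun n => Im (a n)) @ \oo --> Im l.

Lemma ccvg_cst l : ccvg (fun=> l) l.
Proof. by split; exact: cvg_cst. Qed.

Lemma ccvg_real (r : nat -> R) (l : R) : r @ \oo --> l -> ccvg (fun n => (r n)%:C) l%:C.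
Proof. by move=> rl; split => //=; exact: cvg_cst. Qed.

Lemma ccvgM a b l k : ccvg a l -> ccvg b k -> ccvg (fun n => a n * b n) (l * k).
Proof.
move=> [ar ai] [br bi]; split.
- by rewrite ReM; under eq_fun do rewrite ReM; apply: cvgB; exact: cvgM.
- by rewrite ImM; under eq_fun do rewrite ImM; apply: cvgD; exact: cvgM.
Qed.

Lemma ccvg_unique a l k : ccvg a l -> ccvg a k -> l = k.
Proof.
move=> [ar ai] [br bi]; apply: complex_eq.
  exact: (cvg_unique (@norm_hausdorff _ _) ar br).
exact: (cvg_unique (@norm_hausdorff _ _) ai bi).
Qed.

Lemma cintegral_cvg d {V : measurableType d} (m : {measure set V -> \bar R})
    (f_ : nat -> V -> R[i]) (f : V -> R[i]) (h : V -> R) :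
  (forall n, cmeasurable (f_ n)) -> cmeasurable f -> m.-integrable setT (EFin \o h) ->
  (forall n x, normc (f_ n x) <= h x) -> (forall x, ccvg (f_ ^~ x) (f x)) ->
  ccvg (fun n => cintegral m setT (f_ n)) (cintegral m setT f).
Proof.
move=> mf_ [fr fi] ih fh fc; split => /=.
- apply: (Rintegral_cvg _ fr ih); [by move=> n; have [] := mf_ n| |by move=> x; have [] := fc x].
  by move=> n x; exact: le_trans (normc_Re _) (fh n x).
- apply: (Rintegral_cvg _ fi ih); [by move=> n; have [] := mf_ n| |by move=> x; have [] := fc x].
  by move=> n x; exact: le_trans (normc_Im _) (fh n x).
Qed.

Definition ccontinuous (f : R -> R[i]) :=
  continuous (fun x => Re (f x)) /\ continuous (fun x => Im (f x)).

Lemma ccontinuous_measurable f : ccontinuous f -> cmeasurable f.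
Proof. by move=> [fr fi]; split; exact: continuous_measurable_fun. Qed.

Lemma ccontinuousM f g : ccontinuous f -> ccontinuous g -> ccontinuous (fun x => f x * g x).
Proof.
move=> [fr fi] [gr gi]; split=> x.
- by under eq_fun do rewrite ReM; apply: cvgB; apply: cvgM; [exact: fr|exact: gr|exact: fi|exact: gi].
- by under eq_fun do rewrite ImM; apply: cvgD; apply: cvgM; [exact: fr|exact: gi|exact: fi|exact: gr].
Qed.

Lemma ccontinuous_cst (z : R[i]) : ccontinuous (fun=> z).
Proof. by split => x; exact: cvg_cst. Qed.

Lemma ccontinuous_real (p : R -> R) : continuous p -> ccontinuous (fun x => (p x)%:C).
Proof. by move=> pc; split => //= x; exact: cvg_cst. Qed.

Lemma ccontinuous_cis (p : R -> R) : continuous p -> ccontinuous (fun x => cis (p x)).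
Proof.
move=> pc; split => x /=.
- exact: (continuous_comp (pc x) (@continuous_cos R (p x))).
- exact: (continuous_comp (pc x) (@continuous_sin R (p x))).
Qed.

Lemma gauss_ccontinuous (f : R -> R[i]) (B x : R) : ccontinuous f ->
  (forall y, normc (f y) <= B) ->
  ccvg (fun n => cintegral mu setT (fun y => f y * (normal_pdf x (epsn n) y)%:C)) (f x).
Proof.
move=> fc fB; have B0 : 0 <= B by apply: le_trans (fB 0); exact: normc_ge0.
have key (p : R -> R) : continuous p -> (forall y, `|p y| <= B) ->
    (fun n => Rintegral mu setT (fun y => p y * normal_pdf x (epsn n) y)) @ \oo --> p x.
  move=> pc pB; have mp : measurable_fun setT p by exact: continuous_measurable_fun.
  apply: gauss_lebesgue_pt => //; first by apply: (@continuous_lebesgue_pt _ _ _ setT) => //; [split => //; exact: openT|exact: pc].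
  move=> n; apply: (@le_integrableR _ _ _ mu _ (fun y => B * normal_pdf x n.+1%:R^-1 y)).
  - by apply: measurable_funM => //; exact: measurable_normal_pdf.
  - by apply: integrableZR; exact: integrable_normal_pdf.
  - by move=> y; rewrite normrM (ger0_norm (normal_pdf_ge0 _ _ _)) ler_wpM2r ?normal_pdf_ge0.
split => /=.
- under eq_fun do under eq_Rintegral do rewrite ReM /= mulr0 subr0.
  by apply: (key _ fc.1) => y; exact: le_trans (normc_Re _) (fB y).
- under eq_fun do under eq_Rintegral do rewrite ImM /= mulr0 add0r.
  by apply: (key _ fc.2) => y; exact: le_trans (normc_Im _) (fB y).
Qed.

End ComplexSequences.

(** * The Fourier transform of the quadratic term *)

Lemma ccontinuous_cintegral {R : realType} d {Y : measurableType d} (m : {measure set Y -> \bar R})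
    (f : R -> Y -> R[i]) (h : Y -> R) :
  (forall x, cmeasurable (f x)) -> m.-integrable setT (EFin \o h) ->
  (forall x y, normc (f x y) <= h y) -> (forall y, ccontinuous (f ^~ y)) ->
  ccontinuous (fun x => cintegral m setT (f x)).
Proof.
move=> mf ih fh fc.
have key (p : R -> Y -> R) : (forall x, measurable_fun setT (p x)) -> (forall x y, `|p x y| <= h y) ->
    (forall y, continuous (p ^~ y)) -> continuous (fun x => Rintegral m setT (p x)).
  move=> mp ph pc x.
  have := @continuity_under_integral R _ Y m p setT measurableT (x - 1) (x + 1) _ _ h ih _ x.
  apply.
  - by move=> z _; exact: (le_integrableR (mp z) ih (ph z)).
  - by apply: aeW => y _ z _; exact: pc.
  - by move=> z _; apply: aeW => y _; exact: ph.
  - by rewrite inE/= in_itv/= ltrBlDr ltrDl ltr01.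
split => /=.
- apply: key; [by move=> x; have [] := mf x|by move=> x y; exact: le_trans (normc_Re _) (fh x y)|].
  by move=> y; have [] := fc y.
- apply: key; [by move=> x; have [] := mf x|by move=> x y; exact: le_trans (normc_Im _) (fh x y)|].
  by move=> y; have [] := fc y.
Qed.

(** * The transform of a multiplier applied to a Fourier integral *)

Section ProductFormula.
Context d {Q : measurableType d} {R : realType} (M : {sigma_finite_measure set Q -> \bar R}).
Local Notation mu := (@lebesgue_measure R).
Local Notation mu2 := (mu \x mu)%E.
Variables (rho : Q -> R[i]) (a c : Q -> R) (v : R * R -> R[i]).
Variables (theta : R -> R[i]) (Bt : R * R -> R[i]) (beta : R -> R) (Bth M0 : R).
Hypothesis irho : cintegrable M rho.
Hypothesis ma : measurable_fun setT a.
Hypothesis mc : measurable_fun setT c.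
Hypothesis vE : forall y, v y = charint M rho a c y.
Hypothesis iv : cintegrable mu2 v.
Hypothesis theta_cont : ccontinuous theta.
Hypothesis theta_bound : forall xi, normc (theta xi) <= Bth.
Hypothesis itheta : cintegrable mu theta.
Hypothesis mB : cmeasurable Bt.
Hypothesis B_bound : forall t xi, normc (Bt (t, xi)) <= beta t.
Hypothesis ibeta : mu.-integrable setT (EFin \o beta).
Hypothesis beta_bound : forall t, beta t <= M0.
Hypothesis B_cont : forall t, ccontinuous (fun xi => Bt (t, xi)).

Definition Bhat (xi k : R) : R[i] := cintegral mu setT (fun t => cis (t * k) * Bt (t, xi)).

(** Spatial Fourier transform at [xi] of the time integral of [Bt (t, xi)] against [v]. For
    [v = u^2] and [Bt = phase t] it is the transform of the Duhamel term without its factor - i xi /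
    2. *)
Definition pairing (xi : R) : R[i] :=
  cintegral mu2 setT (fun y => cis (- (y.1 * xi)) * Bt (y.2, xi) * v y).

Let cB : R := Rintegral mu setT beta.

Let mB1 xi : cmeasurable (fun t => Bt (t, xi)).
Proof.
by split; [exact: (measurableT_comp mB.1 (measurable_pair2 xi))
  |exact: (measurableT_comp mB.2 (measurable_pair2 xi))].
Qed.

Let iB1 xi : cintegrable mu (fun t => Bt (t, xi)).
Proof. by apply: (@le_cintegrable _ _ _ mu _ beta (mB1 xi) ibeta) => t; exact: B_bound. Qed.

Let mcis1 (k : R) : cmeasurable (fun t : R => cis (t * k)).
Proof. by apply: cmeasurable_cis; exact: measurable_funM. Qed.

Lemma normc_Bhat xi k : normc (Bhat xi k) <= cB.
Proof.
apply: normc_cintegral_le => //; first exact: (cmeasurableM (mcis1 k) (mB1 xi)).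
by move=> t; rewrite ComplexField.Normc.normcM normc_cis mul1r.
Qed.

Lemma ccontinuous_Bhat k : ccontinuous (fun xi => Bhat xi k).
Proof.
apply: (@ccontinuous_cintegral _ _ _ mu _ beta) => //.
- by move=> xi; exact: (cmeasurableM (mcis1 k) (mB1 xi)).
- by move=> xi t; rewrite ComplexField.Normc.normcM normc_cis mul1r.
- by move=> t; apply: ccontinuousM => //; exact: ccontinuous_cst.
Qed.

Lemma cmeasurable_Bhat : cmeasurable (fun z : R * Q => Bhat z.1 (c z.2)).
Proof.
have m1 : measurable_fun setT (fun z : (R * Q) * R => z.1.1) by exact: (measurableT_comp measurable_fst measurable_fst).
have m2 : measurable_fun setT (fun z : (R * Q) * R => c z.1.2).
  exact: (measurableT_comp mc (measurableT_comp measurable_snd measurable_fst)).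
have h : cmeasurable (fun z : (R * Q) * R => cis (z.2 * c z.1.2) * Bt (z.2, z.1.1)).
  apply: cmeasurableM; first by apply: cmeasurable_cis; exact: (measurable_funM measurable_snd m2).
  have mz := measurable_fun_pair (measurable_snd : measurable_fun setT (fun z : (R * Q) * R => z.2)) m1.
  by split; [exact: (measurableT_comp mB.1 mz)|exact: (measurableT_comp mB.2 mz)].
exact: (cmeasurable_cintegral2 mu h).
Qed.

(** A damping factor [r] in the space variable is left free, so that the pairing itself (r = 1) and
    its Gaussian regularizations share their bounds and their continuity. *)
Let Ev (r : R -> R) (xi : R) : R[i] := cintegral mu2 setT (fun y =>
  (cis (- (y.1 * xi)) * (r y.1)%:C) * Bt (y.2, xi) * v y).

Let Eps s := Ev (gaus s).

Let pairingE xi : pairing xi = Ev (fun=> 1) xi.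
Proof. by congr cintegral; apply/funext => y; rewrite mulr1. Qed.

Let cV : R := Rintegral mu2 setT (fun y => M0 * normc (v y)).

Let icV : mu2.-integrable setT (EFin \o (fun y => M0 * normc (v y))).
Proof. by apply: integrableZR; exact: cintegrable_norm. Qed.

Let Ev_integrand (r : R -> R) xi (y : R * R) : (forall x, 0 <= r x <= 1) ->
  normc ((cis (- (y.1 * xi)) * (r y.1)%:C) * Bt (y.2, xi) * v y) <= M0 * normc (v y).
Proof.
move=> r01; have /andP[r0 r1] := r01 y.1.
rewrite !ComplexField.Normc.normcM normc_cis mul1r normc_real ger0_norm//.
rewrite ler_wpM2r ?normc_ge0// -[leRHS]mul1r ler_pM ?normc_ge0//.
exact: le_trans (B_bound _ _) (beta_bound _).
Qed.

Let mEv_integrand (r : R -> R) xi : measurable_fun setT r ->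
  cmeasurable (fun y : R * R => (cis (- (y.1 * xi)) * (r y.1)%:C) * Bt (y.2, xi) * v y).
Proof.
move=> mr; apply: cmeasurableM; last exact: (cintegrable_measurable iv).
apply: cmeasurableM.
  apply: cmeasurableM.
    apply: cmeasurable_cis; apply: measurableT_comp => //.
    by apply: measurable_funM => //; exact: measurable_cst.
  by apply: cmeasurable_real; exact: (measurableT_comp mr measurable_fst).
have [m1 m2] := mB1 xi.
by split; [exact: (measurableT_comp m1 measurable_snd)|exact: (measurableT_comp m2 measurable_snd)].
Qed.

Let ccontinuous_Ev (r : R -> R) : measurable_fun setT r -> (forall x, 0 <= r x <= 1) -> ccontinuous (Ev r).
Proof.
move=> mr r01; apply: (@ccontinuous_cintegral _ _ _ mu2 _ (fun y => M0 * normc (v y))).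
- by move=> xi; exact: mEv_integrand.
- exact: icV.
- by move=> xi y; exact: Ev_integrand.
- move=> y; apply: ccontinuousM; last exact: ccontinuous_cst.
  apply: ccontinuousM => //; apply: ccontinuousM; last exact: ccontinuous_cst.
  apply: ccontinuous_cis => x; apply: cvgN; apply: cvgM; [exact: cvg_cst|exact: cvg_id].
Qed.

Let normc_Ev (r : R -> R) xi : measurable_fun setT r -> (forall x, 0 <= r x <= 1) -> normc (Ev r xi) <= cV.
Proof.
move=> mr r01; apply: normc_cintegral_le; [exact: mEv_integrand|exact: icV|].
by move=> y; exact: Ev_integrand.
Qed.

Let gaus01 (s x : R) : 0 <= gaus s x <= 1.
Proof. by rewrite gaus_ge0 gaus_le1. Qed.

Let one01 (x : R) : 0 <= (1 : R) <= 1.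
Proof. by rewrite ler01 lexx. Qed.

Lemma ccontinuous_pairing : ccontinuous pairing.
Proof.
rewrite (_ : pairing = Ev (fun=> 1)); last by apply/funext => xi; exact: pairingE.
by apply: ccontinuous_Ev => //; exact: measurable_cst.
Qed.

Lemma normc_pairing xi : normc (pairing xi) <= cV.
Proof. by rewrite pairingE; apply: normc_Ev => //; exact: measurable_cst. Qed.

Let EpsE s xi : 0 < s -> Eps s xi =
  cintegral M setT (fun w => (2 * pi * normal_pdf (a w) s xi)%:C * Bhat xi (c w) * rho w).
Proof.
move=> s0; have sn0 : s != 0 by rewrite gt_eqF.
have i1 (k : R) : cintegrable mu (fun y : R => cis (k * y) * (gaus s y)%:C) by exact: integrable_cis_gaus.
have i1' : cintegrable mu (fun y : R => cis (- (y * xi)) * (gaus s y)%:C).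
  by have := i1 (- xi); under eq_fun do rewrite mulNr mulrC [_%:C * _]mulrC [xi * _]mulrC.
have iG : cintegrable (sigma_prod mu mu) (fun y : R * R => (cis (- (y.1 * xi)) * (gaus s y.1)%:C) * Bt (y.2, xi)).
  exact: (cintegrable_prodM i1' (iB1 xi)).
have mph : measurable_fun setT (fun z : (R * R) * Q => z.1.1 * a z.2 + z.1.2 * c z.2).
  have m1 : measurable_fun setT (fun z : (R * R) * Q => z.1.1) by exact: (measurableT_comp measurable_fst measurable_fst).
  have m2 : measurable_fun setT (fun z : (R * R) * Q => z.1.2) by exact: (measurableT_comp measurable_snd measurable_fst).
  exact: (measurable_funD (measurable_funM m1 (measurableT_comp ma measurable_snd))
    (measurable_funM m2 (measurableT_comp mc measurable_snd))).
transitivity (cintegral (sigma_prod mu mu) setT (fun y : R * R =>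
    (cis (- (y.1 * xi)) * (gaus s y.1)%:C) * Bt (y.2, xi) * charint M rho a c y)).
  by congr cintegral; apply/funext => y; rewrite vE.
rewrite (@cintegral_swapM _ _ _ Q R (sigma_prod mu mu) M _ rho
  (fun z => cis (z.1.1 * a z.2 + z.1.2 * c z.2)) 1 iG irho (cmeasurable_cis mph) (fun z => eq_ler (normc_cis _))).
congr cintegral; apply/funext => w; rewrite mulrC; congr (_ * _).
transitivity (cintegral mu2 setT (fun y : R * R =>
    (cis ((a w - xi) * y.1) * (gaus s y.1)%:C) * (cis (y.2 * c w) * Bt (y.2, xi)))).
  congr cintegral; apply/funext => y /=.
  rewrite (_ : (a w - xi) * y.1 = y.1 * a w + - (y.1 * xi)); last by ring.
  by rewrite !cisD; ring.
rewrite (cintegral_prodM (i1 (a w - xi)) (cintegrableM (iB1 xi) (mcis1 (c w)) (fun t => eq_ler (normc_cis _)))).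
by rewrite integral_cis_gaus_pdf.
Qed.

Let kk s (z : R * Q) : R[i] := (2 * pi * normal_pdf (a z.2) s z.1)%:C * Bhat z.1 (c z.2).

Let mkk s : 0 < s -> cmeasurable (kk s).
Proof.
move=> s0; apply: cmeasurableM; last exact: cmeasurable_Bhat.
apply: cmeasurable_real; apply: measurable_funZ.
under eq_fun do rewrite normal_pdf_gaus ?gt_eqF//.
apply: measurable_funZ; apply: (measurableT_comp (measurable_gaus _)).
exact: (measurable_funB measurable_fst (measurableT_comp ma measurable_snd)).
Qed.

Let pi20 : 0 <= 2 * pi :> R. Proof. by rewrite mulr_ge0// pi_ge0. Qed.

Let kkb s z : 0 < s -> normc (kk s z) <= 2 * pi * normal_peak s * cB.
Proof.
move=> s0; rewrite ComplexField.Normc.normcM normc_real ger0_norm; last first.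
  by apply: mulr_ge0 => //; exact: normal_pdf_ge0.
apply: ler_pM; [by apply: mulr_ge0 => //; exact: normal_pdf_ge0|exact: normc_ge0| |exact: normc_Bhat].
by apply: ler_wpM2l => //; apply: normal_pdf_ub; rewrite gt_eqF.
Qed.

Let swapped s : 0 < s -> cintegral mu setT (fun xi => theta xi * Eps s xi) =
  cintegral M setT (fun w => rho w * cintegral mu setT (fun xi => kk s (xi, w) * theta xi)).
Proof.
move=> s0; rewrite -(cintegral_swapM itheta irho (mkk s0) (fun z => kkb z s0)).
by congr cintegral; apply/funext => xi; rewrite EpsE.
Qed.

Let mth : cmeasurable theta. Proof. exact: ccontinuous_measurable. Qed.

(** Formally, the space integral of e^{i x (a - xi)} is 2 pi times a Dirac mass at xi = a. A
    Gaussian factor in space makes Fubini legitimate and replaces the mass by a normal density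
    centred at [a w]; the width then tends to 0, and the limit is found from the continuity of
    [theta] and of [Bhat] in the frequency. *)
Lemma product_formula : cintegral mu setT (fun xi => theta xi * pairing xi) =
  cintegral M setT (fun w => rho w * ((2 * pi)%:C * (theta (a w) * Bhat (a w) (c w)))).
Proof.
have epos n : 0 < epsn n :> R by exact: epsn_gt0.
apply: (@ccvg_unique _ (fun n => cintegral mu setT (fun xi => theta xi * Eps (epsn n) xi))).
- apply: (@cintegral_cvg _ _ _ mu _ _ (fun xi => cV * normc (theta xi))).
  + move=> n; apply: cmeasurableM => //; apply: ccontinuous_measurable.
    by apply: ccontinuous_Ev => //; exact: measurable_gaus.
  + by apply: cmeasurableM => //; apply: ccontinuous_measurable; exact: ccontinuous_pairing.
  + by apply: integrableZR; exact: cintegrable_norm.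
  + move=> n xi; rewrite ComplexField.Normc.normcM mulrC ler_wpM2r ?normc_ge0//.
    by apply: normc_Ev => //; exact: measurable_gaus.
  + move=> xi; rewrite pairingE; apply: ccvgM; first exact: ccvg_cst.
    apply: (@cintegral_cvg _ _ _ mu2 _ _ (fun y => M0 * normc (v y))).
    * by move=> n; apply: mEv_integrand; exact: measurable_gaus.
    * by apply: (@mEv_integrand (fun=> 1)); exact: measurable_cst.
    * exact: icV.
    * by move=> n y; exact: Ev_integrand.
    * move=> y; apply: ccvgM; last exact: ccvg_cst.
      apply: ccvgM; last exact: ccvg_cst.
      by apply: ccvgM; [exact: ccvg_cst|apply: ccvg_real; exact: cvg_gaus1].
- rewrite (_ : (fun n => _) = (fun n => cintegral M setT
    (fun w => rho w * cintegral mu setT (fun xi => kk (epsn n) (xi, w) * theta xi)))); last first.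
    by apply/funext => n; rewrite swapped.
  have mk n w : cmeasurable (fun xi => kk (epsn n) (xi, w)).
    have [m1 m2] := mkk (epos n).
    by split; [exact: (measurableT_comp m1 (measurable_pair2 w))|exact: (measurableT_comp m2 (measurable_pair2 w))].
  have mr := cintegrable_measurable irho.
  apply: (@cintegral_cvg _ _ _ M _ _ (fun w => (2 * pi * cB * Bth) * normc (rho w))).
  + move=> n; apply: cmeasurableM => //.
    have h : cmeasurable (fun z : Q * R => kk (epsn n) (z.2, z.1) * theta z.2).
      have [m1 m2] := mkk (epos n); have ms := @measurable_swap _ _ Q (measurableTypeR R).
      apply: cmeasurableM.
        by split; [exact: (measurableT_comp m1 ms)|exact: (measurableT_comp m2 ms)].
      by split; [exact: (measurableT_comp mth.1 measurable_snd)|exact: (measurableT_comp mth.2 measurable_snd)].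
    exact: (cmeasurable_cintegral2 mu h).
  + apply: cmeasurableM => //; apply: cmeasurableM; first exact: cmeasurable_cst.
    apply: cmeasurableM.
      by split; [exact: (measurableT_comp mth.1 ma)|exact: (measurableT_comp mth.2 ma)].
    have mz : measurable_fun setT (fun w => (a w, w)) by apply: measurable_fun_pair.
    have [m1 m2] := cmeasurable_Bhat.
    by split; [exact: (measurableT_comp m1 mz)|exact: (measurableT_comp m2 mz)].
  + by apply: integrableZR; exact: cintegrable_norm.
  + move=> n w; rewrite ComplexField.Normc.normcM mulrC ler_wpM2r ?normc_ge0//.
    apply: (@le_trans _ _ (Rintegral mu setT (fun xi => (2 * pi * cB * Bth) * normal_pdf (a w) (epsn n) xi))).
      apply: normc_cintegral_le.
      - exact: (cmeasurableM (mk n w) mth).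
      - by apply: integrableZR; exact: integrable_normal_pdf.
      - move=> xi; rewrite !ComplexField.Normc.normcM normc_real ger0_norm; last first.
          by apply: mulr_ge0 => //; exact: normal_pdf_ge0.
        rewrite [leRHS](_ : _ = 2 * pi * normal_pdf (a w) (epsn n) xi * (cB * Bth)); last by ring.
        rewrite -mulrA ler_wpM2l//; first by apply: mulr_ge0 => //; exact: normal_pdf_ge0.
        by apply: ler_pM; rewrite ?normc_ge0// normc_Bhat.
    by rewrite RintegralZl ?integrable_normal_pdf// /Rintegral integral_normal_pdf mulr1.
  + move=> w; apply: ccvgM; first exact: ccvg_cst.
    have mBw : cmeasurable (fun xi => Bhat xi (c w)).
      by apply: ccontinuous_measurable; exact: ccontinuous_Bhat.
    rewrite (_ : (fun n => _) = (fun n => (2 * pi)%:C * cintegral mu setT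
      (fun xi => (theta xi * Bhat xi (c w)) * (normal_pdf (a w) (epsn n) xi)%:C))); last first.
      apply/funext => n; rewrite -cintegralZ.
        by congr cintegral; apply/funext => xi; rewrite /kk /= rmorphM; ring.
      apply: (cintegrableM (cintegrable_real (integrable_normal_pdf _ _)) (cmeasurableM mth mBw) (B := Bth * cB)).
      by move=> xi; rewrite ComplexField.Normc.normcM ler_pM ?normc_ge0// normc_Bhat.
    apply: ccvgM; first exact: ccvg_cst.
    apply: (@gauss_ccontinuous _ _ (Bth * cB)).
      by apply: ccontinuousM => //; exact: ccontinuous_Bhat.
    by move=> xi; rewrite ComplexField.Normc.normcM ler_pM ?normc_ge0// normc_Bhat.
Qed.

End ProductFormula.

(** * Duality bound for the transform of the square *)

Section PairingEstimate.
Context d {P : measurableType d} {R : realType} (m : {sigma_finite_measure set P -> \bar R}).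
Local Notation mu := (@lebesgue_measure R).
Local Notation mu2 := (mu \x mu)%E.
Variables (px pt : P -> R) (g : P -> R[i]) (u2 : R * R -> R[i]).
Hypothesis mpx : measurable_fun setT px.
Hypothesis mpt : measurable_fun setT pt.
Hypothesis mg : cmeasurable g.
Local Notation xi2 w := (px w.1 + px w.2).
Local Notation tau2 w := (pt w.1 + pt w.2).
Variables (v_ : nat -> R * R -> R[i]) (rho_ : nat -> P * P -> R[i]) (q : nat -> R).
Hypothesis iu2 : cintegrable mu2 u2.
Hypothesis iv : forall N, cintegrable mu2 (v_ N) /\ cintegrable (sigma_prod m m) (rho_ N).
Hypothesis vE : forall N y, v_ N y = charint (sigma_prod m m) (rho_ N)
  (fun w => xi2 w) (fun w => tau2 w) y.
Hypothesis rho_le : forall N w, normc (rho_ N w) <= normc (g w.1) * normc (g w.2).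
Hypothesis q0 : q @ \oo --> 0.
Hypothesis vq : forall N, mu2.-integrable setT (EFin \o (fun y => normc (v_ N y - u2 y))) /\
  Rintegral mu2 setT (fun y => normc (v_ N y - u2 y)) <= q N.
Variables (Bt : R * R -> R[i]) (beta : R -> R) (M0 : R).
Hypothesis mB : cmeasurable Bt.
Hypothesis B_bound : forall t xi, normc (Bt (t, xi)) <= beta t.
Hypothesis ibeta : mu.-integrable setT (EFin \o beta).
Hypothesis beta_bound : forall t, beta t <= M0.
Hypothesis B_cont : forall t, ccontinuous (fun xi => Bt (t, xi)).

Local Notation D := (pairing u2 Bt).
Local Notation K w := (Bhat Bt (xi2 w) (tau2 w)).

Let mxi : measurable_fun setT (fun w : P * P => xi2 w).
Proof. exact: (measurable_funD (measurableT_comp mpx measurable_fst) (measurableT_comp mpx measurable_snd)). Qed.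
Let mtau : measurable_fun setT (fun w : P * P => tau2 w).
Proof. exact: (measurable_funD (measurableT_comp mpt measurable_fst) (measurableT_comp mpt measurable_snd)). Qed.

Let M00 : 0 <= M0.
Proof. exact: le_trans (le_trans (normc_ge0 _) (B_bound 0 0)) (beta_bound 0). Qed.

Let mcisB xi : cmeasurable (fun y : R * R => cis (- (y.1 * xi)) * Bt (y.2, xi)).
Proof.
apply: cmeasurableM.
  apply: cmeasurable_cis; apply: measurableT_comp => //.
  by apply: measurable_funM => //; exact: measurable_cst.
by split; [exact: (measurableT_comp mB.1 (measurableT_comp (measurable_pair2 xi) measurable_snd))
  |exact: (measurableT_comp mB.2 (measurableT_comp (measurable_pair2 xi) measurable_snd))].
Qed.

Let cisB_le xi (y : R * R) : normc (cis (- (y.1 * xi)) * Bt (y.2, xi)) <= M0.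
Proof.
rewrite ComplexField.Normc.normcM normc_cis mul1r.
exact: le_trans (B_bound _ _) (beta_bound _).
Qed.

Lemma pairing_approx N xi : normc (pairing (v_ N) Bt xi - D xi) <= M0 * q N.
Proof.
have [ivN _] := iv N; have [iN qN] := vq N.
rewrite /pairing -cintegralB; [|exact: (cintegrableM ivN (mcisB xi) (cisB_le xi))
  |exact: (cintegrableM iu2 (mcisB xi) (cisB_le xi))].
apply: (@le_trans _ _ (Rintegral mu2 setT (fun y => M0 * normc (v_ N y - u2 y)))); last first.
  by rewrite RintegralZl// ler_wpM2l.
apply: normc_cintegral_le; last 2 first.
- exact: integrableZR.
- by move=> y; rewrite -mulrBr ComplexField.Normc.normcM ler_wpM2r ?normc_ge0.
exact: (cmeasurableD (cmeasurableM (mcisB xi) (cintegrable_measurable ivN))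
  (cmeasurableN (cmeasurableM (mcisB xi) (cintegrable_measurable iu2)))).
Qed.

Let mD : cmeasurable D.
Proof. by apply: ccontinuous_measurable; exact: (ccontinuous_pairing iu2 mB B_bound beta_bound B_cont). Qed.

(** The product formula applies to each approximation [v_ N], and the domination of [rho_ N] makes
    the resulting bound independent of N. The pairing of [v_ N] differs from that of [u2] by at most
    [M0 * q N] at every frequency, which costs a vanishing multiple of the integral of |theta|. *)
Lemma cintegral_pairing_le (theta : R -> R[i]) (Bth : R) : ccontinuous theta ->
  (forall xi, normc (theta xi) <= Bth) -> cintegrable mu theta ->
  ((normc (cintegral mu setT (fun xi => theta xi * D xi)))%:E <=
   \int[m \x m]_w (2 * pi * (normc (g w.1) * normc (g w.2) *
      (normc (theta (xi2 w)) * normc (K w))))%:E)%E.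
Proof.
move=> tc tb it; set J := (\int[m \x m]_w _)%E.
have J0 : (0 <= J)%E.
  apply: integral_ge0 => w _; rewrite lee_fin; apply: mulr_ge0; first by rewrite mulr_ge0// pi_ge0.
  by apply: mulr_ge0; apply: mulr_ge0; exact: normc_ge0.
have [->|Joo] := eqVneq J +oo%E; first by rewrite leey.
have Jfin : J \is a fin_num by rewrite ge0_fin_numE// lt_neqAle Joo leey.
pose L := Rintegral mu setT (fun xi => normc (theta xi)).
have L0 : 0 <= L by apply: Rintegral_ge0 => xi _; exact: normc_ge0.
have iD : cintegrable mu (fun xi => theta xi * D xi).
  have := cintegrableM it mD (normc_pairing iu2 mB B_bound beta_bound).
  by under eq_fun do rewrite mulrC.
have key N : normc (cintegral mu setT (fun xi => theta xi * D xi)) <= fine J + M0 * q N * L.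
  have [ivN irho] := iv N.
  have ivD : cintegrable mu (fun xi => theta xi * pairing (v_ N) Bt xi).
    have mv : cmeasurable (pairing (v_ N) Bt).
      by apply: ccontinuous_measurable; exact: (ccontinuous_pairing ivN mB B_bound beta_bound B_cont).
    have := cintegrableM it mv (normc_pairing ivN mB B_bound beta_bound).
    by under eq_fun do rewrite mulrC.
  rewrite -[X in normc X](subKr (cintegral mu setT (fun xi => theta xi * pairing (v_ N) Bt xi))).
  apply: le_trans (normcD _ _) _; rewrite normcN; apply: lerD.
    rewrite (product_formula irho mxi mtau (vE N) ivN tc tb it mB B_bound ibeta beta_bound B_cont).
    rewrite -lee_fin fineK//.
    have mKw : cmeasurable (fun w : P * P => K w).
      have [k1 k2] := cmeasurable_Bhat mtau mB.
      have mz : measurable_fun setT (fun w : P * P => (xi2 w, w)) by apply: measurable_fun_pair.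
      by split; [exact: (measurableT_comp k1 mz)|exact: (measurableT_comp k2 mz)].
    have mth := ccontinuous_measurable tc.
    have mtw : cmeasurable (fun w : P * P => theta (xi2 w)).
      by split; [exact: (measurableT_comp mth.1 mxi)|exact: (measurableT_comp mth.2 mxi)].
    have ib : cintegrable (sigma_prod m m)
        (fun w => rho_ N w * ((2 * pi)%:C * (theta (xi2 w) * K w))).
      under eq_fun do rewrite mulrC.
      apply: (cintegrableM irho (B := 2 * pi * (Bth * Rintegral mu setT beta))).
        by apply: cmeasurableM; [exact: cmeasurable_cst|exact: cmeasurableM].
      move=> w; rewrite !ComplexField.Normc.normcM normc_real ger0_norm ?mulr_ge0 ?pi_ge0//.
      rewrite ler_wpM2l ?mulr_ge0 ?pi_ge0// ler_pM ?normc_ge0//.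
      exact: (normc_Bhat mB B_bound ibeta).
    apply: (@le_trans _ _ (Rintegral (sigma_prod m m) setT
        (fun w => normc (rho_ N w * ((2 * pi)%:C * (theta (xi2 w) * K w)))))%:E).
      by rewrite lee_fin; exact: normc_cintegral.
    rewrite -(Rintegral_fin (cintegrable_norm ib)).
    apply: ge0_le_integral_nm => w; first by rewrite lee_fin normc_ge0.
    rewrite lee_fin !ComplexField.Normc.normcM normc_real ger0_norm ?mulr_ge0 ?pi_ge0//.
    rewrite mulrCA ler_wpM2l ?mulr_ge0 ?pi_ge0// ler_wpM2r ?mulr_ge0 ?normc_ge0//.
  rewrite -cintegralB//; apply: (@le_trans _ _ (Rintegral mu setT (fun xi => M0 * q N * normc (theta xi)))).
    apply: normc_cintegral_le.
    - exact: (cintegrable_measurable (cintegrableB ivD iD)).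
    - by apply: integrableZR; exact: cintegrable_norm.
    - move=> xi; rewrite -mulrBr ComplexField.Normc.normcM mulrC ler_wpM2r ?normc_ge0//.
      exact: pairing_approx.
  by rewrite RintegralZl//; exact: cintegrable_norm.
rewrite -(fineK Jfin) lee_fin.
have c : (fun N => fine J + M0 * q N * L) @ \oo --> fine J.
  have e : fine J = fine J + M0 * 0 * L by rewrite mulr0 mul0r addr0.
  rewrite [X in _ --> X]e; apply: cvgD; first exact: cvg_cst.
  by apply: cvgM; [apply: cvgM => //; exact: cvg_cst|exact: cvg_cst].
rewrite -(cvg_lim (@norm_hausdorff _ _) c); apply: limr_ge; first by apply/cvg_ex; exists (fine J).
exact: nearW.
Qed.

End PairingEstimate.

Lemma absorb_half {R : realFieldType} (k i j c : R) :
  k * i <= i -> i <= k / 2 * i + c / 2 * j -> i <= c * j.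
Proof. lra. Qed.

(** * Weighted L^2 bound by duality and absorption *)

Section WeightedEstimate.
Context d {P : measurableType d} {R : realType} (m : {sigma_finite_measure set P -> \bar R}).
Local Notation mu := (@lebesgue_measure R).
Variables (px pt : P -> R) (g : P -> R[i]) (D : R -> R[i]) (K : P * P -> R[i]) (DB s b a Cm : R).
Hypothesis mpx : measurable_fun setT px.
Hypothesis mpt : measurable_fun setT pt.
Hypothesis mg : cmeasurable g.
Hypothesis mK : cmeasurable K.
Hypothesis D_cont : ccontinuous D.
Hypothesis D_le : forall xi, normc (D xi) <= DB.
Local Notation xi2 w := (px w.1 + px w.2).
Local Notation tau2 w := (pt w.1 + pt w.2).
Hypothesis D_dual : forall (theta : R -> R[i]) (Bth : R), ccontinuous theta ->
  (forall xi, normc (theta xi) <= Bth) -> cintegrable mu theta ->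
  ((normc (cintegral mu setT (fun xi => theta xi * D xi)))%:E <=
   \int[m \x m]_w (2 * pi * (normc (g w.1) * normc (g w.2) *
      (normc (theta (xi2 w)) * normc (K w))))%:E)%E.
Hypothesis sa0 : 0 <= s + a.
Hypothesis Cm0 : 0 <= Cm.
Hypothesis Cm_main : forall f : R -> R, measurable_fun setT f -> (forall x, 0 <= f x) ->
  (\int[m \x m]_v (f (px v.1 + px v.2)%R * (px v.1 + px v.2)%R ^+ 2 *
     (bracket (px v.1 + px v.2)%R `^ (2 * (s + a)) *
      ((pweight px pt s b v.1 ^+ 2)^-1 * (pweight px pt s b v.2 ^+ 2)^-1)) *
     bracket (pt v.1 + pt v.2 + (px v.1 + px v.2) ^+ 5)%R `^ (- 2))%:E <=
   Cm%:E * \int[mu]_x (f x)%:E)%E.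

Definition hweight (x : R) : R := x ^+ 2 * bracket x `^ (2 * (s + a)).

Definition wdens (z : P) : R := pweight px pt s b z * normc (g z).

(** The modulation bracket of the output compensates the decay of the kernel [K]. Once their product
    is bounded, this is controlled by the product of two squared X^{s,b} densities. *)
Definition wpair (w : P * P) : R :=
  (wdens w.1 * wdens w.2 * (bracket (tau2 w + xi2 w ^+ 5) * normc (K w))) ^+ 2.

Lemma hweight_ge0 x : 0 <= hweight x.
Proof. by rewrite mulr_ge0 ?sqr_ge0 ?powR_ge0. Qed.

Lemma continuous_hweight : continuous hweight.
Proof.
move=> x; apply: cvgM; first exact: exprn_continuous.
have h : continuous (fun y : R => bracket y).
  by move=> y; apply: cvgD; [exact: cvg_cst|exact: norm_continuous].
rewrite (_ : (fun y => _) = (fun y => expR (2 * (s + a) * ln (bracket y)))); last first.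
  by apply/funext => y; rewrite /powR gt_eqF// bracket_gt0.
rewrite /powR gt_eqF ?bracket_gt0//.
apply: (continuous_comp (f := fun y => 2 * (s + a) * ln (bracket y))); last exact: continuous_expR.
apply: cvgM; first exact: cvg_cst.
exact: (continuous_comp (h x) (continuous_ln (bracket_gt0 x))).
Qed.

Let hweight_gaus t : t != 0 -> exists2 C, 0 <= C & forall x, hweight x * gaus t x <= C * gaus (4 / 5 * t) x.
Proof.
move=> t0; pose k := (Num.truncn (2 * (s + a))).+1.
have s1 : 3 / 5 * t != 0 by rewrite mulf_neq0// lt0r_neq0//; lra.
have [C C0 hC] := gaus_bound (2 + k) s1.
exists C => // x; rewrite gaus_split mulrA ler_wpM2r ?gaus_ge0//.
apply: le_trans (hC x); rewrite ler_wpM2r ?gaus_ge0// exprD /hweight ler_pM ?sqr_ge0 ?powR_ge0//.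
  by rewrite -[x ^+ 2]real_normK ?num_real// lerXn2r ?nnegrE ?addr_ge0// lerDr.
rewrite -powR_mulrn ?addr_ge0//; apply: ler_powR; first exact: bracket_ge1.
by apply: ltW; rewrite /k truncnS_gt.
Qed.

(** The test function that reproduces the norm: [theta * D] is |D|^2 [hweight], damped by the
    Gaussian. The damping makes [theta] bounded and integrable, and makes the quantity to be
    absorbed finite. *)
Let theta t x : R[i] := (hweight x * gaus t x)%:C * conjc (D x).
Let f t x : R := normc (D x) ^+ 2 * (hweight x * gaus t x).

Let DB0 : 0 <= DB. Proof. exact: le_trans (normc_ge0 _) (D_le 0). Qed.

Let f0 t x : 0 <= f t x.
Proof. by apply: mulr_ge0; [exact: sqr_ge0|apply: mulr_ge0; [exact: hweight_ge0|exact: gaus_ge0]]. Qed.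

Let mhw : measurable_fun setT hweight.
Proof. by apply: continuous_measurable_fun; exact: continuous_hweight. Qed.

Let mD : cmeasurable D. Proof. exact: ccontinuous_measurable. Qed.

Let mnD : measurable_fun setT (fun x => normc (D x) ^+ 2).
Proof. by apply: measurable_funX; exact: measurable_normc. Qed.

Let mf t : measurable_fun setT (f t).
Proof. apply: measurable_funM => //; apply: measurable_funM => //; exact: measurable_gaus. Qed.

Let intf t : t != 0 -> mu.-integrable setT (EFin \o f t).
Proof.
move=> t0; have [C C0 hC] := hweight_gaus t0.
have s1 : 4 / 5 * t != 0 by rewrite mulf_neq0// lt0r_neq0//; lra.
apply: (@le_integrableR _ _ _ mu _ (fun x => (DB ^+ 2 * C) * gaus (4 / 5 * t) x)); first exact: mf.
  by apply: integrableZR; exact: integrable_gaus.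
move=> x; rewrite ger0_norm// -mulrA; apply: ler_pM => //; first exact: sqr_ge0.
  by apply: mulr_ge0; [exact: hweight_ge0|exact: gaus_ge0].
by rewrite lerXn2r ?nnegrE ?normc_ge0.
Qed.

Let theta_props t : t != 0 -> exists Bth, [/\ ccontinuous (theta t),
  forall x, normc (theta t x) <= Bth & cintegrable mu (theta t)].
Proof.
move=> t0; have [C C0 hC] := hweight_gaus t0.
have s1 : 4 / 5 * t != 0 by rewrite mulf_neq0// lt0r_neq0//; lra.
have tc : ccontinuous (theta t).
  apply: ccontinuousM.
    apply: ccontinuous_real => x; apply: cvgM; [exact: continuous_hweight|exact: continuous_gaus].
  have [dr di] := D_cont; split => x.
    by rewrite (_ : (fun y => _) = (fun y => Re (D y))); [exact: dr|apply/funext => y; case: (D y)].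
  rewrite (_ : (fun y => _) = (fun y => - Im (D y))); last by apply/funext => y; case: (D y).
  by apply: cvgN; exact: di.
have tb x : normc (theta t x) <= (C * DB) * gaus (4 / 5 * t) x.
  rewrite ComplexField.Normc.normcM normc_real normc_conj ger0_norm; last first.
    by apply: mulr_ge0; [exact: hweight_ge0|exact: gaus_ge0].
  rewrite [leRHS]mulrAC; apply: ler_pM; [|exact: normc_ge0|exact: hC|exact: D_le].
  by apply: mulr_ge0; [exact: hweight_ge0|exact: gaus_ge0].
exists (C * DB); split => //.
  move=> x; apply: le_trans (tb x) _; rewrite ler_piMr ?gaus_le1//; exact: mulr_ge0.
apply: (@le_cintegrable _ _ _ mu _ _ (ccontinuous_measurable tc) _ tb).
by apply: integrableZR; exact: integrable_gaus.
Qed.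

Let thetaD t x : theta t x * D x = (f t x)%:C.
Proof. by rewrite /theta /f -mulrA [conjc _ * _]mulrC mulc_conj -rmorphM mulrC. Qed.

Let A t w : R := f t (xi2 w) * xi2 w ^+ 2 *
  (bracket (xi2 w) `^ (2 * (s + a)) *
      ((pweight px pt s b w.1 ^+ 2)^-1 * (pweight px pt s b w.2 ^+ 2)^-1)) *
     bracket (tau2 w + xi2 w ^+ 5) `^ (- 2).

Let young t dl w : 0 < dl ->
  normc (g w.1) * normc (g w.2) * (normc (theta t (xi2 w)) * normc (K w)) <=
  dl / 2 * A t w + dl^-1 / 2 * wpair w.
Proof.
move=> dl0; rewrite /A /wpair /wdens ComplexField.Normc.normcM normc_real normc_conj ger0_norm; last first.
  by apply: mulr_ge0; [exact: hweight_ge0|exact: gaus_ge0].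
have p1 : 0 < pweight px pt s b w.1 by exact: Xweight_gt0.
have p2 : 0 < pweight px pt s b w.2 by exact: Xweight_gt0.
have br : 0 < bracket (tau2 w + xi2 w ^+ 5) by exact: bracket_gt0.
rewrite powRN powR_mulrn ?(ltW br)// /f /hweight.
have P0 := powR_ge0 (bracket (xi2 w)) (2 * (s + a)).
have h0 := gaus_ge0 t (xi2 w); have h1 := gaus_le1 t (xi2 w).
move: (xi2 w) (pweight _ _ _ _ w.1) (pweight _ _ _ _ w.2) (bracket (tau2 w + xi2 w ^+ 5))
  (gaus t (xi2 w)) p1 p2 br P0 h0 h1 => x q1 q2 r h.
move: (bracket x `^ _) (normc (D x)) (normc (g w.1)) (normc (g w.2)) (normc (K w)) => p dn g1 g2 k.
move=> q10 q20 r0 p0 h0 h1.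
(* The weights are distributed so that h * al^2 is the integrand of [Cm_main] for f = f t and be^2
   is [wpair]. The Gaussian value h factors out of both sides and is dropped in front of be^2, as it
   is at most 1. *)
pose al := dn * (x ^+ 2 * p) / (q1 * q2 * r).
pose be := q1 * g1 * (q2 * g2) * (r * k).
have e1 : g1 * g2 * (x ^+ 2 * p * h * dn * k) = h * (al * be).
  by rewrite /al /be; field; rewrite !gt_eqF.
have e2 : dn ^+ 2 * (x ^+ 2 * p * h) * x ^+ 2 * (p * ((q1 ^+ 2)^-1 * (q2 ^+ 2)^-1)) * (r ^+ 2)^-1 = h * al ^+ 2.
  by rewrite /al; field; rewrite !gt_eqF.
rewrite e1 e2 -/be.
have b2 : 0 <= dl^-1 / 2 * be ^+ 2 by rewrite mulr_ge0 ?divr_ge0 ?invr_ge0 ?(ltW dl0)// sqr_ge0.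
have am : al * be <= dl / 2 * al ^+ 2 + dl^-1 / 2 * be ^+ 2.
  have : 0 <= dl^-1 / 2 * (dl * al - be) ^+ 2.
    by rewrite mulr_ge0 ?divr_ge0 ?invr_ge0 ?(ltW dl0)// sqr_ge0.
  rewrite (_ : _ * _ ^+ 2 = dl / 2 * al ^+ 2 - al * be + dl^-1 / 2 * be ^+ 2); last by field; rewrite gt_eqF.
  lra.
apply: le_trans (ler_wpM2l h0 am) _; rewrite mulrDr mulrCA lerD2l.
by rewrite ler_piMl.
Qed.

Let mxi : measurable_fun setT (fun w : P * P => xi2 w).
Proof. exact: (measurable_funD (measurableT_comp mpx measurable_fst) (measurableT_comp mpx measurable_snd)). Qed.
Let mtau : measurable_fun setT (fun w : P * P => tau2 w).
Proof. exact: (measurable_funD (measurableT_comp mpt measurable_fst) (measurableT_comp mpt measurable_snd)). Qed.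
Let mom : measurable_fun setT (fun w : P * P => bracket (tau2 w + xi2 w ^+ 5)).
Proof.
apply: measurable_fun_bracket.
exact: (measurable_funD mtau (measurable_funX 5 mxi)).
Qed.

Lemma measurable_wpair : measurable_fun setT wpair.
Proof.
have mw : measurable_fun setT wdens.
  exact: (measurable_funM (measurable_pweight mpx mpt s b) (measurable_normc mg)).
apply: measurable_funX.
exact: (measurable_funM (measurable_funM (measurableT_comp mw measurable_fst) (measurableT_comp mw measurable_snd))
  (measurable_funM mom (measurable_normc mK))).
Qed.

Let mA t : measurable_fun setT (A t).
Proof.
have mw : measurable_fun setT (fun z => (pweight px pt s b z ^+ 2)^-1).
  rewrite (_ : (fun z => _) = (fun z => pweight px pt s b z `^ (- 2))); last first.
    by apply/funext => z; rewrite powRN powR_mulrn// ltW// Xweight_gt0.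
  by apply: measurable_fun_powR; exact: measurable_pweight.
apply: measurable_funM; last by apply: measurable_fun_powR.
apply: measurable_funM.
  exact: (measurable_funM (measurableT_comp (mf t) mxi) (measurable_funX 2 mxi)).
apply: measurable_funM; first by apply: measurable_fun_powR; exact: measurable_fun_bracket.
exact: (measurable_funM (measurableT_comp mw measurable_fst) (measurableT_comp mw measurable_snd)).
Qed.

Let A0 t w : 0 <= A t w.
Proof.
apply: mulr_ge0; last exact: powR_ge0.
apply: mulr_ge0; first by apply: mulr_ge0 => //; exact: sqr_ge0.
apply: mulr_ge0; first exact: powR_ge0.
by apply: mulr_ge0; rewrite invr_ge0 sqr_ge0.
Qed.

Let c : R := (2 * pi) ^+ 2 * (Cm + 1).

Let f_bound t : t != 0 ->
  (\int[mu]_x (f t x)%:E <= c%:E * \int[m \x m]_w (wpair w)%:E)%E.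
Proof.
move=> t0; set J := (\int[m \x m]_w _)%E.
have J0 : (0 <= J)%E by apply: integral_ge0 => w _; rewrite lee_fin sqr_ge0.
have pi20 : 0 < 2 * pi :> R by rewrite mulr_gt0// pi_gt0.
have Cp : 0 < Cm + 1 by rewrite ltr_wpDl.
have c0 : 0 < c by rewrite mulr_gt0// exprn_gt0.
have [->|Joo] := eqVneq J +oo%E; first by rewrite gt0_muley ?lte_fin// leey.
have Jfin : J \is a fin_num by rewrite ge0_fin_numE// lt_neqAle Joo leey.
have [Bth [tc tb it]] := theta_props t0.
pose I := Rintegral mu setT (f t).
have I0 : 0 <= I by apply: Rintegral_ge0 => x _; exact: f0.
have := D_dual tc tb it.
under [X in normc (cintegral _ _ X)]eq_fun do rewrite thetaD.
rewrite cintegral_real normc_real ger0_norm// => hI.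
rewrite (Rintegral_fin (intf t0)) -/I.
(* The coefficient of [I] on the right becomes Cm / (Cm + 1) / 2, which is less than one half, and
   that of [J] becomes c / 2. The shift from Cm to Cm + 1 avoids dividing by 0. *)
pose dl := (2 * pi * (Cm + 1))^-1.
have dl0 : 0 < dl by rewrite invr_gt0 mulr_gt0.
have h2 : (I%:E <= (2 * pi * (dl / 2 * Cm))%:E * I%:E + (2 * pi * (dl^-1 / 2))%:E * J)%E.
  apply: le_trans hI _.
  apply: (@le_trans _ _ (\int[m \x m]_w ((2 * pi * (dl / 2))%:E * (A t w)%:E +
      (2 * pi * (dl^-1 / 2))%:E * (wpair w)%:E))%E).
    apply: ge0_le_integral_nm => w.
      rewrite lee_fin; apply: mulr_ge0; first exact: ltW.
      by apply: mulr_ge0; apply: mulr_ge0; exact: normc_ge0.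
    rewrite -!EFinM -EFinD lee_fin.
    rewrite [leRHS](_ : _ = 2 * pi * (dl / 2 * A t w + dl^-1 / 2 * wpair w)); last by ring.
    by apply: ler_wpM2l; [exact: ltW|exact: young].
  have k1 : 0 <= 2 * pi * (dl / 2) by rewrite mulr_ge0 ?divr_ge0 ?ltW.
  have k2 : 0 <= 2 * pi * (dl^-1 / 2).
    by apply: mulr_ge0; [exact: ltW|apply: divr_ge0 => //; rewrite invr_ge0 ltW].
  have mAE : measurable_fun setT (fun w => (A t w)%:E) by apply/measurable_EFinP; exact: mA.
  have mwE : measurable_fun setT (fun w => (wpair w)%:E) by apply/measurable_EFinP; exact: measurable_wpair.
  rewrite ge0_integralD//; last 4 first.
  - by move=> w _; rewrite mule_ge0 ?lee_fin.
  - exact: measurable_funeM.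
  - by move=> w _; rewrite mule_ge0 ?lee_fin ?sqr_ge0.
  - exact: measurable_funeM.
  rewrite ge0_integralZl//; last by move=> w _; rewrite lee_fin.
  rewrite ge0_integralZl//; last by move=> w _; rewrite lee_fin sqr_ge0.
  have ea : 2 * pi * (dl / 2 * Cm) = (2 * pi * (dl / 2)) * Cm by rewrite !mulrA.
  apply: leeD => //; rewrite ea (EFinM _ Cm) -muleA; apply: lee_wpmul2l; first by rewrite lee_fin.
  apply: le_trans (Cm_main (mf t) (f0 t)) _.
  by rewrite (Rintegral_fin (intf t0)).
rewrite -(fineK Jfin) -!EFinM -EFinD lee_fin in h2 *.
have e1 : 2 * pi * (dl / 2 * Cm) = Cm / (Cm + 1) / 2.
  have pi0 : pi != 0 :> R by rewrite gt_eqF// pi_gt0.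
  have Cn0 : Cm + 1 != 0 by rewrite gt_eqF.
  by rewrite /dl; move: (pi : R) pi0 => p p0; field; rewrite p0 Cn0.
have e2 : 2 * pi * (dl^-1 / 2) = c / 2 by rewrite /dl invrK /c; move: (pi : R) => p; field.
rewrite e1 e2 in h2.
have : Cm / (Cm + 1) * I <= I by rewrite ler_piMl// ler_pdivrMr// mul1r lerDl.
by rewrite lee_fin => h3; exact: (absorb_half h3 h2).
Qed.

Lemma weighted_estimate :
  (\int[mu]_x (normc (D x) ^+ 2 * hweight x)%:E <= c%:E * \int[m \x m]_w (wpair w)%:E)%E.
Proof.
apply: (@fatou_bound _ _ _ mu (fun n x => f (epsn n) x)).
- by move=> n; exact: mf.
- exact: measurable_funM.
- by move=> n x; exact: f0.
- apply: aeW => x; rewrite /f; have e : normc (D x) ^+ 2 * hweight x = normc (D x) ^+ 2 * (hweight x * 1) by rewrite mulr1.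
  rewrite [X in _ --> X]e.
  by apply: cvgM; [exact: cvg_cst|apply: cvgM; [exact: cvg_cst|exact: cvg_gaus1]].
- by apply: nearW => n; apply: f_bound; exact: epsn_neq0.
Qed.

End WeightedEstimate.

(** * The oscillatory kernel of the Duhamel term *)

Section DuhamelKernel.
Context {R : realType}.
Local Notation mu := (@lebesgue_measure R).
Implicit Types t w x : R.

Local Notation ind t := (\1_(`[0, t]%classic : set R) : R -> R).

Definition phase t (p : R * R) : R[i] := cis (- ((t - p.1) * p.2 ^+ 5)) * (ind t p.1)%:C.

Definition phase_int t w : R[i] := cintegral mu setT (fun x => cis (x * w) * (ind t x)%:C).

Let mind t : measurable_fun setT (ind t).
Proof. by apply: measurable_indic. Qed.

Lemma ind_bound t x : 0 <= ind t x <= 1.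
Proof. by rewrite indicE ler0n lern1 leq_b1. Qed.

Lemma le_ind (r t x : R) : r <= t -> ind r x <= ind t x.
Proof.
move=> rt; rewrite !indicE ler_nat; case: (boolP (x \in [set` `[0, r]])) => //= h.
by rewrite mem_set//=; move: h; rewrite inE/= !in_itv/= => /andP[-> /le_trans->].
Qed.

Lemma integrable_ind t : mu.-integrable setT (EFin \o ind t).
Proof.
apply: integrable_lty => //.
rewrite integral_indic//= setIT.
by rewrite lebesgue_measure_itv/=; case: ifP; rewrite ?EFinN ?ltry// -EFinB ltry.
Qed.

Lemma Rintegral_ind t : 0 <= t -> Rintegral mu setT (ind t) = t.
Proof.
move=> t0; rewrite /Rintegral integral_indic//= setIT lebesgue_measure_itv/= lte_fin.
by case: ltP => [_|h]; rewrite ?oppr0 ?adde0//= ?sube0//; apply/eqP; rewrite eq_le t0 h.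
Qed.

Lemma cmeasurable_phase t : cmeasurable (phase t).
Proof.
apply: cmeasurableM.
  apply: cmeasurable_cis; apply: measurableT_comp => //; apply: measurable_funM; last exact: measurable_funX.
  by apply: measurable_funB => //; exact: measurable_cst.
by apply: cmeasurable_real; exact: (measurableT_comp (mind t) measurable_fst).
Qed.

Lemma normc_phase t (x xi : R) : t <= 1 -> normc (phase t (x, xi)) <= ind 1 x.
Proof.
move=> t1; rewrite ComplexField.Normc.normcM normc_cis mul1r normc_real ger0_norm; last first.
  by have /andP[] := ind_bound t x.
exact: le_ind.
Qed.

Lemma ccontinuous_phase t x : ccontinuous (fun xi => phase t (x, xi)).
Proof.
apply: ccontinuousM; last exact: (ccontinuous_cst ((ind t x)%:C)).
apply: ccontinuous_cis => xi /=; apply: cvgN; apply: cvgM; [exact: cvg_cst|exact: exprn_continuous].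
Qed.

Lemma Bhat_phase t xi k : Bhat (phase t) xi k = cis (- (t * xi ^+ 5)) * phase_int t (k + xi ^+ 5).
Proof.
rewrite /Bhat /phase_int -cintegralZ.
  congr cintegral; apply/funext => x; rewrite /phase/= !mulrA -!cisD; congr (cis _ * _); ring.
apply: (cintegrableM (cintegrable_real (integrable_ind t)) _ (B := 1)).
  by apply: cmeasurable_cis; exact: measurable_funM.
by move=> x; rewrite normc_cis.
Qed.

Let FTC_ind t (p q : R -> R) : 0 <= t -> continuous p -> (forall x : R, is_derive x 1 q (p x)) ->
  Rintegral mu setT (fun x => p x * ind t x) = q t - q 0.
Proof.
move=> t0 pc dq; rewrite -(Rintegral_FTC2 t0 pc dq) /Rintegral.
by rewrite integral_indicR.
Qed.

(** Both identities are multiplied by [w], so the primitive needs no division and the case w = 0 is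
    included. *)
Lemma phase_int_FTC t w : 0 <= t ->
  w * Re (phase_int t w) = sin (t * w) /\ w * Im (phase_int t w) = 1 - cos (t * w).
Proof.
move=> t0; rewrite /phase_int/=.
have iind (p : R -> R) : continuous p -> (forall x, `|p x| <= 1) -> mu.-integrable setT (EFin \o (fun x => p x * ind t x)).
  move=> pc pb; apply: (le_integrableR _ (integrable_ind t)).
    by apply: measurable_funM => //; exact: continuous_measurable_fun.
  move=> x; rewrite normrM; have /andP[i0 _] := ind_bound t x.
  by rewrite (ger0_norm i0) ler_piMl.
have cw : continuous (fun x : R => x * w) by move=> x; apply: cvgM; [exact: cvg_id|exact: cvg_cst].
have cc : continuous (fun x : R => cos (x * w)) by move=> x; exact: (continuous_comp (cw x) (@continuous_cos R _)).
have cs : continuous (fun x : R => sin (x * w)) by move=> x; exact: (continuous_comp (cw x) (@continuous_sin R _)).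
have bc (x : R) : `|cos (x * w)| <= 1 by rewrite ler_norml cos_geN1 cos_le1.
have bs (x : R) : `|sin (x * w)| <= 1 by rewrite ler_norml sin_geN1 sin_le1.
split.
- under eq_Rintegral do rewrite mulr0 subr0.
  rewrite -RintegralZl//; last exact: iind.
  under eq_Rintegral do rewrite mulrA.
  have wc : continuous (fun x : R => w * cos (x * w)) by move=> x; apply: cvgM; [exact: cvg_cst|exact: cc].
  have d (x : R) : is_derive x 1 (fun x : R => sin (x * w)) (w * cos (x * w)).
    by apply: is_derive_eq; rewrite /GRing.scale/= !(mulr1, mulr0, addr0, add0r) mulrC.
  by rewrite (FTC_ind t0 wc d) mul0r sin0 subr0.
- under eq_Rintegral do rewrite mulr0 add0r.
  rewrite -RintegralZl//; last exact: iind.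
  under eq_Rintegral do rewrite mulrA.
  have wc : continuous (fun x : R => w * sin (x * w)) by move=> x; apply: cvgM; [exact: cvg_cst|exact: cs].
  have d (x : R) : is_derive x 1 (fun x : R => - cos (x * w)) (w * sin (x * w)).
    by apply: is_derive_eq; rewrite /GRing.scale/= !(mulr1, mulr0, addr0, add0r); ring.
  by rewrite (FTC_ind t0 wc d) mul0r cos0 opprK addrC.
Qed.

Let iphase t w : cintegrable mu (fun x => cis (x * w) * (ind t x)%:C).
Proof.
apply: (cintegrableM (cintegrable_real (integrable_ind t)) _ (B := 1)).
  by apply: cmeasurable_cis; exact: measurable_funM.
by move=> x; rewrite normc_cis.
Qed.

Lemma normc_phase_int t w : 0 <= t -> normc (phase_int t w) <= t.
Proof.
move=> t0; rewrite -[leRHS](Rintegral_ind t0); apply: normc_cintegral_le.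
- exact: (cintegrable_measurable (iphase t w)).
- exact: integrable_ind.
- move=> x; rewrite ComplexField.Normc.normcM normc_cis mul1r normc_real ger0_norm//.
Qed.

(** The 1 of the bracket contributes at most t <= 1, and |w| times the integral at most |sin| + |1 -
    cos| <= 3. *)
Lemma bracket_phase_int t w : 0 <= t <= 1 -> bracket w * normc (phase_int t w) <= 4.
Proof.
move=> /andP[t0 t1]; have [h1 h2] := phase_int_FTC w t0.
have hn := normc_phase_int w t0.
rewrite /bracket mulrDl mul1r.
have : `|w| * normc (phase_int t w) <= 3.
  apply: (@le_trans _ _ (`|w| * (`|Re (phase_int t w)| + `|Im (phase_int t w)|))).
    by rewrite ler_wpM2l// normc_le.
  rewrite mulrDr -!normrM h1 h2.
  have : `|sin (t * w)| <= 1 by rewrite ler_norml sin_geN1 sin_le1.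
  have : `|1 - cos (t * w)| <= 2.
    by have := cos_geN1 (t * w); have := cos_le1 (t * w); rewrite ler_norml; lra.
  lra.
lra.
Qed.

(** Read off [phase_int_FTC] at time 1, where sin x and 1 - cos x are x times the components of a
    number of modulus at most 1. *)
Lemma normc_cis_sub1 x : normc (cis x - 1) <= 2 * `|x|.
Proof.
have [h1 h2] := phase_int_FTC x ler01; have hn := normc_phase_int x ler01.
rewrite mul1r in h1; rewrite mul1r in h2.
apply: le_trans (normc_le _) _; rewrite ReD ImD ReN ImN /= oppr0 addr0 -h1.
rewrite -[`|cos x - 1|]normrN opprB -h2 !normrM -mulrDr mulrC ler_wpM2r//.
by have := normc_Re (phase_int 1 x); have := normc_Im (phase_int 1 x); lra.
Qed.

Lemma normc_cis_sub x y : normc (cis x - cis y) <= 2 * `|x - y|.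
Proof.
have -> : cis x - cis y = (cis (x - y) - 1) * cis y by rewrite mulrBl mul1r -cisD subrK.
by rewrite ComplexField.Normc.normcM normc_cis mulr1 normc_cis_sub1.
Qed.

Lemma phase_int_lip t t0 w : 0 <= t -> 0 <= t0 ->
  normc (phase_int t w - phase_int t0 w) <= `|t - t0|.
Proof.
wlog tt : t t0 / t0 <= t.
  move=> h; have [/h//|tt] := leP t0 t; move=> h1 h2.
  by rewrite -normcN opprB distrC; apply: h => //; exact: ltW.
move=> t_ge t0_ge; rewrite ger0_norm ?subr_ge0//.
rewrite -{2}(Rintegral_ind t_ge) -{2}(Rintegral_ind t0_ge) -RintegralB//; [|exact: integrable_ind..].
rewrite /phase_int -cintegralB//; apply: normc_cintegral_le.
- exact: (cintegrable_measurable (cintegrableB (iphase t w) (iphase t0 w))).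
- rewrite /comp; under eq_fun do rewrite EFinB.
  by apply: integrableB => //; exact: integrable_ind.
- move=> x; rewrite -mulrBr -rmorphB ComplexField.Normc.normcM normc_cis mul1r normc_real ger0_norm//.
  by rewrite subr_ge0; exact: le_ind.
Qed.

Definition phase_diff t t0 (p : R * R) : R[i] := phase t p - phase t0 p.

Lemma Bhat_phase_diff t t0 xi k : t <= 1 -> t0 <= 1 ->
  Bhat (phase_diff t t0) xi k = Bhat (phase t) xi k - Bhat (phase t0) xi k.
Proof.
move=> t1 t01.
have i1 r : r <= 1 -> cintegrable mu (fun x => cis (x * k) * phase r (x, xi)).
  move=> r1; apply: (@le_cintegrable _ _ _ mu _ _ _ (integrable_ind 1)).
    apply: cmeasurableM; first by apply: cmeasurable_cis; exact: measurable_funM.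
    have [p1 p2] := cmeasurable_phase r.
    by split; [exact: (measurableT_comp p1 (measurable_pair2 xi))|exact: (measurableT_comp p2 (measurable_pair2 xi))].
  by move=> x; rewrite ComplexField.Normc.normcM normc_cis mul1r normc_phase.
rewrite /Bhat -cintegralB; [|exact: i1..].
by congr cintegral; apply/funext => x; rewrite mulrBr.
Qed.

Lemma bracket_Bhat_phase t xi k : 0 <= t <= 1 ->
  bracket (k + xi ^+ 5) * normc (Bhat (phase t) xi k) <= 4.
Proof.
by move=> t01; rewrite Bhat_phase ComplexField.Normc.normcM normc_cis mul1r bracket_phase_int.
Qed.

(** Two bounds with separate purposes: the constant 8 is the dominating bound, while the second
    tends to 0 with |t - t0| at each fixed frequency although it grows with the frequency. *)
Lemma bracket_Bhat_phase_diff t t0 xi k : 0 <= t <= 1 -> 0 <= t0 <= 1 ->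
  bracket (k + xi ^+ 5) * normc (Bhat (phase_diff t t0) xi k) <= 8 /\
  bracket (k + xi ^+ 5) * normc (Bhat (phase_diff t t0) xi k) <=
    `|t - t0| * (bracket (k + xi ^+ 5) * (2 * `|xi ^+ 5| + 1)).
Proof.
move=> t01 t001; have /andP[tg tl] := t01; have /andP[t0g t0l] := t001.
have b0 := bracket_gt0 (k + xi ^+ 5).
rewrite Bhat_phase_diff//; split.
  apply: (@le_trans _ _ (bracket (k + xi ^+ 5) * (normc (Bhat (phase t) xi k) + normc (Bhat (phase t0) xi k)))).
    apply: ler_wpM2l; first exact: ltW.
    by apply: le_trans (normcD _ _) _; rewrite normcN.
  have := bracket_Bhat_phase xi k t01; have := bracket_Bhat_phase xi k t001; rewrite mulrDr; lra.
rewrite mulrCA ler_wpM2l ?(ltW b0)//.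
rewrite !Bhat_phase; set E := phase_int t _; set E0 := phase_int t0 _.
have -> : cis (- (t * xi ^+ 5)) * E - cis (- (t0 * xi ^+ 5)) * E0 =
    (cis (- (t * xi ^+ 5)) - cis (- (t0 * xi ^+ 5))) * E + cis (- (t0 * xi ^+ 5)) * (E - E0) by ring.
apply: le_trans (normcD _ _) _; rewrite !ComplexField.Normc.normcM normc_cis mul1r mulrDr mulr1.
apply: lerD; last exact: phase_int_lip.
have E1 : normc E <= 1 by apply: le_trans tl; exact: normc_phase_int.
apply: le_trans (ler_piMr (normc_ge0 _) E1) _.
apply: le_trans (normc_cis_sub _ _) _.
rewrite (_ : - (t * xi ^+ 5) - - (t0 * xi ^+ 5) = - ((t - t0) * xi ^+ 5)); last by ring.
by rewrite normrN normrM mulrCA.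
Qed.

End DuhamelKernel.

(** * Schwartz functions on the line *)

Section SchwartzLine.
Context {R : realType}.
Local Notation mu := (@lebesgue_measure R).
Local Notation schwartzR1 := (@schwartzR R R^o).
Local Notation itD := (@iter_derive R R^o).
Implicit Types (f : R -> R) (phi chi : R -> R[i]).

Lemma schwartzR_iter f vs : schwartzR1 f -> schwartzR1 (itD vs f).
Proof.
have e us : itD us (itD vs f) = itD (us ++ vs) f by rewrite /iter_derive foldr_cat.
move=> [sm dec]; split; first by move=> us; rewrite e; exact: sm.
by move=> k us; rewrite e; exact: dec.
Qed.

Lemma schwartzR_is_derive f (x : R) : schwartzR1 f -> is_derive x 1 f ('D_1 (f : R^o -> R) x).
Proof. by move=> [sm _]; split => //; have [_ +] := sm [::]; exact. Qed.

Lemma schwartzR_continuous f : schwartzR1 f -> continuous f.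
Proof. by move=> [sm _]; have [+ _] := sm [::]. Qed.

Lemma schwartzR_bound f (k : nat) : schwartzR1 f ->
  exists2 M, 0 <= M & forall x : R, (1 + `|x|) ^+ k * `|f x| <= M.
Proof.
move=> [_ dec]; have [M1 h1] := dec 0%N [::]; have [M2 h2] := dec k [::].
have M10 : 0 <= M1 by apply: le_trans (h1 0); rewrite mulr_ge0.
have M20 : 0 <= M2 by apply: le_trans (h2 0); rewrite mulr_ge0.
exists (2 ^+ k * (M1 + M2)); first by rewrite mulr_ge0 ?addr_ge0.
move=> x; have {}h1 := h1 x; have {}h2 := h2 x; rewrite /= expr0 mul1r in h1.
have f0 : 0 <= `|f x| by [].
have [x1|x1] := leP `|x| 1.
  apply: ler_pM => //.
    by rewrite lerXn2r ?nnegrE ?addr_ge0//; lra.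
  by apply: le_trans h1 _; rewrite lerDl.
apply: (@le_trans _ _ ((2 * `|x|) ^+ k * `|f x|)).
  by rewrite ler_wpM2r// lerXn2r ?nnegrE ?addr_ge0 ?mulr_ge0//; lra.
rewrite exprMn -mulrA ler_wpM2l ?exprn_ge0//.
by apply: le_trans h2 _; rewrite lerDr.
Qed.

Definition dx phi : R -> R[i] := fun x =>
  'D_1 ((fun y => Re (phi y)) : R^o -> R) x +i* 'D_1 ((fun y => Im (phi y)) : R^o -> R) x.

Lemma schwartz_dx phi : schwartz1 phi -> schwartz1 (dx phi).
Proof.
by move=> [hr hi]; split; [exact: (@schwartzR_iter _ [:: 1] hr)|exact: (@schwartzR_iter _ [:: 1] hi)].
Qed.

Lemma schwartz1_ccontinuous phi : schwartz1 phi -> ccontinuous phi.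
Proof. by move=> [hr hi]; split; exact: schwartzR_continuous. Qed.

Lemma schwartz1_bound phi (k : nat) : schwartz1 phi ->
  exists2 M, 0 <= M & forall x, (1 + `|x|) ^+ k * normc (phi x) <= M.
Proof.
move=> [hr hi]; have [M1 M10 h1] := schwartzR_bound k hr; have [M2 M20 h2] := schwartzR_bound k hi.
exists (M1 + M2); first exact: addr_ge0.
move=> x; apply: le_trans (ler_wpM2l _ (normc_le _)) _; first by rewrite exprn_ge0 ?addr_ge0.
by rewrite mulrDr; apply: lerD; [exact: h1|exact: h2].
Qed.

Definition tail2 (x : R) : R := bracket x `^ (- 2).

Lemma integrable_tail2 : mu.-integrable setT (EFin \o tail2).
Proof.
apply: integrable_lty.
- by apply: measurable_fun_powR; exact: measurable_fun_bracket.
- by move=> x; exact: powR_ge0.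
- have [C _ /(_ 0 0)] := @integral_bracket2 R 0 (lexx 0) ltr01.
  move=> h; apply: le_lt_trans _ (le_lt_trans h (ltry _)).
  by apply: ge0_le_integral_nm => x; rewrite lee_fin ?powR_ge0// oppr0 powRr0 mul1r addr0.
Qed.

Definition tail2_mass : R := Rintegral mu setT tail2.

Lemma tail2E x : tail2 x = (bracket x ^+ 2)^-1.
Proof. by rewrite /tail2 powRN powR_mulrn// ltW// bracket_gt0. Qed.

Lemma le_tail2 (y M : R) x : (1 + `|x|) ^+ 2 * y <= M -> y <= M * tail2 x.
Proof. by move=> h; rewrite tail2E ler_pdivlMr ?exprn_gt0 ?bracket_gt0// mulrC. Qed.

Lemma decay_cintegrable phi (M : R) : cmeasurable phi ->
  (forall x, (1 + `|x|) ^+ 2 * normc (phi x) <= M) -> cintegrable mu phi.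
Proof.
move=> mp h; apply: (@le_cintegrable _ _ _ mu _ (fun x => M * tail2 x)) => //.
  by apply: integrableZR; exact: integrable_tail2.
by move=> x; apply: le_tail2.
Qed.

Lemma schwartz1_cintegrable phi : schwartz1 phi -> cintegrable mu phi.
Proof.
move=> sp; have [M M0 h] := schwartz1_bound 2 sp.
by apply: (decay_cintegrable _ h); apply: ccontinuous_measurable; exact: schwartz1_ccontinuous.
Qed.

(** Unnormalized transform with the positive sign; [fourier1] is its reflection and [inv_fourier1] a
    multiple of it, so the decay estimates are proved once. *)
Definition ftrans phi (x : R) : R[i] := cintegral mu setT (fun y => cis (x * y) * phi y).

Let mcis (x : R) : cmeasurable (fun y : R => cis (x * y)).
Proof. by apply: cmeasurable_cis; exact: measurable_funM. Qed.

Lemma ftrans_integrand phi (x : R) : cintegrable mu phi -> cintegrable mu (fun y => cis (x * y) * phi y).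
Proof. by move=> ip; apply: (cintegrableM ip (mcis x) (B := 1)) => y; rewrite normc_cis. Qed.

Lemma normc_ftrans phi (x : R) : cintegrable mu phi ->
  normc (ftrans phi x) <= Rintegral mu setT (fun y => normc (phi y)).
Proof.
move=> ip; apply: normc_cintegral_le.
- exact: (cintegrable_measurable (ftrans_integrand x ip)).
- exact: cintegrable_norm.
- by move=> y; rewrite ComplexField.Normc.normcM normc_cis mul1r.
Qed.

Let is_derive_cosM (x y : R) : is_derive y 1 (fun y : R => cos (x * y)) (- x * sin (x * y)).
Proof. by apply: is_derive_eq; rewrite /GRing.scale/= !(mulr1, mulr0, addr0, add0r); ring. Qed.

Let is_derive_sinM (x y : R) : is_derive y 1 (fun y : R => sin (x * y)) (x * cos (x * y)).
Proof. by apply: is_derive_eq; rewrite /GRing.scale/= !(mulr1, mulr0, addr0, add0r); ring. Qed.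

(** Real form of the rule that the transform of the derivative is - i x times the transform. The
    pair (p, q) = (Re, Im) at [x] gives the real part, and (Im, Re) at [- x] the imaginary part. *)
Let parts (x : R) (p q : R -> R) : schwartzR1 p -> schwartzR1 q ->
  Rintegral mu setT (fun y => cos (x * y) * 'D_1 (p : R^o -> R) y - sin (x * y) * 'D_1 (q : R^o -> R) y) =
  x * Rintegral mu setT (fun y => sin (x * y) * p y + cos (x * y) * q y).
Proof.
move=> sp sq.
have cp := schwartzR_continuous sp; have cq := schwartzR_continuous sq.
have sp' := schwartzR_iter [:: 1] sp; have sq' := schwartzR_iter [:: 1] sq.
have cp' := schwartzR_continuous sp'; have cq' := schwartzR_continuous sq'.
have cw : continuous (fun y : R => x * y) by move=> y; apply: cvgM; [exact: cvg_cst|exact: cvg_id].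
have cc : continuous (fun y : R => cos (x * y)) by move=> y; exact: (continuous_comp (cw y) (@continuous_cos R _)).
have cs : continuous (fun y : R => sin (x * y)) by move=> y; exact: (continuous_comp (cw y) (@continuous_sin R _)).
have bc (y : R) : `|cos (x * y)| <= 1 by rewrite ler_norml cos_geN1 cos_le1.
have bs (y : R) : `|sin (x * y)| <= 1 by rewrite ler_norml sin_geN1 sin_le1.
have ii (r f : R -> R) : continuous r -> (forall y, `|r y| <= 1) -> schwartzR1 f ->
    mu.-integrable setT (EFin \o (fun y => r y * f y)).
  move=> cr rb sf; have [M M0 h] := schwartzR_bound 2 sf.
  apply: (@le_integrableR _ _ _ mu _ (fun y => M * tail2 y)).
  - by apply: measurable_funM; apply: continuous_measurable_fun => //; exact: schwartzR_continuous.
  - by apply: integrableZR; exact: integrable_tail2.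
  - move=> y; rewrite normrM; apply: le_trans (le_tail2 (h y)).
    by rewrite ler_piMl.
have iN f : mu.-integrable setT (EFin \o f) -> mu.-integrable setT (EFin \o (fun y => - f y)).
  by move=> fi; have := integrableZR (-1) fi; under eq_fun do rewrite mulN1r.
have i1 : mu.-integrable setT (EFin \o (fun y => cos (x * y) * 'D_1 (p : R^o -> R) y - sin (x * y) * 'D_1 (q : R^o -> R) y)).
  by apply: integrableDR; [exact: (ii _ _ cc bc sp')|apply: iN; exact: (ii _ _ cs bs sq')].
have i2 : mu.-integrable setT (EFin \o (fun y => sin (x * y) * p y + cos (x * y) * q y)).
  by apply: integrableDR; [exact: (ii _ _ cs bs sp)|exact: (ii _ _ cc bc sq)].
rewrite -RintegralZl//; apply/eqP; rewrite -subr_eq0; apply/eqP.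
rewrite -RintegralB//; last exact: integrableZR.
have [M1 M10 h1] := schwartzR_bound 1 sp; have [M2 M20 h2] := schwartzR_bound 1 sq.
apply: (@Rintegral_line _ _ (fun y => cos (x * y) * p y - sin (x * y) * q y) (M1 + M2)).
- move=> y; apply: cvgB; first by apply: cvgB; apply: cvgM; [exact: cc|exact: cp'|exact: cs|exact: cq'].
  apply: cvgM; first exact: cvg_cst.
  by apply: cvgD; apply: cvgM; [exact: cs|exact: cp|exact: cc|exact: cq].
- rewrite /comp; under eq_fun do rewrite EFinB.
  by apply: integrableB => //; exact: integrableZR.
- move=> y; have d1 := schwartzR_is_derive y sp; have d2 := schwartzR_is_derive y sq.
  apply: is_derive_eq; rewrite /GRing.scale/=; ring.
- move=> y; rewrite mulrC.
  apply: (@le_trans _ _ ((1 + `|y|) * (`|p y| + `|q y|))).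
    rewrite ler_wpM2l ?addr_ge0//; apply: le_trans (ler_normB _ _) _.
    by rewrite !normrM; apply: lerD; rewrite ler_piMl.
  by rewrite mulrDr; have := h1 y; have := h2 y; rewrite !expr1; lra.
Qed.

Lemma normc_ftrans_dx phi (x : R) : schwartz1 phi ->
  normc (ftrans (dx phi) x) = `|x| * normc (ftrans phi x).
Proof.
move=> [sr si]; have h1 := parts x sr si; have h2 := parts (- x) si sr.
have e1 : Re (ftrans (dx phi) x) = x * Im (ftrans phi x).
  transitivity (x * Rintegral mu setT (fun y => sin (x * y) * Re (phi y) + cos (x * y) * Im (phi y))).
    by rewrite -h1.
  by congr (x * _); apply: eq_Rintegral => y _ /=; case: (phi y) => p q /=; ring.
have e2 : Im (ftrans (dx phi) x) = - x * Re (ftrans phi x).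
  transitivity (- x * Rintegral mu setT (fun y => sin (- x * y) * Im (phi y) + cos (- x * y) * Re (phi y))).
    by rewrite -h2; apply: eq_Rintegral => y _ /=; rewrite mulNr cosN sinN; ring.
  by congr (- x * _); apply: eq_Rintegral => y _ /=; case: (phi y) => p q /=; rewrite mulNr cosN sinN; ring.
apply/eqP; rewrite -(@eqrXn2 _ 2%N) ?mulr_ge0 ?normc_ge0//; apply/eqP.
by rewrite exprMn !sqr_normc e1 e2 real_normK ?num_real//; ring.
Qed.

(** Three powers are wanted: one pays for the derivative in the nonlinearity, the other two leave
    the integrable majorant [tail2]. The third derivative provides |x|^3, and (1 + |x|)^3 <= 4 (1 +
    |x|^3). *)
Lemma ftrans_decay phi (x : R) : schwartz1 phi ->
  (1 + `|x|) ^+ 3 * normc (ftrans phi x) <=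
  4 * (Rintegral mu setT (fun y => normc (phi y)) +
       Rintegral mu setT (fun y => normc (dx (dx (dx phi)) y))).
Proof.
move=> s0; have s1 := schwartz_dx s0; have s2 := schwartz_dx s1; have s3 := schwartz_dx s2.
have n0 := normc_ftrans x (schwartz1_cintegrable s0).
have n3 := normc_ftrans x (schwartz1_cintegrable s3).
rewrite !normc_ftrans_dx// in n3.
have := normr_ge0 x; have := normc_ge0 (ftrans phi x).
move: (normc (ftrans phi x)) `|x| n0 n3 => f a n0 n3 f0 a0.
have : (1 + a) ^+ 3 <= 4 * (1 + a * (a * a)).
  rewrite -subr_ge0 (_ : _ - _ = 3 * (1 + a) * (1 - a) ^+ 2); last by ring.
  by rewrite mulr_ge0 ?sqr_ge0// mulr_ge0// addr_ge0.
move=> h; apply: le_trans (ler_wpM2r f0 h) _; rewrite -mulrA ler_wpM2l// mulrDl mul1r -!mulrA; exact: lerD.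
Qed.

(* The constant is explicit because it enters the continuity estimate of a
   tempered distribution. *)
Lemma ftrans_seminorm phi (M : R) : schwartz1 phi ->
  (forall vs (x : R), vs \in [:: [::]; [:: 1; 1; 1]] ->
     (1 + `|x|) ^+ 2 * `|itD vs (fun y => Re (phi y)) x| <= M /\
     (1 + `|x|) ^+ 2 * `|itD vs (fun y => Im (phi y)) x| <= M) ->
  forall x, (1 + `|x|) ^+ 3 * normc (ftrans phi x) <= 16 * tail2_mass * M.
Proof.
move=> sp hM x; apply: le_trans (ftrans_decay x sp) _.
have bnd psi : schwartz1 psi -> (forall y : R, (1 + `|y|) ^+ 2 * `|Re (psi y)| <= M /\
    (1 + `|y|) ^+ 2 * `|Im (psi y)| <= M) ->
    Rintegral mu setT (fun y => normc (psi y)) <= 2 * M * tail2_mass.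
  move=> spsi h; rewrite -RintegralZl//; last exact: integrable_tail2.
  apply: le_Rintegral => //; first exact: cintegrable_norm (schwartz1_cintegrable spsi).
    by apply: integrableZR; exact: integrable_tail2.
  move=> y _; apply: le_tail2; have [h1 h2] := h y.
  have c0 : 0 <= (1 + `|y|) ^+ 2 by rewrite exprn_ge0 ?addr_ge0.
  apply: le_trans (ler_wpM2l c0 (normc_le _)) _; rewrite mulrDr mulr_natl mulr2n; exact: lerD.
have b0 := bnd phi sp (fun y => hM [::] y (mem_head _ _)).
have m3 : ([:: 1; 1; 1] : seq R) \in ([:: [::]; [:: 1; 1; 1]] : seq (seq R)) by rewrite !inE eqxx orbT.
have b3 := bnd _ (schwartz_dx (schwartz_dx (schwartz_dx sp))) (fun y => hM _ y m3).
lra.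
Qed.

Lemma ftrans_bound phi : schwartz1 phi ->
  exists2 M, 0 <= M & forall x, (1 + `|x|) ^+ 3 * normc (ftrans phi x) <= M.
Proof.
move=> sp; exists (4 * (Rintegral mu setT (fun y => normc (phi y)) +
  Rintegral mu setT (fun y => normc (dx (dx (dx phi)) y)))).
  by rewrite mulr_ge0// addr_ge0//; apply: Rintegral_ge0 => y _; exact: normc_ge0.
by move=> x; exact: ftrans_decay.
Qed.

Lemma fourier1E phi (x : R) : fourier1 phi x = ftrans phi (- x).
Proof. by congr cintegral; apply/funext => y; rewrite mulNr (mulrC x). Qed.

Lemma inv_fourier1E phi (x : R) : inv_fourier1 phi x = ((2 * pi)^-1)%:C * ftrans phi x.
Proof. by []. Qed.

Lemma ccontinuous_ftrans phi : cintegrable mu phi -> ccontinuous (ftrans phi).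
Proof.
move=> ip; apply: (@ccontinuous_cintegral _ _ _ mu _ (fun y => normc (phi y))).
- by move=> x; exact: (cintegrable_measurable (ftrans_integrand x ip)).
- exact: cintegrable_norm.
- by move=> x y; rewrite ComplexField.Normc.normcM normc_cis mul1r.
- move=> y; apply: ccontinuousM; last exact: (ccontinuous_cst (phi y)).
  by apply: ccontinuous_cis => x; apply: cvgM; [exact: cvg_id|exact: cvg_cst].
Qed.

(** The inversion integral damped by [gaus (epsn n)] equals 2 pi times a Gaussian mean of [chi]
    around [x]. It converges to the undamped integral by domination and to 2 pi [chi x] by
    continuity. *)
Lemma fourier1K chi (x : R) : schwartz1 chi -> inv_fourier1 (fourier1 chi) x = chi x.
Proof.
move=> sc; have ic := schwartz1_cintegrable sc.
have pi20 : 2 * pi != 0 :> R by rewrite mulf_neq0// gt_eqF// pi_gt0.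
have mF : cmeasurable (fourier1 chi).
  have [cr ci] := ccontinuous_measurable (ccontinuous_ftrans ic).
  have e : fourier1 chi = (fun y => ftrans chi (- y)) by apply/funext => y; rewrite fourier1E.
  by rewrite e; split; [exact: (measurableT_comp cr (@measurable_negR R))|exact: (measurableT_comp ci (@measurable_negR R))].
have iF : cintegrable mu (fourier1 chi).
  have [M M0 hM] := ftrans_bound sc.
  apply: (decay_cintegrable mF (M := M)) => y; rewrite fourier1E; apply: le_trans (hM (- y)).
  by rewrite normrN ler_wpM2r ?normc_ge0// ler_weXn2l// lerDl.
rewrite inv_fourier1E.
suff -> : ftrans (fourier1 chi) x = (2 * pi)%:C * chi x.
  by rewrite mulrA -rmorphM mulVf// mul1r.
apply: (@ccvg_unique _ (fun n => cintegral mu setT (fun xi =>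
  (cis (x * xi) * (gaus (epsn n) xi)%:C) * fourier1 chi xi))).
- apply: (@cintegral_cvg _ _ _ mu _ _ (fun xi => normc (fourier1 chi xi))).
  + by move=> n; exact: (cmeasurableM (cmeasurableM (mcis x) (cmeasurable_real (measurable_gaus _))) mF).
  + exact: (cmeasurableM (mcis x) mF).
  + exact: cintegrable_norm.
  + move=> n xi; rewrite !ComplexField.Normc.normcM normc_cis mul1r normc_real (ger0_norm (gaus_ge0 _ _)).
    by rewrite ler_piMl ?normc_ge0// gaus_le1.
  + move=> xi; apply: ccvgM; last exact: ccvg_cst.
    have e : cis (x * xi) = cis (x * xi) * 1%:C by rewrite mulr1.
    by rewrite {2}e; apply: ccvgM; [exact: ccvg_cst|apply: ccvg_real; exact: cvg_gaus1].
- rewrite (_ : (fun n => _) = (fun n => (2 * pi)%:C *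
    cintegral mu setT (fun y => chi y * (normal_pdf x (epsn n) y)%:C))); last first.
    apply/funext => n.
    have mk : cmeasurable (fun z : R * R => cis (- (z.2 * z.1))).
      apply: cmeasurable_cis; apply: measurableT_comp => //.
      exact: (measurable_funM measurable_snd measurable_fst).
    rewrite (@cintegral_swapM _ _ _ _ R mu mu _ chi (fun z => cis (- (z.2 * z.1))) 1
      (integrable_cis_gaus x (epsn_neq0 n)) ic mk (fun z => eq_ler (normc_cis _))).
    rewrite -cintegralZ.
      congr cintegral; apply/funext => y; rewrite mulrCA; congr (_ * _).
      transitivity ((2 * pi * normal_pdf x (epsn n) y)%:C); last by rewrite rmorphM.
      rewrite -integral_cis_gaus_pdf ?epsn_gt0//; congr cintegral; apply/funext => xi /=.
      rewrite mulrA -cisD; congr (cis _ * _); ring.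
    have [B B0 hB] := schwartz1_bound 0 sc.
    apply: (cintegrableM (cintegrable_real (integrable_normal_pdf _ _)) _ (B := B)).
      by apply: ccontinuous_measurable; exact: schwartz1_ccontinuous.
    by move=> y; have := hB y; rewrite expr0 mul1r.
  apply: ccvgM; first exact: ccvg_cst.
  have [B B0 hB] := schwartz1_bound 0 sc.
  apply: (@gauss_ccontinuous _ _ B); first exact: schwartz1_ccontinuous.
  by move=> y; have := hB y; rewrite expr0 mul1r.
Qed.

End SchwartzLine.

(** * The Duhamel term tested against a function *)

Section DuhamelFormula.
Context {R : realType}.
Local Notation mu := (@lebesgue_measure R).
Local Notation mu2 := (mu \x mu)%E.
Implicit Types (theta kappa : R -> R[i]).

Let tail2_le (x y M : R) : 0 <= y -> (1 + `|x|) ^+ 3 * y <= M ->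
  y <= M * tail2 x /\ `|x| * y <= M * tail2 x.
Proof.
move=> y0 h; have a0 := normr_ge0 x; have c0 : 0 <= (1 + `|x|) ^+ 2 by rewrite exprn_ge0 ?addr_ge0.
split; apply: le_tail2; apply: le_trans h.
  by rewrite ler_wpM2r// ler_weXn2l// lerDl.
by rewrite [in leRHS]exprSr -[leRHS]mulrA ler_wpM2l// ler_wpM2r// lerDr.
Qed.

Lemma D_trig_integral (p q : R -> R) (M a : R) :
  measurable_fun setT p -> measurable_fun setT q ->
  (forall x : R, `|p x| + `|q x| <= M * tail2 x) ->
  (forall x : R, `|x| * (`|p x| + `|q x|) <= M * tail2 x) ->
  'D_1 ((fun y => Rintegral mu setT (fun x => cos (x * y) * p x + sin (x * y) * q x)) : R^o -> R) a =
  Rintegral mu setT (fun x => x * (cos (x * a) * q x - sin (x * a) * p x)).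
Proof.
move=> mp mq h1 h2; rewrite -derive1E.
pose f (y x : R) : R := cos (x * y) * p x + sin (x * y) * q x.
have iM : mu.-integrable setT (EFin \o (fun x => M * tail2 x)) by apply: integrableZR; exact: integrable_tail2.
have bc (y : R) : `|cos y| <= 1 by rewrite ler_norml cos_geN1 cos_le1.
have bs (y : R) : `|sin y| <= 1 by rewrite ler_norml sin_geN1 sin_le1.
have df (y x : R) : is_derive y 1 (f ^~ x) (x * (cos (x * y) * q x - sin (x * y) * p x)).
  by apply: is_derive_eq; rewrite /GRing.scale/= !(mulr1, mulr0, addr0, add0r); ring.
have pE (y x : R) : partial1of2 f y x = x * (cos (x * y) * q x - sin (x * y) * p x).
  by rewrite /partial1of2 derive1E; have [_ ->] := df y x.
have mcos (y : R) : measurable_fun setT (fun x : R => cos (x * y)).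
  apply: (measurableT_comp (f := @cos R)) => //; last exact: measurable_funM.
  by apply: continuous_measurable_fun; exact: continuous_cos.
have msin (y : R) : measurable_fun setT (fun x : R => sin (x * y)).
  apply: (measurableT_comp (f := @sin R)) => //; last exact: measurable_funM.
  by apply: continuous_measurable_fun; exact: continuous_sin.
have fle (y x : R) : `|f y x| <= M * tail2 x.
  apply: le_trans (h1 x); apply: le_trans (ler_normD _ _) _; rewrite !normrM.
  by apply: lerD; rewrite ler_piMl.
have mf y : measurable_fun setT (f y) by apply: measurable_funD; apply: measurable_funM.
have := @differentiation_under_integral R _ _ mu f setT measurableT a (a - 1) (a + 1) _ _ _ (fun x => M * tail2 x) _ iM.
move=> ->.
- by apply: eq_Rintegral => x _; rewrite pE.
- by rewrite /= in_itv/= ltrBlDr ltrDl ltr01.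
- by move=> y _; apply: (@le_integrableR _ _ _ mu _ _ (mf y) iM); exact: fle.
- by move=> y x _ _; have [+ _] := df y x.
- by move=> x; exact: le_trans (fle 0 x).
- move=> y x _ _; rewrite pE normrM; apply: le_trans (h2 x); rewrite ler_wpM2l//.
  apply: le_trans (ler_normB _ _) _; rewrite !normrM addrC.
  by apply: lerD; rewrite ler_piMl.
Qed.

Lemma dx_fourier1 kappa (M x : R) : cmeasurable kappa ->
  (forall xi, (1 + `|xi|) ^+ 3 * normc (kappa xi) <= M) ->
  dx (fourier1 kappa) x = cintegral mu setT (fun xi => cis (- (xi * x)) * ((0 +i* (- xi)) * kappa xi)).
Proof.
move=> [mr mi] dec.
have b2 xi : `|Re (kappa xi)| + `|Im (kappa xi)| <= (2 * M) * tail2 xi /\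
    `|xi| * (`|Re (kappa xi)| + `|Im (kappa xi)|) <= (2 * M) * tail2 xi.
  have [k1 k2] := tail2_le (normc_ge0 (kappa xi)) (dec xi).
  have := normc_Re (kappa xi); have := normc_Im (kappa xi) => e1 e2.
  have e : `|Re (kappa xi)| + `|Im (kappa xi)| <= 2 * normc (kappa xi) by rewrite mulr_natl mulr2n addrC lerD.
  split; rewrite -mulrA.
    by apply: le_trans e _; rewrite ler_wpM2l.
  apply: (@le_trans _ _ (`|xi| * (2 * normc (kappa xi)))); first by rewrite ler_wpM2l.
  by rewrite mulrCA ler_wpM2l.
have b3 xi : `|Im (kappa xi)| + `|- Re (kappa xi)| = `|Re (kappa xi)| + `|Im (kappa xi)|.
  by rewrite normrN addrC.
have dr := @D_trig_integral _ _ (2 * M) x mr mi (fun xi => (b2 xi).1) (fun xi => (b2 xi).2).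
have di := @D_trig_integral _ (fun xi => - Re (kappa xi)) (2 * M) x mi (measurableT_comp (@measurable_negR R) mr).
apply: complex_eq => /=.
- rewrite (_ : (fun y => _) = (fun y => Rintegral mu setT
    (fun xi => cos (xi * y) * Re (kappa xi) + sin (xi * y) * Im (kappa xi)))); last first.
    apply/funext => y; apply: eq_Rintegral => xi _ /=; case: (kappa xi) => p q /=.
    by rewrite cosN sinN; ring.
  rewrite dr; apply: eq_Rintegral => xi _ /=; case: (kappa xi) => p q /=.
  by rewrite cosN sinN; ring.
- rewrite (_ : (fun y => _) = (fun y => Rintegral mu setT
    (fun xi => cos (xi * y) * Im (kappa xi) + sin (xi * y) * - Re (kappa xi)))); last first.
    apply/funext => y; apply: eq_Rintegral => xi _ /=; case: (kappa xi) => p q /=.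
    by rewrite cosN sinN; ring.
  rewrite di; last 2 first.
  + by move=> xi; rewrite b3; exact: (b2 xi).1.
  + by move=> xi; rewrite b3; exact: (b2 xi).2.
  apply: eq_Rintegral => xi _ /=; case: (kappa xi) => p q /=.
  by rewrite cosN sinN; ring.
Qed.

Lemma cintegral_ind (f : R -> R[i]) (t : R) :
  cintegral mu `[0, t] f = cintegral mu setT (fun x => f x * (\1_(`[0, t]%classic : set R) x : R)%:C).
Proof.
apply: complex_eq => /=.
- rewrite /Rintegral -integral_indicR; congr fine; apply: eq_integral => x _.
  by case: (f x) => p q /=; congr (_%:E); ring.
- rewrite /Rintegral -integral_indicR; congr fine; apply: eq_integral => x _.
  by case: (f x) => p q /=; congr (_%:E); ring.
Qed.

Variable u : R * R -> R[i].
Hypothesis iu2 : cintegrable mu2 (fun y => u y ^+ 2).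

Definition duhamel_density (Bt : R * R -> R[i]) (xi : R) : R[i] :=
  (0 +i* (- (xi / 2))) * pairing (fun y => u y ^+ 2) Bt xi.

(** Each operator is moved to the test function by duality. The minus sign of [Dx] cancels that of
    [nonlin], leaving 1/2 and the derivative on the character. *)
Lemma W_nonlin (tau t' M : R) phi : cmeasurable (inv_fourier1 phi) ->
  (forall xi, (1 + `|xi|) ^+ 3 * normc (inv_fourier1 phi xi) <= M) ->
  W tau (nonlin u t') phi = 2^-1 * cintegral mu setT (fun x => u (x, t') ^+ 2 *
    cintegral mu setT (fun xi => cis (- (xi * x)) * ((0 +i* (- xi)) *
      (cis (- (tau * xi ^+ 5)) * inv_fourier1 phi xi)))).
Proof.
move=> mth dec.
have mk : cmeasurable (fun xi : R => cis (- (tau * xi ^+ 5)) * inv_fourier1 phi xi).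
  apply: cmeasurableM => //; apply: cmeasurable_cis; apply: measurableT_comp => //.
  by apply: measurable_funM => //; exact: measurable_cst.
rewrite /W /inv_fourier_dist1 /mul_dist /fourier_dist1 /nonlin /Dx /dist1_of /dist_of mulrNN.
congr (_ * _); congr cintegral; apply/funext => x; congr (_ * _).
rewrite -(dx_fourier1 x mk (M := M))// => xi.
by rewrite ComplexField.Normc.normcM normc_cis mul1r.
Qed.

(** Everything is asked of [inv_fourier1 phi] rather than of [phi]. The formula thus applies to
    [fourier1 phi] for Schwartz [phi], by inversion, without showing that the transform of a
    Schwartz function is Schwartz. *)
Lemma duhamel_pairing (t M : R) phi : 0 <= t <= 1 -> cmeasurable (inv_fourier1 phi) ->
  (forall xi, (1 + `|xi|) ^+ 3 * normc (inv_fourier1 phi xi) <= M) ->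
  duhamel (nonlin u) t phi =
  cintegral mu setT (fun xi => inv_fourier1 phi xi * duhamel_density (phase t) xi).
Proof.
move=> /andP[t0 t1] mth dec; set th := inv_fourier1 phi.
pose rho (xi : R) : R[i] := (0 +i* (- xi)) * th xi.
have mI : cmeasurable (fun xi : R => (0 +i* (- xi)) : R[i]).
  by split => /=; [exact: measurable_cst|exact: measurable_negR].
have irho : cintegrable mu rho.
  apply: (@le_cintegrable _ _ _ mu _ (fun x => M * tail2 x)).
  - exact: (cmeasurableM mI mth).
  - by apply: integrableZR; exact: integrable_tail2.
  - move=> xi; rewrite ComplexField.Normc.normcM normcE/= expr0n/= add0r sqrrN sqrtr_sqr.
    by have [] := tail2_le (normc_ge0 (th xi)) (dec xi).
pose k (z : (R * R) * R) : R[i] := cis (- (z.1.1 * z.2)) * phase t (z.1.2, z.2).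
have m1 : measurable_fun setT (fun z : (R * R) * R => z.1.1) by exact: (measurableT_comp measurable_fst measurable_fst).
have m2 : measurable_fun setT (fun z : (R * R) * R => z.1.2) by exact: (measurableT_comp measurable_snd measurable_fst).
have mk : cmeasurable k.
  apply: cmeasurableM.
    apply: cmeasurable_cis; apply: measurableT_comp => //; exact: (measurable_funM m1 measurable_snd).
  have mz := measurable_fun_pair m2 (measurable_snd : measurable_fun setT (fun z : (R * R) * R => z.2)).
  have [p1 p2] := cmeasurable_phase t.
  by split; [exact: (measurableT_comp p1 mz)|exact: (measurableT_comp p2 mz)].
have kb z : normc (k z) <= 1.
  rewrite ComplexField.Normc.normcM normc_cis mul1r; apply: le_trans (normc_phase _ _ t1) _.
  by have /andP[] := ind_bound 1 z.1.2.
(* The space-time function against which [u^2] is integrated. The time cutoff sits inside [phase],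
   and [Phi] is bounded, so integrability of [u^2] justifies the exchanges that follow. *)
pose Phi (y : R * R) : R[i] := cintegral mu setT (fun xi => k (y, xi) * rho xi).
have mPhi : cmeasurable Phi.
  have h : cmeasurable (fun z : (R * R) * R => k z * rho z.2).
    have [r1 r2] := cintegrable_measurable irho.
    apply: cmeasurableM => //.
    by split; [exact: (measurableT_comp r1 measurable_snd)|exact: (measurableT_comp r2 measurable_snd)].
  exact: (cmeasurable_cintegral2 mu h).
have mky y : cmeasurable (fun xi => k (y, xi)).
  by split; [exact: (measurableT_comp mk.1 (measurable_pair1 y))|exact: (measurableT_comp mk.2 (measurable_pair1 y))].
have Phib y : normc (Phi y) <= Rintegral mu setT (fun xi => normc (rho xi)).
  apply: normc_cintegral_le; [exact: (cmeasurableM (mky y) (cintegrable_measurable irho))|exact: cintegrable_norm|].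
  by move=> xi; rewrite ComplexField.Normc.normcM ler_piMl ?normc_ge0.
have iuP : cintegrable mu2 (fun y => u y ^+ 2 * Phi y).
  by have := cintegrableM iu2 mPhi Phib; under eq_fun do rewrite mulrC.
rewrite /duhamel /cintegral_from0 t0 cintegral_ind.
transitivity (cintegral mu setT (fun t' => 2^-1 * cintegral mu setT (fun x => u (x, t') ^+ 2 * Phi (x, t')))).
  congr cintegral; apply/funext => t'; rewrite (W_nonlin (t - t') t' mth dec) -mulrA; congr (_ * _).
  pose h (x xi : R) := cis (- (xi * x)) * ((0 +i* (- xi)) * (cis (- ((t - t') * xi ^+ 5)) * th xi)) : R[i].
  have ih x : cintegrable mu (h x).
    have mh : cmeasurable (fun xi : R => cis (- (xi * x)) * cis (- ((t - t') * xi ^+ 5))).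
      apply: cmeasurableM; apply: cmeasurable_cis; apply: measurableT_comp => //.
        by apply: measurable_funM => //; exact: measurable_cst.
      by apply: measurable_funM; [exact: measurable_cst|exact: measurable_funX].
    have := cintegrableM irho mh (B := 1) _.
    rewrite (_ : (fun xi => _ * rho xi) = h x); last by apply/funext => xi; rewrite /h /rho; ring.
    by apply=> xi; rewrite ComplexField.Normc.normcM !normc_cis mulr1.
  have PhiE x : Phi (x, t') = (\1_(`[0, t]%classic : set R) t' : R)%:C * cintegral mu setT (h x).
    rewrite -cintegralZ; last exact: ih.
    congr cintegral; apply/funext => xi; rewrite /k /phase /rho /h/= (mulrC x); ring.
  under [in RHS]eq_fun do rewrite PhiE.
  rewrite indicE; case: (t' \in _) => /=.
    by rewrite mulr1; congr cintegral; apply/funext => x; rewrite mul1r.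
  rewrite mulr0; apply: complex_eq => /=; rewrite /Rintegral integral0_eq// => x _; rewrite mul0r mulr0//.
rewrite cintegralZ; last exact: (cintegrable_cintegral2 iuP).
rewrite -(cintegral_Fubini2 iuP).
transitivity (2^-1 * cintegral (sigma_prod mu mu) setT (fun y => u y ^+ 2 * Phi y)); first by [].
rewrite (@cintegral_swapM _ _ _ _ R (sigma_prod mu mu) mu (fun y => u y ^+ 2) rho k 1 iu2 irho mk kb).
rewrite -cintegralZ.
  congr cintegral; apply/funext => xi.
  have -> : cintegral (sigma_prod mu mu) setT (fun y => k (y, xi) * u y ^+ 2) =
    pairing (fun y => u y ^+ 2) (phase t) xi by [].
  have e : (0 +i* (- (xi / 2))) = 2^-1 * (0 +i* (- xi)) :> R[i].
    have -> : 2^-1 = ((2^-1 : R)%:C) :> R[i] by rewrite fmorphV rmorph_nat.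
    by apply: complex_eq => /=; ring.
  by rewrite /duhamel_density e /rho; ring.
have Bb (x xi : R) : normc (phase t (x, xi)) <= \1_(`[0, 1]%classic : set R) x by exact: normc_phase.
have ind1 (x : R) : \1_(`[0, 1]%classic : set R) x <= (1 : R) by have /andP[] := ind_bound 1 x.
have cp := ccontinuous_pairing iu2 (cmeasurable_phase t) Bb ind1 (fun x => ccontinuous_phase t x).
have := cintegrableM irho (ccontinuous_measurable cp) (normc_pairing iu2 (cmeasurable_phase t) Bb ind1).
by under eq_fun do rewrite mulrC.
Qed.

End DuhamelFormula.

(** * The Duhamel term as a tempered distribution with a density *)

Section DuhamelDistribution.
Context {R : realType}.
Local Notation mu := (@lebesgue_measure R).
Local Notation mu2 := (mu \x mu)%E.
Variable u : R * R -> R[i].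
Hypothesis iu2 : cintegrable mu2 (fun y => u y ^+ 2).

Let cV : R := Rintegral mu2 setT (fun y => 1 * normc (u y ^+ 2)).

Let cV0 : 0 <= cV.
Proof. by apply: Rintegral_ge0 => y _; rewrite mul1r normc_ge0. Qed.

Let ind1 (x : R) : \1_(`[0, 1]%classic : set R) x <= (1 : R).
Proof. by have /andP[] := ind_bound 1 x. Qed.

Let phase_le t (t1 : t <= 1) (x xi : R) : normc (phase t (x, xi)) <= \1_(`[0, 1]%classic : set R) x :=
  normc_phase x xi t1.

Lemma ccontinuous_duhamel_density t : t <= 1 -> ccontinuous (duhamel_density u (phase t)).
Proof.
move=> t1; apply: ccontinuousM.
  split => x /=; first exact: cvg_cst.
  by apply: cvgN; apply: cvgM; [exact: cvg_id|exact: cvg_cst].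
exact: (ccontinuous_pairing iu2 (cmeasurable_phase t) (phase_le t1) ind1 (fun x => ccontinuous_phase t x)).
Qed.

Let normc_imag (x : R) : normc (0 +i* x) = `|x|.
Proof. by rewrite normcE/= expr0n/= add0r sqrtr_sqr. Qed.

Lemma normc_duhamel_density t xi : t <= 1 ->
  normc (duhamel_density u (phase t) xi) <= (1 + `|xi|) * cV.
Proof.
move=> t1; rewrite ComplexField.Normc.normcM normc_imag normrN.
apply: ler_pM; [exact: normr_ge0|exact: normc_ge0| |].
  rewrite normrM [`|2^-1|]ger0_norm; last by rewrite invr_ge0.
  by have := normr_ge0 xi; lra.
exact: (normc_pairing iu2 (cmeasurable_phase t) (phase_le t1) ind1).
Qed.

Let density_decay t (M : R) phi : t <= 1 ->
  (forall xi : R, (1 + `|xi|) ^+ 3 * normc (phi xi) <= M) ->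
  forall xi, (1 + `|xi|) ^+ 2 * normc (duhamel_density u (phase t) xi * phi xi) <= cV * M.
Proof.
move=> t1 h xi; rewrite ComplexField.Normc.normcM.
have c0 : 0 <= (1 + `|xi|) ^+ 2 by rewrite exprn_ge0 ?addr_ge0.
apply: (@le_trans _ _ ((1 + `|xi|) ^+ 2 * ((1 + `|xi|) * cV * normc (phi xi)))).
  by rewrite ler_wpM2l// ler_wpM2r ?normc_ge0// normc_duhamel_density.
rewrite [leLHS](_ : _ = cV * ((1 + `|xi|) ^+ 3 * normc (phi xi))); last by ring.
by rewrite ler_wpM2l.
Qed.

Lemma test_integrable_duhamel_density t : t <= 1 ->
  test_integrable mu schwartz1 (duhamel_density u (phase t)).
Proof.
move=> t1; have md := ccontinuous_measurable (ccontinuous_duhamel_density t1).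
split => // phi sp; have [M M0 hM] := schwartz1_bound 3 sp.
apply: (decay_cintegrable _ (density_decay t1 hM)).
by apply: cmeasurableM => //; apply: ccontinuous_measurable; exact: schwartz1_ccontinuous.
Qed.

Lemma is_density_duhamel t : 0 <= t <= 1 ->
  is_density mu schwartz1 (fourier_dist1 (duhamel (nonlin u) t)) (duhamel_density u (phase t)).
Proof.
move=> t01; have /andP[t0 t1] := t01; split; first exact: test_integrable_duhamel_density.
move=> phi sp; have [M M0 hM] := schwartz1_bound 3 sp.
have e : inv_fourier1 (fourier1 phi) = phi by apply/funext => x; exact: fourier1K.
have mp : cmeasurable phi by apply: ccontinuous_measurable; exact: schwartz1_ccontinuous.
rewrite /fourier_dist1 (duhamel_pairing iu2 t01 (M := M)) e//.
by congr cintegral; apply/funext => x; rewrite mulrC.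
Qed.

Let normc_pi : normc ((2 * pi)^-1%:C : R[i]) = (2 * pi)^-1.
Proof. by rewrite normc_real ger0_norm// invr_ge0 mulr_ge0// pi_ge0. Qed.

Lemma inv_fourier1_decay phi (M : R) : (forall x : R, (1 + `|x|) ^+ 3 * normc (ftrans phi x) <= M) ->
  forall x, (1 + `|x|) ^+ 3 * normc (inv_fourier1 phi x) <= (2 * pi)^-1 * M.
Proof.
move=> h x; rewrite inv_fourier1E ComplexField.Normc.normcM normc_pi mulrCA ler_wpM2l//.
by rewrite invr_ge0 mulr_ge0// pi_ge0.
Qed.

Lemma cmeasurable_inv_fourier1 phi : cintegrable mu phi -> cmeasurable (inv_fourier1 phi).
Proof.
move=> ip; apply: cmeasurableM; first exact: cmeasurable_cst.
by apply: ccontinuous_measurable; exact: ccontinuous_ftrans.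
Qed.

Lemma tempered_duhamel t : 0 <= t <= 1 -> tempered1 (duhamel (nonlin u) t).
Proof.
move=> t01; have /andP[t0 t1] := t01.
have md := ccontinuous_measurable (ccontinuous_duhamel_density t1).
have idec phi (M : R) : cmeasurable (inv_fourier1 phi) ->
    (forall xi, (1 + `|xi|) ^+ 3 * normc (inv_fourier1 phi xi) <= M) ->
    cintegrable mu (fun xi => inv_fourier1 phi xi * duhamel_density u (phase t) xi).
  move=> mp h; have := decay_cintegrable (cmeasurableM md mp) (density_decay t1 h).
  by under eq_fun do rewrite mulrC.
split.
- move=> c phi psi sp sq.
  have ip := schwartz1_cintegrable sp; have iq := schwartz1_cintegrable sq.
  have [Mp Mp0 hp] := ftrans_bound sp; have [Mq Mq0 hq] := ftrans_bound sq.
  have dp := inv_fourier1_decay hp; have dq := inv_fourier1_decay hq.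
  have mp := cmeasurable_inv_fourier1 ip; have mq := cmeasurable_inv_fourier1 iq.
  have e : inv_fourier1 (fun x => c * phi x + psi x) = (fun xi => c * inv_fourier1 phi xi + inv_fourier1 psi xi).
    apply/funext => xi; rewrite !inv_fourier1E.
    have -> : ftrans (fun x => c * phi x + psi x) xi = c * ftrans phi xi + ftrans psi xi.
      rewrite /ftrans -cintegralZ; last exact: ftrans_integrand.
      rewrite -cintegralD; [|exact: cintegrableZ (ftrans_integrand xi ip)|exact: ftrans_integrand].
      by congr cintegral; apply/funext => x; rewrite mulrDr mulrCA.
    by ring.
  have de xi : (1 + `|xi|) ^+ 3 * normc (inv_fourier1 (fun x => c * phi x + psi x) xi) <=
      normc c * ((2 * pi)^-1 * Mp) + (2 * pi)^-1 * Mq.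
    rewrite e; have c0 : 0 <= (1 + `|xi|) ^+ 3 by rewrite exprn_ge0 ?addr_ge0.
    apply: le_trans (ler_wpM2l c0 (normcD _ _)) _; rewrite mulrDr ComplexField.Normc.normcM mulrCA.
    by apply: lerD; [rewrite ler_wpM2l ?normc_ge0|].
  have me : cmeasurable (inv_fourier1 (fun x => c * phi x + psi x)).
    by rewrite e; apply: cmeasurableD => //; apply: cmeasurableM => //; exact: cmeasurable_cst.
  rewrite (duhamel_pairing iu2 t01 me de) (duhamel_pairing iu2 t01 mp dp) (duhamel_pairing iu2 t01 mq dq).
  have i1 := idec _ _ mp dp; have i2 := idec _ _ mq dq.
  rewrite -cintegralZ// -cintegralD//; last exact: cintegrableZ.
  by congr cintegral; apply/funext => xi; rewrite e mulrDl mulrA.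
(* The seminorms are those of [ftrans_seminorm]: the function and its third derivative, with a
   quadratic weight that makes both integrable. *)
- exists 2%N, ([:: [::]; [:: 1; 1; 1]] : seq (seq R^o)).
  exists (cV * ((2 * pi)^-1 * (16 * tail2_mass)) * tail2_mass) => phi M sp hM.
  have ip := schwartz1_cintegrable sp; have mp := cmeasurable_inv_fourier1 ip.
  have h := inv_fourier1_decay (ftrans_seminorm sp hM).
  rewrite (duhamel_pairing iu2 t01 mp h).
  apply: (@le_trans _ _ (Rintegral mu setT (fun xi => cV * ((2 * pi)^-1 * (16 * tail2_mass * M)) * tail2 xi))).
    apply: normc_cintegral_le.
    - exact: cmeasurableM.
    - by apply: integrableZR; exact: integrable_tail2.
    - move=> xi; apply: le_tail2; rewrite mulrC [X in normc X]mulrC mulrC; exact: density_decay.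
  rewrite RintegralZl//; last exact: integrable_tail2.
  by rewrite le_eqVlt; apply/orP; left; apply/eqP; rewrite /tail2_mass; ring.
Qed.

Lemma duhamel_densityB t t0 xi : t <= 1 -> t0 <= 1 ->
  duhamel_density u (phase_diff t t0) xi =
  duhamel_density u (phase t) xi - duhamel_density u (phase t0) xi.
Proof.
move=> t1 t01; rewrite /duhamel_density -mulrBr; congr (_ * _).
have ii r : r <= 1 -> cintegrable mu2 (fun y => cis (- (y.1 * xi)) * phase r (y.2, xi) * u y ^+ 2).
  move=> r1; apply: (cintegrableM iu2 (B := 1)).
    apply: cmeasurableM.
      apply: cmeasurable_cis; apply: measurableT_comp => //.
      by apply: measurable_funM => //; exact: measurable_cst.
    have [p1 p2] := cmeasurable_phase r.
    by split; [exact: (measurableT_comp p1 (measurableT_comp (measurable_pair2 xi) measurable_snd))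
      |exact: (measurableT_comp p2 (measurableT_comp (measurable_pair2 xi) measurable_snd))].
  move=> y; rewrite ComplexField.Normc.normcM normc_cis mul1r.
  exact: le_trans (phase_le r1 _ _) (ind1 _).
rewrite /pairing -cintegralB; [|exact: ii..].
by congr cintegral; apply/funext => y; rewrite /phase_diff mulrBr mulrBl.
Qed.

Lemma is_density_duhamelB t t0 : 0 <= t <= 1 -> 0 <= t0 <= 1 ->
  is_density mu schwartz1 (fourier_dist1 (duhamel (nonlin u) t \- duhamel (nonlin u) t0))
    (duhamel_density u (phase_diff t t0)).
Proof.
move=> t01 t001; have /andP[_ t1] := t01; have /andP[_ t01'] := t001.
have [[m1 i1] v1] := is_density_duhamel t01; have [[m2 i2] v2] := is_density_duhamel t001.
have e : duhamel_density u (phase_diff t t0) =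
    (fun xi => duhamel_density u (phase t) xi - duhamel_density u (phase t0) xi).
  by apply/funext => xi; exact: duhamel_densityB.
split.
  split; first by rewrite e; apply: cmeasurableD => //; exact: cmeasurableN.
  by move=> phi sp; rewrite e; under eq_fun do rewrite mulrBl; apply: cintegrableB; [exact: i1|exact: i2].
move=> phi sp; rewrite /fourier_dist1 /=.
have -> : duhamel (nonlin u) t (fourier1 phi) = dist_of mu (duhamel_density u (phase t)) phi by exact: v1.
have -> : duhamel (nonlin u) t0 (fourier1 phi) = dist_of mu (duhamel_density u (phase t0)) phi by exact: v2.
rewrite /dist_of -cintegralB; [|exact: i1|exact: i2].
by congr cintegral; apply/funext => xi; rewrite e mulrBl.
Qed.

End DuhamelDistribution.

(** * The smoothing estimate *)

Section Lnorm2.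
Context d {V : measurableType d} {R : realType} (m : {measure set V -> \bar R}) (f : V -> R).
Hypothesis f0 : forall x, 0 <= f x.

Let Lnorm2_sq : (Lnorm m 2%:E (fun x => (f x)%:E) `^ 2 = \int[m]_x (f x ^+ 2)%:E)%E.
Proof.
rewrite poweR_Lnorm//; apply: eq_integral => x _.
by rewrite abse_EFin ger0_norm// poweR_EFin powR_mulrn.
Qed.

Lemma Lnorm2_fin (r : R) : Lnorm m 2%:E (fun x => (f x)%:E) = r%:E ->
  0 <= r /\ (\int[m]_x (f x ^+ 2)%:E = (r ^+ 2)%:E)%E.
Proof.
move=> e; have r0 : 0 <= r by rewrite -lee_fin -e Lnorm_ge0.
by split => //; rewrite -Lnorm2_sq e poweR_EFin powR_mulrn.
Qed.

Lemma Lnorm2_le (r : R) : 0 <= r -> (\int[m]_x (f x ^+ 2)%:E <= (r ^+ 2)%:E)%E ->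
  (Lnorm m 2%:E (fun x => (f x)%:E) <= r%:E)%E.
Proof.
move=> r0; rewrite -Lnorm2_sq.
have := Lnorm_ge0 m 2%:E (fun x => (f x)%:E).
case: (Lnorm m 2%:E (fun x => (f x)%:E)) => [l| |] //=; rewrite ?lee_fin.
- by move=> l0; rewrite ?poweR_EFin ?lee_fin powR_mulrn// ler_pXn2r// nnegrE.
- by rewrite pnatr_eq0.
Qed.

End Lnorm2.

Section HnormBound.
Context {R : realType}.
Local Notation mu := (@lebesgue_measure R).

Lemma Hnorm_ge0 (k : R) (U : dist1 R) : (0 <= Hnorm k U)%E.
Proof. by apply: le_ereal_inf_tmp => _ [g _ <-]; exact: Lnorm_ge0. Qed.

(** The norm is an infimum over densities, so exhibiting one density bounds it from above. *)
Lemma Hnorm_le (k r : R) (U : dist1 R) (G : R -> R[i]) : 0 <= r ->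
  is_density mu schwartz1 (fourier_dist1 U) G ->
  (\int[mu]_xi ((bracket xi `^ k * normc (G xi)) ^+ 2)%:E <= (r ^+ 2)%:E)%E ->
  (Hnorm k U <= r%:E)%E.
Proof.
move=> r0 dG hG; apply: le_trans (_ : Lnorm mu 2%:E (fun x => (bracket x `^ k * normc (G x))%:E) <= _)%E.
  by apply: ereal_inf_lbound; exists G.
by apply: Lnorm2_le => // x; apply: mulr_ge0; [exact: powR_ge0|exact: normc_ge0].
Qed.

End HnormBound.

(** * The regularization applied to the solution *)

Section SolutionSquare.
Context {R : realType}.
Local Notation mu := (@lebesgue_measure R).
Local Notation mu2 := (mu \x mu)%E.
Local Notation m2 := (sigma_prod mu mu).

Lemma planar_prod (F : R * R -> \bar R) : measurable_fun setT F -> (forall z, 0 <= F z)%E ->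
  (\int[m2]_z F (z.1, z.2) = \int[mu]_x \int[mu]_t F (x, t))%E.
Proof.
move=> mF F0; have := fubini_tonelli1 (m1 := mu) (m2 := mu) _ mF F0; rewrite /fubini_F => <-.
by apply: eq_integral => -[x t] _.
Qed.

Variables (u g : R * R -> R[i]).
Hypothesis tu : test_integrable mu2 schwartz2 u.
Hypothesis ts : forall t, test_integrable mu schwartz1 (slice u t).
Hypothesis gd : is_density mu2 schwartz2 (fourier_dist2 (dist2_of u)) g.

Let cis00 (x y : R) : cis (0 * x + 0 * y) = 1 :> R[i].
Proof. by rewrite !mul0r addr0 cis0. Qed.

Let iu_gauss s1 s2 : s1 != 0 -> s2 != 0 ->
  cintegrable mu2 (fun y => u y * (gaus s1 y.1 * gaus s2 y.2)%:C).
Proof.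
move=> s10 s20; have := tu.2 _ (gaussian_schwartz2 0 0 s10 s20).
by under eq_fun do rewrite cis00 mul1r.
Qed.

Let iu_slice t s : s != 0 -> cintegrable mu (fun x => u (x, t) * (gaus s x)%:C).
Proof.
move=> s0; have := (ts t).2 _ (gaussian_schwartz1 0 s0).
by under eq_fun do rewrite mul0r cis0 mul1r.
Qed.

Let ig_gauss s1 s2 : s1 != 0 -> s2 != 0 ->
  cintegrable mu2 (fun y => g y * (gaus s1 y.1 * gaus s2 y.2)%:C).
Proof.
move=> s10 s20; have := gd.1.2 _ (gaussian_schwartz2 0 0 s10 s20).
by under eq_fun do rewrite cis00 mul1r.
Qed.

(** The density is tested against the plane wave at [y] damped by Gaussians. The Fourier transform
    of that test function is (2 pi)^2 times the product of the two normal densities centred at [y],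
    which is the kernel of [ureg]. *)
Let ureg_greg_prod n k y :
  ((2 * pi) ^+ 2)%:C * ureg u n k y = charint m2 (greg fst snd g n k) fst snd y.
Proof.
have e0 := @epsn_neq0 R.
have sp := gaussian_schwartz2 y.1 y.2 (e0 n) (e0 k).
have := gd.2 _ sp.
rewrite /fourier_dist2 /dist2_of /dist_of => h.
have -> : charint m2 (greg fst snd g n k) fst snd y = cintegral mu2 setT (fun z =>
    g z * (cis (y.1 * z.1 + y.2 * z.2) * (gaus (epsn n) z.1 * gaus (epsn k) z.2)%:C)).
  by congr cintegral; apply/funext => z; rewrite /greg /damp mulrCA.
rewrite -h /ureg -cintegralZ; last exact: (integrable_u_pdf2 tu.1 iu_gauss).
congr cintegral; apply/funext => y'; rewrite mulrCA; congr (_ * _).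
rewrite /fourier2.
transitivity (cintegral mu2 setT (fun z : R * R => (cis ((y.1 - y'.1) * z.1) * (gaus (epsn n) z.1)%:C) *
    (cis ((y.2 - y'.2) * z.2) * (gaus (epsn k) z.2)%:C))); last first.
  congr cintegral; apply/funext => z; rewrite !mulrBl.
  have -> : y.1 * z.1 - y'.1 * z.1 = y.1 * z.1 + - (z.1 * y'.1) by ring.
  have -> : y.2 * z.2 - y'.2 * z.2 = y.2 * z.2 + - (z.2 * y'.2) by ring.
  have -> : - (z.1 * y'.1 + z.2 * y'.2) = - (z.1 * y'.1) + - (z.2 * y'.2) by ring.
  move: (- (z.1 * y'.1)) (- (z.2 * y'.2)) => p q.
  by rewrite !cisD rmorphM; ring.
rewrite (cintegral_prodM (integrable_cis_gaus _ (e0 n)) (integrable_cis_gaus _ (e0 k))).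
rewrite !integral_cis_gaus_pdf ?epsn_gt0// -!rmorphM; congr (_%:C); ring.
Qed.

Hypothesis L2g : (\int[mu2]_z (normc (g z) ^+ 2)%:E < +oo)%E.

Lemma solution_sqr_approx : cintegrable mu2 (fun y => u y ^+ 2) /\
  exists (v_ : nat -> R * R -> R[i]) (rho_ : nat -> (R * R) * (R * R) -> R[i]) (q : nat -> R),
  [/\ forall N, cintegrable mu2 (v_ N) /\ cintegrable (sigma_prod m2 m2) (rho_ N),
      forall N y, v_ N y = charint (sigma_prod m2 m2) (rho_ N)
        (fun w => w.1.1 + w.2.1) (fun w => w.1.2 + w.2.2) y,
      forall N w, normc (rho_ N w) <= normc (g w.1) * normc (g w.2),
      q @ \oo --> 0 &
      forall N, mu2.-integrable setT (EFin \o (fun y => normc (v_ N y - u y ^+ 2))) /\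
        Rintegral mu2 setT (fun y => normc (v_ N y - u y ^+ 2)) <= q N].
Proof.
exact: (@sqr_approx _ _ _ m2 fst snd u g measurable_fst measurable_snd planar_prod tu.1 gd.1.1
  iu_gauss iu_slice ig_gauss ureg_greg_prod L2g).
Qed.

End SolutionSquare.

(** * Integrals over pairs of frequencies *)

Section PairBounds.
Context d {P : measurableType d} {R : realType} (m : {sigma_finite_measure set P -> \bar R}).
Variables (px pt : P -> R) (g : P -> R[i]) (s b r : R).
Hypothesis mpx : measurable_fun setT px.
Hypothesis mpt : measurable_fun setT pt.
Hypothesis mg : cmeasurable g.
Local Notation wd := (wdens px pt g s b).
Hypothesis r0 : 0 <= r.
Hypothesis wd_r : (\int[m]_z (wd z ^+ 2)%:E = (r ^+ 2)%:E)%E.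

Let mwd : measurable_fun setT (fun z => wd z ^+ 2).
Proof.
apply: measurable_funX.
exact: (measurable_funM (measurable_pweight mpx mpt s b) (measurable_normc mg)).
Qed.

Let iwd : m.-integrable setT (EFin \o (fun z => wd z ^+ 2)).
Proof. by apply: integrable_lty => //; [move=> z; exact: sqr_ge0|rewrite wd_r ltry]. Qed.

Lemma L2_of_wdens : 0 <= s -> 0 <= b -> (\int[m]_z (normc (g z) ^+ 2)%:E < +oo)%E.
Proof.
move=> s0 b0; apply: le_lt_trans (_ : \int[m]_z (wd z ^+ 2)%:E < +oo)%E; last by rewrite wd_r ltry.
apply: ge0_le_integral_nm => z; first by rewrite lee_fin sqr_ge0.
rewrite lee_fin lerXn2r ?nnegrE ?normc_ge0 ?mulr_ge0 ?normc_ge0 ?powR_ge0//.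
rewrite ler_peMl ?normc_ge0// -[leLHS]mulr1 ler_pM//.
  by rewrite -[leLHS](powRr0 (bracket (px z))) ler_powR// bracket_ge1.
by rewrite -[leLHS](powRr0 (bracket (pt z + px z ^+ 5))) ler_powR// bracket_ge1.
Qed.

Let ww (w : P * P) : R := wd w.1 ^+ 2 * wd w.2 ^+ 2.

Let iww : (m \x m)%E.-integrable setT (EFin \o ww).
Proof. exact: (integrable_prodM iwd iwd). Qed.

Let ww0 w : 0 <= ww w. Proof. by rewrite mulr_ge0 ?sqr_ge0. Qed.

Let ww_r : Rintegral (m \x m)%E setT ww = (r ^+ 2) ^+ 2.
Proof.
have e : Rintegral m setT (fun z => wd z ^+ 2) = r ^+ 2 by rewrite /Rintegral wd_r.
rewrite (Rintegral_Fubini iww).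
transitivity (Rintegral m setT (fun z => r ^+ 2 * wd z ^+ 2)).
  by apply: eq_Rintegral => z _; rewrite /ww /= RintegralZl// e mulrC.
by rewrite RintegralZl// e -expr2.
Qed.

Let wpair_le K (k : R) w : 0 <= k ->
  bracket (pt w.1 + pt w.2 + (px w.1 + px w.2) ^+ 5) * normc (K w) <= k ->
  wpair px pt g K s b w <= ww w * k ^+ 2.
Proof.
move=> k0 h; rewrite /wpair exprMn [X in X * _]exprMn; apply: ler_wpM2l; first exact: ww0.
by rewrite lerXn2r ?nnegrE// mulr_ge0 ?normc_ge0// ltW// bracket_gt0.
Qed.

Lemma wpair_bound K : (forall w,
    bracket (pt w.1 + pt w.2 + (px w.1 + px w.2) ^+ 5) * normc (K w) <= 4) ->
  (\int[m \x m]_w (wpair px pt g K s b w)%:E <= (16 * (r ^+ 2) ^+ 2)%:E)%E.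
Proof.
move=> hK; rewrite -ww_r; have i16 := integrableZR 16 iww.
rewrite -RintegralZl// -(Rintegral_fin i16).
apply: ge0_le_integral_nm => w; first by rewrite lee_fin sqr_ge0.
rewrite lee_fin; apply: le_trans (wpair_le (ler0n _ 4) (hK w)) _.
by rewrite mulrC -natrX.
Qed.

(** The kernel is replaced by min(8, epsn n * Pw), which tends to 0 pointwise and is dominated by 8,
    so dominated convergence applies. The resulting rate depends on [n] but not on [K], hence is
    uniform over the pairs of times at distance at most [epsn n]. *)
Lemma wpair_vanish (Pw : P * P -> R) : measurable_fun setT Pw -> (forall w, 0 <= Pw w) ->
  exists2 I_ : nat -> R, I_ @ \oo --> 0 & forall n K, (forall w,
    bracket (pt w.1 + pt w.2 + (px w.1 + px w.2) ^+ 5) * normc (K w) <= 8 /\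
    bracket (pt w.1 + pt w.2 + (px w.1 + px w.2) ^+ 5) * normc (K w) <= epsn n * Pw w) ->
  (\int[m \x m]_w (wpair px pt g K s b w)%:E <= (I_ n)%:E)%E.
Proof.
move=> mPw Pw0; pose F n w := ww w * (Num.min 8 (epsn n * Pw w)) ^+ 2.
have e0 n : 0 <= epsn n :> R by rewrite ltW// epsn_gt0.
have min0 n w : 0 <= Num.min 8 (epsn n * Pw w) by rewrite le_min ler0n mulr_ge0.
have F0 n w : 0 <= F n w by rewrite mulr_ge0 ?sqr_ge0.
have mF n : measurable_fun setT (F n).
  apply: measurable_funM; first exact: integrable_measurable iww.
  apply: measurable_funX; apply: measurable_minr; first exact: measurable_cst.
  by apply: measurable_funM => //; exact: measurable_cst.
have i64 := integrableZR 64 iww.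
have Fle n w : `|F n w| <= 64 * ww w.
  rewrite (ger0_norm (F0 n w)) /F [leRHS]mulrC; apply: ler_wpM2l; first exact: ww0.
  have -> : 64 = 8 ^+ 2 :> R by rewrite -natrX.
  by rewrite lerXn2r ?nnegrE// ge_min lexx.
exists (fun n => Rintegral (m \x m)%E setT (F n)).
  have := @Rintegral_cvg _ _ _ (m \x m)%E F (fun=> 0) _ mF (measurable_cst _) i64 Fle.
  rewrite [X in _ --> X](_ : _ = 0); last by rewrite /Rintegral integral0.
  apply=> w; have c : (fun n => epsn n * Pw w) @ \oo --> 0 * Pw w.
    by apply: cvgM; [exact: cvg_harmonic|exact: cvg_cst].
  rewrite mul0r in c.
  have h0 : 0 = ww w * 0 by rewrite mulr0.
  rewrite [X in _ --> X]h0; apply: cvgM; first exact: cvg_cst.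
  have c2 : (fun n => (epsn n * Pw w) ^+ 2) @ \oo --> (0 * 0 : R) by apply: cvgM.
  rewrite mul0r in c2; apply: (squeeze_cvgr _ (cvg_cst (0 : R)) c2).
  by apply: nearW => n; rewrite sqr_ge0/= lerXn2r ?nnegrE ?mulr_ge0// ge_min lexx orbT.
move=> n K hK; have iF := le_integrableR (mF n) i64 (Fle n).
rewrite -(Rintegral_fin iF); apply: ge0_le_integral_nm => w; first by rewrite lee_fin sqr_ge0.
rewrite lee_fin; apply: wpair_le => //; have [h1 h2] := hK w.
by rewrite le_min h1.
Qed.

End PairBounds.

(** * Norm and continuity of the Duhamel term *)

Section DuhamelEstimate.
Context {R : realType}.
Local Notation mu := (@lebesgue_measure R).
Local Notation mu2 := (mu \x mu)%E.
Local Notation m2 := (sigma_prod mu mu).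
Variables (s b a Cm : R) (u g : R * R -> R[i]) (r : R).
Hypothesis hs : 0 <= s.
Hypothesis hb : 2 / 5 < b < 1 / 2.
Hypothesis ha : 0 <= a.
Hypothesis Cm0 : 0 <= Cm.
Hypothesis Cm_main : forall f : R -> R, measurable_fun setT f -> (forall x, 0 <= f x) ->
  (\int[m2 \x m2]_v (f (v.1.1 + v.2.1)%R * (v.1.1 + v.2.1)%R ^+ 2 *
     (bracket (v.1.1 + v.2.1)%R `^ (2 * (s + a)) *
      ((pweight fst snd s b v.1 ^+ 2)^-1 * (pweight fst snd s b v.2 ^+ 2)^-1)) *
     bracket (v.1.2 + v.2.2 + (v.1.1 + v.2.1) ^+ 5)%R `^ (- 2))%:E <=
   Cm%:E * \int[mu]_x (f x)%:E)%E.
Hypothesis tu : test_integrable mu2 schwartz2 u.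
Hypothesis ts : forall t, test_integrable mu schwartz1 (slice u t).
Hypothesis gd : is_density mu2 schwartz2 (fourier_dist2 (dist2_of u)) g.
Hypothesis g_norm : Lnorm mu2 2%:E (fun z =>
  (bracket z.1 `^ s * bracket (z.2 + z.1 ^+ 5) `^ b * normc (g z))%:E) = r%:E.

Let c : R := (2 * pi) ^+ 2 * (Cm + 1).

Let r_facts : 0 <= r /\ (\int[m2]_z (wdens fst snd g s b z ^+ 2)%:E = (r ^+ 2)%:E)%E.
Proof.
apply: (Lnorm2_fin _ g_norm) => z.
by apply: mulr_ge0; [apply: mulr_ge0; exact: powR_ge0|exact: normc_ge0].
Qed.

Let b0 : 0 <= b. Proof. by have /andP[h _] := hb; apply: ltW; apply: le_lt_trans h; rewrite divr_ge0. Qed.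

Let mg : cmeasurable g := gd.1.1.

Let L2g : (\int[mu2]_z (normc (g z) ^+ 2)%:E < +oo)%E :=
  L2_of_wdens r_facts.2 hs b0.

Lemma integrable_solution_sqr : cintegrable mu2 (fun y => u y ^+ 2).
Proof. by have [] := solution_sqr_approx tu ts gd L2g. Qed.

Section Energy.
Variables (Bt : R * R -> R[i]) (beta : R -> R) (M0 : R).
Hypothesis mB : cmeasurable Bt.
Hypothesis B_bound : forall t xi, normc (Bt (t, xi)) <= beta t.
Hypothesis ibeta : mu.-integrable setT (EFin \o beta).
Hypothesis beta_bound : forall t, beta t <= M0.
Hypothesis B_cont : forall t, ccontinuous (fun xi => Bt (t, xi)).

Definition pair_kernel (w : (R * R) * (R * R)) : R[i] := Bhat Bt (w.1.1 + w.2.1) (w.1.2 + w.2.2).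

(** Stated for a general multiplier [Bt], so that [phase] gives the norm and [phase_diff] the
    continuity in time. The 1/4 is the square of the 1/2 in [duhamel_density]. *)
Lemma energy :
  (\int[mu]_xi ((bracket xi `^ (s + a) * normc (duhamel_density u Bt xi)) ^+ 2)%:E <=
   (c / 4)%:E * \int[m2 \x m2]_w (wpair fst snd g pair_kernel s b w)%:E)%E.
Proof.
have [iu2 [v_ [rho_ [q [h1 h2 h3 h4 h5]]]]] := solution_sqr_approx tu ts gd L2g.
have dual := @cintegral_pairing_le _ _ _ m2 fst snd g _ measurable_fst measurable_snd
  v_ rho_ q iu2 h1 h2 h3 h4 h5 Bt beta M0 mB B_bound ibeta beta_bound B_cont.
have cD := ccontinuous_pairing iu2 mB B_bound beta_bound B_cont.
have mxi : measurable_fun setT (fun w : (R * R) * (R * R) => w.1.1 + w.2.1).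
  by apply: measurable_funD; [exact: (measurableT_comp measurable_fst measurable_fst)
    |exact: (measurableT_comp measurable_fst measurable_snd)].
have mtau : measurable_fun setT (fun w : (R * R) * (R * R) => w.1.2 + w.2.2).
  by apply: measurable_funD; [exact: (measurableT_comp measurable_snd measurable_fst)
    |exact: (measurableT_comp measurable_snd measurable_snd)].
have mK : cmeasurable pair_kernel.
  have [k1 k2] := cmeasurable_Bhat mtau mB.
  have mz : measurable_fun setT (fun w : (R * R) * (R * R) => (w.1.1 + w.2.1, w)).
    by apply: measurable_fun_pair => //; exact: mxi.
  by split; [exact: (measurableT_comp k1 mz)|exact: (measurableT_comp k2 mz)].
have est := @weighted_estimate _ _ _ m2 fst snd g _ pair_kernel _ s b a Cm
  measurable_fst measurable_snd mg mK cD (normc_pairing iu2 mB B_bound beta_bound) dual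
  Cm0 Cm_main.
have e xi : ((bracket xi `^ (s + a) * normc (duhamel_density u Bt xi)) ^+ 2)%:E =
    ((1 / 4)%:E * (normc (pairing (fun y => u y ^+ 2) Bt xi) ^+ 2 * hweight s a xi)%:E)%E.
  rewrite -EFinM; congr (_%:E); rewrite /duhamel_density ComplexField.Normc.normcM.
  have -> : normc (0 +i* (- (xi / 2)) : R[i]) = `|xi| / 2.
    rewrite normcE/= expr0n/= add0r sqrtr_sqr normrN normrM; congr (_ * _).
    by rewrite ger0_norm// invr_ge0.
  rewrite /hweight [2 * (s + a)]mulrC powRrM powR_mulrn ?powR_ge0//.
  by rewrite -[xi ^+ 2]real_normK ?num_real//; field.
under eq_integral do rewrite e.
rewrite ge0_integralZl//; last 2 first.
- apply/measurable_EFinP; apply: measurable_funM.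
    by apply: measurable_funX; apply: measurable_normc; exact: ccontinuous_measurable.
  by apply: continuous_measurable_fun; exact: continuous_hweight.
- by move=> xi _; rewrite lee_fin mulr_ge0 ?sqr_ge0// hweight_ge0.
apply: le_trans (lee_wpmul2l _ est) _; first by rewrite lee_fin divr_ge0.
rewrite muleA -EFinM; apply: lee_wpmul2r.
  by apply: integral_ge0 => w _; rewrite lee_fin sqr_ge0.
by rewrite lee_fin -/c mulrC mulrA mulr1.
Qed.

End Energy.

Let c0 : 0 <= c.
Proof. by apply: mulr_ge0; [exact: sqr_ge0|exact: addr_ge0]. Qed.

(** The kernel bound 4 enters squared: (c / 4) * 16 * r^4 is the square of 2 sqrt(c) r^2. *)
Lemma Hnorm_duhamel (t : R) : 0 <= t <= 1 ->
  (Hnorm (s + a) (duhamel (nonlin u) t) <= (2 * Num.sqrt c * r ^+ 2)%:E)%E.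
Proof.
move=> t01; have /andP[t0 t1] := t01.
apply: (Hnorm_le _ (is_density_duhamel integrable_solution_sqr t01)).
  by rewrite mulr_ge0 ?sqr_ge0// mulr_ge0 ?sqrtr_ge0.
apply: le_trans (energy (cmeasurable_phase t) (fun x xi => normc_phase x xi t1)
  (integrable_ind 1) (M0 := 1) _ (ccontinuous_phase t)) _.
  by move=> x; have /andP[] := ind_bound 1 x.
have h := @wpair_bound _ _ _ m2 fst snd g s b r measurable_fst measurable_snd mg r_facts.2
  (pair_kernel (phase t)) (fun w => bracket_Bhat_phase _ _ t01).
apply: le_trans (lee_wpmul2l _ h) _; first by rewrite lee_fin divr_ge0.
rewrite -EFinM lee_fin !exprMn sqr_sqrtr//.
by rewrite le_eqVlt; apply/orP; left; apply/eqP; field.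
Qed.

Let normc_phase_diff t t0 : t <= 1 -> t0 <= 1 -> forall x xi : R,
  normc (phase_diff t t0 (x, xi)) <= 2 * \1_(`[0, 1]%classic : set R) x.
Proof.
move=> t1 t01 x xi; apply: le_trans (normcD _ _) _; rewrite normcN.
by have := normc_phase x xi t1; have := normc_phase x xi t01; lra.
Qed.

Lemma Hnorm_duhamelB : exists2 J : nat -> R, J @ \oo --> 0 &
  forall n (t t0 : R), 0 <= t <= 1 -> 0 <= t0 <= 1 -> `|t - t0| <= epsn n ->
  (Hnorm (s + a) (duhamel (nonlin u) t \- duhamel (nonlin u) t0)%R <= (J n)%:E)%E.
Proof.
pose Pw (w : (R * R) * (R * R)) := bracket (w.1.2 + w.2.2 + (w.1.1 + w.2.1) ^+ 5) *
  (2 * `|(w.1.1 + w.2.1) ^+ 5| + 1).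
have mP : measurable_fun setT Pw.
  have mw : measurable_fun setT (fun w : (R * R) * (R * R) => w.1.1 + w.2.1).
    by apply: measurable_funD; [exact: (measurableT_comp measurable_fst measurable_fst)
      |exact: (measurableT_comp measurable_fst measurable_snd)].
  have mk : measurable_fun setT (fun w : (R * R) * (R * R) => w.1.2 + w.2.2).
    by apply: measurable_funD; [exact: (measurableT_comp measurable_snd measurable_fst)
      |exact: (measurableT_comp measurable_snd measurable_snd)].
  have mw5 := measurable_funX 5 mw.
  apply: measurable_funM; first by apply: measurable_fun_bracket; exact: measurable_funD.
  apply: measurable_funD; last exact: measurable_cst.
  by apply: measurable_funM; [exact: measurable_cst|exact: measurableT_comp].
have P0 w : 0 <= Pw w.
  by apply: mulr_ge0; [exact: ltW (bracket_gt0 _)|rewrite addr_ge0// mulr_ge0].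
have [I_ I0 hI] := @wpair_vanish _ _ _ m2 fst snd g s b r measurable_fst measurable_snd mg
  r_facts.2 Pw mP P0.
exists (fun n => Num.sqrt (c / 4 * I_ n)).
  have c1 : (fun n => c / 4 * I_ n) @ \oo --> c / 4 * 0 by apply: cvgM => //; exact: cvg_cst.
  rewrite mulr0 in c1; rewrite -[X in _ --> X]sqrtr0.
  by apply: (continuous_cvg _ _ c1); exact: sqrt_continuous.
move=> n t t0 t01 t001 tt; have /andP[_ t1] := t01; have /andP[_ t1'] := t001.
have h := hI n (pair_kernel (phase_diff t t0)) _.
have {}h : (\int[m2 \x m2]_w (wpair fst snd g (pair_kernel (phase_diff t t0)) s b w)%:E <= (I_ n)%:E)%E.
  apply: h => w; have [h1 h2] := bracket_Bhat_phase_diff (w.1.1 + w.2.1) (w.1.2 + w.2.2) t01 t001.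
  by split; [exact: h1|apply: le_trans h2 _; exact: ler_wpM2r (P0 w) _ _ tt].
have I_0 : 0 <= I_ n.
  by rewrite -lee_fin; apply: le_trans h; apply: integral_ge0 => w _; rewrite lee_fin sqr_ge0.
apply: (Hnorm_le _ (is_density_duhamelB integrable_solution_sqr t01 t001)); first exact: sqrtr_ge0.
have [p1 p2] := cmeasurable_phase t; have [q1 q2] := cmeasurable_phase t0.
apply: le_trans (energy _ (normc_phase_diff t1 t1') (integrableZR 2 (integrable_ind 1)) (M0 := 2) _ _) _.
- by apply: cmeasurableD; [|apply: cmeasurableN]; exact: cmeasurable_phase.
- by move=> x; have /andP[_ h1] := ind_bound 1 x; rewrite -[leRHS]mulr1 ler_wpM2l.
- move=> x; have [e1 e2] := ccontinuous_phase t x; have [f1 f2] := ccontinuous_phase t0 x.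
  split => xi.
  + rewrite (_ : (fun _ => _) = (fun xi => Re (phase t (x, xi)) - Re (phase t0 (x, xi)))); last first.
      by apply/funext => z; rewrite /phase_diff ReD ReN.
    by apply: cvgB; [exact: e1|exact: f1].
  + rewrite (_ : (fun _ => _) = (fun xi => Im (phase t (x, xi)) - Im (phase t0 (x, xi)))); last first.
      by apply/funext => z; rewrite /phase_diff ImD ImN.
    by apply: cvgB; [exact: e2|exact: f2].
apply: le_trans (lee_wpmul2l _ h) _; first by rewrite lee_fin divr_ge0.
by rewrite -EFinM lee_fin sqr_sqrtr// mulr_ge0// divr_ge0.
Qed.

End DuhamelEstimate.

(** * From densities to the Bourgain norm *)

Section SmoothingEstimate.
Context {R : realType}.
Local Notation mu := (@lebesgue_measure R).
Local Notation mu2 := (mu \x mu)%E.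

(** Removes the margin [e] left by choosing a density that only nearly attains the Bourgain norm. *)
Lemma ler_sqr_addgt0 (h c x : R) : 0 <= c -> 0 <= x ->
  (forall e, 0 < e -> h <= c * (x + e) ^+ 2) -> h <= c * x ^+ 2.
Proof.
move=> c0 x0 H; rewrite leNgt; apply/negP => hlt.
have k0 : 0 < c * (2 * x + 1) + 1 by rewrite ltr_wpDl// mulr_ge0// addr_ge0// mulr_ge0.
pose e := Num.min 1 ((h - c * x ^+ 2) / (c * (2 * x + 1) + 1)).
have e0 : 0 < e by rewrite lt_min ltr01 divr_gt0// subr_gt0.
have e1 : e <= 1 by rewrite ge_min lexx.
have e2 : e * (c * (2 * x + 1) + 1) <= h - c * x ^+ 2.
  by rewrite -ler_pdivlMr// ge_min lexx orbT.
have e3 : c * e * e <= c * e by rewrite ler_piMr// mulr_ge0// ltW.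
have := H e e0; rewrite (_ : c * (x + e) ^+ 2 = c * x ^+ 2 + 2 * (c * e * x) + c * e * e); last by ring.
rewrite (_ : e * (c * (2 * x + 1) + 1) = 2 * (c * e * x) + c * e + e) in e2; last by ring.
move: (c * e * x) (c * e * e) (c * e) (c * x ^+ 2) e2 e3 hlt => A B D E; lra.
Qed.

Lemma Xnorm_ge0 (s b : R) (U : dist2 R) : (0 <= Xnorm s b U)%E.
Proof. by apply: le_ereal_inf_tmp => _ [g _ <-]; exact: Lnorm_ge0. Qed.

(** A nearly optimal density is enough, which avoids proving that densities agree up to null
    sets. *)
Lemma Xnorm_density (s b : R) (U : dist2 R) (e : R) : 0 < e -> (Xnorm s b U < +oo)%E ->
  exists g r, [/\ is_density mu2 schwartz2 (fourier_dist2 U) g,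
    Lnorm mu2 2%:E (fun z => (bracket z.1 `^ s * bracket (z.2 + z.1 ^+ 5) `^ b * normc (g z))%:E) = r%:E,
    0 <= r & (r%:E < Xnorm s b U + e%:E)%E].
Proof.
move=> e0 Xoo; have Xf : Xnorm s b U \is a fin_num by rewrite ge0_fin_numE ?Xnorm_ge0.
have [_ [g gd <-]] := lb_ereal_inf_adherent e0 Xf; rewrite -[ereal_inf _]/(Xnorm s b U).
have := Lnorm_ge0 mu2 2%:E (fun z => (bracket z.1 `^ s * bracket (z.2 + z.1 ^+ 5) `^ b * normc (g z))%:E).
case E : Lnorm => [r| |] // r0 h; last by rewrite -(fineK Xf) in h.
by exists g, r; split.
Qed.

End SmoothingEstimate.

Theorem theorem1p2 (R : realType) (eta : R -> R) (heta : bump_function eta)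
    (s b a : R) (hs : 0 <= s) (hb : 2 / 5 < b < 1 / 2)
    (ha : 0 <= a <= 10 * b - 4) :
  exists2 C : R, 0 < C &
    forall (u0 : dist1 R) (T : R) (u : R * R -> R[i]),
      Hs s u0 ->
      0 < T <= 1 / 2 ->
      XsbCHs s b u ->
      solves_cutoff_equation eta T u0 u ->
      continuous_Hs `[0, T] (s + a) (duhamel (nonlin u)) /\
      (CHnorm `[0%R, T] (s + a)%R (duhamel (nonlin u)) <=
         C%:E * Xnorm s b (dist2_of u) ^+ 2)%E.
Proof.
have /andP[ha0 _] := ha.
have [Cm Cm0 Cm_main] := @main_estimate R _ _ (sigma_prod lebesgue_measure lebesgue_measure) fst snd
  measurable_fst measurable_snd planar_prod s b a hs hb ha.
pose c : R := (2 * pi) ^+ 2 * (Cm + 1).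
have c0 : 0 < 2 * Num.sqrt c.
  by rewrite mulr_gt0// sqrtr_gt0 mulr_gt0 ?exprn_gt0 ?mulr_gt0 ?pi_gt0// ltr_wpDl.
exists (2 * Num.sqrt c) => // u0 T u _ /andP[_ T2] [tu [_ Xoo] ts _] _.
have inA t : `[0, T]%classic t -> 0 <= t <= 1.
  by rewrite /= in_itv/= => /andP[-> /le_trans]; apply; move: T2; lra.
have Hle t : 0 <= t <= 1 -> (Hnorm (s + a) (duhamel (nonlin u) t) <=
    (2 * Num.sqrt c)%:E * Xnorm s b (dist2_of u) ^+ 2)%E.
  move=> t01; have Xf : Xnorm s b (dist2_of u) \is a fin_num by rewrite ge0_fin_numE ?Xnorm_ge0.
  have le_e e : 0 < e -> (Hnorm (s + a) (duhamel (nonlin u) t) <=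
      (2 * Num.sqrt c * (fine (Xnorm s b (dist2_of u)) + e) ^+ 2)%:E)%E.
    move=> e0; have [g [r [gd gr r0 rX]]] := Xnorm_density e0 Xoo.
    apply: le_trans (Hnorm_duhamel hs hb Cm0 Cm_main tu ts gd gr t01) _.
    rewrite lee_fin; apply: ler_wpM2l; first exact: ltW.
    rewrite -(fineK Xf) -EFinD lte_fin in rX.
    by rewrite lerXn2r ?nnegrE// ?(le_trans r0)// ltW.
  have x0 : 0 <= fine (Xnorm s b (dist2_of u)) by apply: fine_ge0; exact: Xnorm_ge0.
  have Hf : Hnorm (s + a) (duhamel (nonlin u) t) \is a fin_num.
    by rewrite ge0_fin_numE ?Hnorm_ge0//; apply: le_lt_trans (le_e 1 ltr01) (ltry _).
  rewrite -(fineK Xf) -(fineK Hf) -EFin_expe -EFinM lee_fin.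
  apply: (ler_sqr_addgt0 (ltW c0) x0) => e e0.
  by rewrite -lee_fin fineK// le_e.
have [g [r [gd gr _ _]]] := Xnorm_density ltr01 Xoo.
have iu2 := integrable_solution_sqr hs hb tu ts gd gr.
split; last first.
  by apply: ge_ereal_sup => _ [t /inA t01 <-]; exact: Hle.
have [J J0 hJ] := Hnorm_duhamelB hs hb Cm0 Cm_main tu ts gd gr.
split => [t /inA t01|t0 /inA t001].
  split; first exact: tempered_duhamel.
  exact: le_lt_trans (Hnorm_duhamel hs hb Cm0 Cm_main tu ts gd gr t01) (ltry _).
(* [epsn 0] is 1 and covers any two times in [0, 1], so all the norms of differences are finite and
   [fine] loses nothing. *)
have lt1 t : 0 <= t <= 1 -> `|t - t0| <= epsn 0.
  by move=> t01; rewrite /epsn invr1 ler_norml; move: t01 t001 => /andP[? ?] /andP[? ?]; apply/andP; split; lra.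
apply/fine_cvgP; split.
  rewrite near_withinE; apply: nearW => t /inA t01; rewrite ge0_fin_numE ?Hnorm_ge0//.
  exact: le_lt_trans (hJ 0%N _ _ t01 t001 (lt1 _ t01)) (ltry _).
apply/cvgr0Pnorm_lt => e e0.
have [n _ hn] : \forall n \near \oo, J n < e by apply: (cvgr_lt _ J0).
rewrite near_withinE; apply/nbhs_ballP; exists (epsn n); first exact: epsn_gt0.
move=> t; rewrite /ball/= distrC => tt /inA t01.
have h := hJ n _ _ t01 t001 (ltW tt).
have hf : Hnorm (s + a) (duhamel (nonlin u) t \- duhamel (nonlin u) t0)%R \is a fin_num.
  by rewrite ge0_fin_numE ?Hnorm_ge0//; apply: le_lt_trans h (ltry _).
rewrite ger0_norm ?fine_ge0 ?Hnorm_ge0//; apply: le_lt_trans (hn n (leqnn n)).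
by rewrite -lee_fin fineK.
Qed.
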